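(* Let $B$ be a body. Let $h$ be a tensor field of type $(1,1)$ on $B$ which is $0$-deformable to $u=e^2\otimes e_1+e^3\otimes e_2$, let $\Omega$ be a volume form on $B$, let $\overline{P}$ be the $\overline{G}_{24}$-structure given by $h$ and let $P$ be the $G_{24}$-structure given by $h$ and $\Omega$. Then $\overline{P}$ is integrable if and only if the Nijenhuis tensor $N_h$ of $h$ vanishes. Assuming that $\overline{P}$ is integrable, $P$ is integrable if and only if for an arbitrary system of local coordinates $x^1,x^2,x^3$ adapted to $\overline{P}$ the following conditions hold: $$\mathcal{L}_{\frac{\partial}{\partial x^1}}\Omega=0,\qquad \mathcal{L}_{\frac{\partial}{\partial x^2}}\Omega=0.$$
   Context: A body is a $3$-dimensional smooth manifold which can be covered with one chart. $(e_i)$ is the canonical basis of $\mathbb{R}^3$ and $(e^i)$ its dual basis; $u$ is viewed as the endomorphism of $\mathbb{R}^3$ with $u(e_1)=0$, $u(e_2)=e_1$, $u(e_3)=e_2$ (so $u^3=0$). Up to conjugation, $\overline{G}_{24}\subset GL(3,\mathbb{R})$ is the isotropy group of $u$ (the invertible matrices commuting with $u$) and $G_{24}=\overline{G}_{24}\cap Sl(3,\mathbb{R})$. That $h$ is $0$-deformable to $u$ means that at each point there is a linear frame in which $h$ has the matrix of $u$. $\overline{P}$ is the set of linear frames $(v_1,v_2,v_3)$ with $hv_1=0$, $hv_2=v_1$, $hv_3=v_2$, and $P$ is the set of those frames in $\overline{P}$ with $\Omega(v_1,v_2,v_3)=1$. Coordinates are adapted to a $G$-structure if their coordinate frame is a section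 of it, and a $G$-structure is integrable if adapted local coordinates exist around each point. The Nijenhuis tensor is defined by $\tfrac12N_h(X,Y)=[hX,hY]-h[hX,Y]-h[X,hY]+h^2[X,Y]$. $\mathcal{L}$ denotes the Lie derivative. *)

(* Defs.v *)
From HB Require Import structures.
From mathcomp Require Import all_boot all_order all_algebra.
From mathcomp Require Import all_classical all_reals all_analysis.
From mathcomp Require Import ring.

Set Implicit Arguments.
Unset Strict Implicit.
Unset Printing Implicit Defensive.

Import Order.TTheory GRing.Theory Num.Theory.
Import numFieldNormedType.Exports.

Local Open Scope classical_set_scope.
Local Open Scope ring_scope.

Section Euclidean.
Variables (R : realType).

(* The canonical basis of R^3; indices are shifted by one, so [basis 0] is
   e_1, [basis 1] is e_2 and [basis 2] is e_3. *)
Definition basis (i : 'I_3) : 'cV[R]_3 := delta_mx i 0.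

(* [Ck k A f] is only meant for open [A]: all iterated partial derivatives of
   order at most [k] exist and are continuous on [A]. *)
Fixpoint Ck (V : normedModType R) (k : nat) (A : set 'cV[R]_3)
    (f : 'cV[R]_3 -> V) : Prop :=
  (forall x, A x -> {for x, continuous f}) /\
  if k is k'.+1 then
    forall i, (forall x, A x -> derivable f x (basis i)) /\
              Ck k' A (fun x => 'D_(basis i) f x)
  else True.

Definition Csmooth (V : normedModType R) (A : set 'cV[R]_3)
    (f : 'cV[R]_3 -> V) : Prop :=
  forall k, Ck k A f.

(* u = e^2 (x) e_1 + e^3 (x) e_2, acting on column vectors. *)
Definition u_mx : 'M[R]_3 := delta_mx 0 1 + delta_mx 1 2.

Definition G24bar : set 'M[R]_3 :=
  [set g | g \in unitmx /\ g *m u_mx = u_mx *m g].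

Definition G24 : set 'M[R]_3 := G24bar `&` [set g | \det g = 1].

End Euclidean.

(* A 3-dimensional smooth manifold covered by one chart: a topological space
   with a homeomorphism onto an open subset of R^3, the smooth structure being
   the one generated by this chart. *)
Record body (R : realType) := Body {
  body_space :> topologicalType;
  gchart : body_space -> 'cV[R]_3;
  gchart_inj : injective gchart;
  gchart_open : forall V : set body_space, open V <-> open (gchart @` V)
}.
Arguments gchart {R} b _.

Section Body.
Variables (R : realType) (B : body R).

(* Tangent vectors are given by their components in the frame of the global
   chart. *)
Definition tangent := 'cV[R]_3.

(* The expression of [f] in the global chart, extended by 0 outside the range
   of the chart; only its values on this open range are ever used. *)
Definition in_chart (V : normedModType R) (f : B -> V) : 'cV[R]_3 -> V :=
  fun x => xget 0 [set f p | p in gchart B @^-1` [set x]].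

Lemma in_chartE (V : normedModType R) (f : B -> V) (p : B) :
  in_chart f (gchart B p) = f p.
Proof.
by apply: xget_unique => [|_ [q /gchart_inj -> <-]]; first by exists p.
Qed.

Definition smooth_on (V : normedModType R) (A : set B) (f : B -> V) : Prop :=
  Csmooth (gchart B @` A) (in_chart f).

(* For a function [f], the derivative v(f) at [p]; for a vector field, the
   componentwise derivative of its expression in the global chart. *)
Definition dirder (V : normedModType R) (v : tangent) (f : B -> V) (p : B) : V
  := 'D_v (in_chart f) (gchart B p).

Definition bracket (X Y : B -> tangent) (p : B) : tangent :=
  dirder (X p) Y p - dirder (Y p) X p.

(* A field of endomorphisms of the tangent spaces is given by its matrices in
   the frame of the global chart. *)
Definition tensor11 := B -> 'M[R]_3.

Definition tensor_app (h : tensor11) (X : B -> tangent) : B -> tangent :=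
  fun p => h p *m X p.

Definition nijenhuis (h : tensor11) (X Y : B -> tangent) (p : B) : tangent :=
  let hX := tensor_app h X in
  let hY := tensor_app h Y in
  2 *: (bracket hX hY p - h p *m bracket hX Y p - h p *m bracket X hY p
        + h p *m (h p *m bracket X Y p)).

Definition nijenhuis_vanishes (h : tensor11) : Prop :=
  forall X Y : B -> tangent, smooth_on setT X -> smooth_on setT Y ->
  forall p, nijenhuis h X Y p = 0.

(* The columns of an invertible matrix [F] are the vectors of a linear frame:
   [col 0 F], [col 1 F], [col 2 F] are v_1, v_2, v_3. *)
Definition deformable0 (h : tensor11) (a : 'M[R]_3) : Prop :=
  forall p, exists2 F : 'M[R]_3, F \in unitmx & invmx F *m h p *m F = a.

Definition form3 := B -> tangent -> tangent -> tangent -> R.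

Definition trilinear_alternating (w : tangent -> tangent -> tangent -> R) :=
  [/\ forall a v v' x y, w (a *: v + v') x y = a * w v x y + w v' x y,
      forall a x v v' y, w x (a *: v + v') y = a * w x v y + w x v' y,
      forall a x y v v', w x y (a *: v + v') = a * w x y v + w x y v' &
      forall x y, [/\ w x x y = 0, w x y y = 0 & w x y x = 0]].

Definition volume_form (Omega : form3) : Prop :=
  [/\ forall p, trilinear_alternating (Omega p),
      forall A : set B, open A ->
        forall Y1 Y2 Y3 : B -> tangent,
        smooth_on A Y1 -> smooth_on A Y2 -> smooth_on A Y3 ->
        smooth_on A (fun p => Omega p (Y1 p) (Y2 p) (Y3 p) : R^o) &
      forall p, exists v1 v2 v3, Omega p v1 v2 v3 != 0].

(* (L_X Omega)(Y1, Y2, Y3) at [p]. *)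
Definition lie_form3 (X : B -> tangent) (Omega : form3)
    (Y1 Y2 Y3 : B -> tangent) (p : B) : R :=
  dirder (X p) (fun q => Omega q (Y1 q) (Y2 q) (Y3 q) : R^o) p
  - Omega p (bracket X Y1 p) (Y2 p) (Y3 p)
  - Omega p (Y1 p) (bracket X Y2 p) (Y3 p)
  - Omega p (Y1 p) (Y2 p) (bracket X Y3 p).

(* L_X Omega = 0 on the open set [A], where [X] is a vector field on [A]. *)
Definition lie_form3_vanishes_on (A : set B) (X : B -> tangent)
    (Omega : form3) : Prop :=
  forall Y1 Y2 Y3 : B -> tangent,
  smooth_on A Y1 -> smooth_on A Y2 -> smooth_on A Y3 ->
  forall p, A p -> lie_form3 X Omega Y1 Y2 Y3 p = 0.

(* A diffeomorphism [crd] from the open set [dom] onto an open subset of R^3,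
   with inverse [prm]; values of [crd] outside [dom] and of [prm] outside
   [crd @` dom] are irrelevant. *)
Record local_coordinates := LocalCoordinates {
  dom : set B;
  crd : B -> 'cV[R]_3;
  prm : 'cV[R]_3 -> B;
  dom_open : open dom;
  crd_open : open (crd @` dom);
  crdK : forall p, dom p -> prm (crd p) = p;
  crd_smooth : smooth_on dom crd;
  prm_smooth : Csmooth (crd @` dom) (gchart B \o prm)
}.

(* The vector field d/dx^(i+1) on [dom c]. *)
Definition coord_field (c : local_coordinates) (i : 'I_3) (p : B) : tangent :=
  'D_(basis R i) (gchart B \o prm c) (crd c p).

Definition coord_frame (c : local_coordinates) (p : B) : 'M[R]_3 :=
  \matrix_(i, j) coord_field c j p i 0.

(* A G-structure is represented by its sets of frames at the points of B. *)
Definition frames := B -> set 'M[R]_3.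

Definition adapted (c : local_coordinates) (P : frames) : Prop :=
  forall p, dom c p -> P p (coord_frame c p).

Definition integrable_structure (P : frames) : Prop :=
  forall p, exists c, dom c p /\ adapted c P.

Definition Pbar (h : tensor11) : frames := fun p =>
  [set F | [/\ F \in unitmx, h p *m col 0 F = 0, h p *m col 1 F = col 0 F
             & h p *m col 2 F = col 1 F]].

Definition Pvol (h : tensor11) (Omega : form3) : frames := fun p =>
  Pbar h p `&` [set F | Omega p (col 0 F) (col 1 F) (col 2 F) = 1].

Lemma PbarE (h : tensor11) (p : B) (F : 'M[R]_3) :
  Pbar h p F <-> F \in unitmx /\ h p *m F = F *m u_mx R.
Proof.
have colu i : col i (F *m u_mx R) =
    if i == 0 :> 'I_3 then 0 else if i == 1 :> 'I_3 then col 0 F else col 1 F.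
  apply/colP => k; pose f a : R := F k (inord a).
  have fE j : F k j = f j by rewrite /f inord_val.
  rewrite !mxE !big_ord_recl big_ord0 !mxE !fE.
  by case: i => [] [|[|[|//]]] ? /=; rewrite ?mxE ?fE /=; ring.
have colM i : col i (h p *m F) = h p *m col i F by rewrite !colE mulmxA.
split=> [[uF h0 h1 h2]|[uF hF]].
  split=> //; suff colh i : col i (h p *m F) = col i (F *m u_mx R).
    by apply/matrixP => k i; move/colP/(_ k): (colh i); rewrite !mxE.
  rewrite colu colM.
  case: i => [] [|[|[|//]]] lti /=; set i := Ordinal lti.
  - by rewrite (_ : i = 0) //; apply: val_inj.
  - by rewrite (_ : i = 1) //; apply: val_inj.
  - by rewrite (_ : i = 2) //; apply: val_inj.
by split=> //; rewrite -colM hF colu.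
Qed.

(* [Pbar h p] is an orbit of [G24bar], nonempty when h is 0-deformable to u. *)
Lemma Pbar_orbit (h : tensor11) (p : B) (F F' : 'M[R]_3) :
  Pbar h p F -> Pbar h p F' <-> exists2 g, G24bar g & F' = F *m g.
Proof.
move=> /PbarE[uF hF]; split=> [/PbarE[uF' hF']|[g [ug gu] ->]].
  exists (invmx F *m F'); last by rewrite mulKVmx.
  split; first by rewrite unitmx_mul unitmx_inv uF.
  by rewrite -mulmxA -hF' mulmxA -[F' in LHS](mulKVmx uF) !mulmxA
    -(mulmxA _ (h p)) hF !mulmxA mulVmx // mul1mx.
by apply/PbarE; rewrite unitmx_mul uF ug -mulmxA gu !mulmxA hF.
Qed.

Lemma Pbar_nonempty (h : tensor11) :
  deformable0 h (u_mx R) <-> forall p, exists F, Pbar h p F.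
Proof.
split=> H p; have := H p => -[F].
  by move=> uF hF; exists F; apply/PbarE; rewrite -hF !mulmxA mulmxV // mul1mx.
by move=> /PbarE[uF hF]; exists F => //; rewrite -mulmxA hF mulKmx.
Qed.

Lemma det3 (g : 'M[R]_3) : \det g =
  g 0 0 * (g 1 1 * g 2 2 - g 1 2 * g 2 1)
  - g 0 1 * (g 1 0 * g 2 2 - g 1 2 * g 2 0)
  + g 0 2 * (g 1 0 * g 2 1 - g 1 1 * g 2 0).
Proof.
pose f a b : R := g (inord a) (inord b).
have fE i j : g i j = f i j by rewrite /f !inord_val.
rewrite (expand_det_row _ 0) !big_ord_recl big_ord0 /cofactor.
rewrite !(expand_det_row _ 0) !big_ord_recl !big_ord0 /cofactor !det_mx11 !mxE.
by rewrite !fE /= /bump /=; ring.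
Qed.

Lemma trilinear_alternating_det w (F g : 'M[R]_3) : trilinear_alternating w ->
  w (col 0 (F *m g)) (col 1 (F *m g)) (col 2 (F *m g)) =
  \det g * w (col 0 F) (col 1 F) (col 2 F).
Proof.
move=> [l1 l2 l3 alt].
have colg i : col i (F *m g) = g 0 i *: col 0 F + (g 1 i *: col 1 F
    + (g 2 i *: col 2 F + 0)).
  apply/colP => k; pose f a : R := F k (inord a).
  have fE j : F k j = f j by rewrite /f inord_val.
  pose f' a : R := g (inord a) i.
  have fE' j : g j i = f' j by rewrite /f' inord_val.
  by rewrite !mxE !big_ord_recl big_ord0 !fE !fE' /= /bump /=; ring.
have w1 x y : w 0 x y = 0.
  by have := l1 (-1) 0 0 x y; rewrite scaler0 addr0 mulN1r addNr.
have w2 x y : w x 0 y = 0.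
  by have := l2 (-1) x 0 0 y; rewrite scaler0 addr0 mulN1r addNr.
have w3 x y : w x y 0 = 0.
  by have := l3 (-1) x y 0 0; rewrite scaler0 addr0 mulN1r addNr.
have a1 x y : w x x y = 0 by case: (alt x y).
have a2 x y : w x y y = 0 by case: (alt x y).
have a3 x y : w x y x = 0 by case: (alt x y).
have s12 x y z : w y x z = - w x y z.
  apply/eqP; rewrite -addr_eq0 addrC; have := a1 (1 *: x + y) z.
  by rewrite !(l1, l2) !a1 !mul1r add0r addr0 => ->.
have s23 x y z : w x z y = - w x y z.
  apply/eqP; rewrite -addr_eq0 addrC; have := a2 x (1 *: y + z).
  by rewrite !(l2, l3) !a2 !mul1r add0r addr0 => ->.
rewrite !colg; set a := col 0 F; set b := col 1 F; set c := col 2 F.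
rewrite !(l1, l2, l3) !(w1, w2, w3) !(a1, a2, a3).
rewrite (s12 a b c) (s23 a b c) (s12 a c b) (s23 b a c) (s12 b c a) (s23 b a c).
by rewrite (s23 a b c) (s12 a b c) det3; ring.
Qed.

(* [Pvol h Omega p] is an orbit of [G24]. *)
Lemma Pvol_orbit (h : tensor11) (Omega : form3) (p : B) (F F' : 'M[R]_3) :
  volume_form Omega -> Pvol h Omega p F ->
  Pvol h Omega p F' <-> exists2 g, G24 g & F' = F *m g.
Proof.
move=> [/(_ p) Op _ _] [PF OF]; split.
  move=> [/(Pbar_orbit _ PF)[g Gg ->] /=].
  by rewrite (trilinear_alternating_det _ _ Op) OF mulr1 => dg; exists g.
move=> [g [Gg dg] ->]; split; first by apply/(Pbar_orbit _ PF); exists g.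
by rewrite /= (trilinear_alternating_det _ _ Op) OF mulr1.
Qed.

End Body.

(* Main.v *)
(* In a chart, [N_h = 0] says that
   [(D_(hv) h) w - (D_(hw) h) v + h (D_w h) v - h (D_v h) w = 0], a tensorial
   expression that vanishes for constant [h]. Conversely, for a 1-form [theta], put
   [phi = theta h] and [chi = phi h]; then
   [dtheta(hv, hw) - dphi(hv, w) - dphi(v, hw) + dchi(v, w) = - theta(N_h(v, w)) / 2].
   With [phi = chi = 0] this makes the image of [h] an integrable plane field, with
   leaves [x3 = cst]; along these leaves it then yields by quadrature functions with
   [dx2 h = dx3] and [dx1 h = dx2].

   Adapted coordinates of [Pbar] differ by maps whose Jacobian matrix commutes with
   [u]: it is Toeplitz with diagonal entry [k = dy3/dx3], and [y3] depends on [x3]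
   only. The component [omega] of [Omega] in such coordinates is therefore [k^3] if
   the [y]'s are adapted to [P], and [L_(d/dx_i) Omega = (d omega/dx_i) dx] vanishes
   for [i = 1, 2]. Conversely, if [omega] depends on [x3] only and [c^3 = omega], then
   [y = (c x1 + c' x2^2 / 2, c x2, primitive of c)] is adapted to [P]. *)
Require Import Defs.
From HB Require Import structures.
From mathcomp Require Import all_boot all_order all_algebra.
From mathcomp Require Import all_classical all_reals all_analysis.
From mathcomp Require Import ring lra.

Set Implicit Arguments.
Unset Strict Implicit.
Unset Printing Implicit Defensive.

Import Order.TTheory GRing.Theory Num.Theory.
Import numFieldNormedType.Exports.

Local Open Scope classical_set_scope.
Local Open Scope ring_scope.

(** * Differential calculus on R^3 *)

Section Lines.
Context {R : realType}.
Implicit Types W : normedModType R.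

(** The relation $\theta h=\phi$ determines $\theta$ only on the image of $h$. Once the leaves are
    the planes $x^3=cst$, the last row of $h$ is zero: the third component of $\theta$ is free,
    closedness is available only along the leaves, and a leafwise primitive $X$ of the other two
    components already satisfies $dX\,h=\phi$, whatever its derivative in $x^3$. So quadratures with
    $x^3$ as a parameter suffice, and $dx^2$ must come before $dx^1$, whose right-hand side contains
    the $x^3$-derivative of the second coordinate.

    The leaves are graphs $x^3=Z(x^1,x^2,z)$, and $(x^1,x^2,z)$ has to be a smooth chart. Hence the
    analytic core is a scalar differential equation with smooth dependence on parameters and initial
    value, together with the inverse function theorem. As smoothness is defined by iterated partial
    derivatives along the axes, both are proved by induction on the order, from explicit formulas
    for the partial derivatives.

    The cube root of the density exists for either orientation of the coordinates because 3 is
    odd. *)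

Lemma is_derive_line W (f : W -> R) x v (t df : R) :
  is_derive (t *: v + x) v f df -> is_derive t 1 (fun s : R => f (s *: v + x)) df.
Proof.
move=> [dv vE]; have E : (fun h : R => h^-1 *: (f (h *: v + (t *: v + x)) - f (t *: v + x)))
   = (fun h : R => h^-1 *: (((fun s : R => f (s *: v + x)) \o shift t) (h *: 1)
        - f (t *: v + x))).
  by apply/funext => h /=; rewrite /shift /= scalerDl -addrA /GRing.scale /= mulr1.
by split; [move: dv; rewrite /derivable /= E|
  move: vE; rewrite /derive /= E].
Qed.

Lemma is_derive_dirZ W (W' : normedModType R) (f : W -> W') x v c df :
  is_derive x v f df -> is_derive x (c *: v) f (c *: df).
Proof.
move=> [dv vE]; have [->|c0] := eqVneq c 0; first by rewrite !scale0r; exact: is_derive0.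
have L : h^-1 *: (f (h *: (c *: v) + x) - f x) @[h --> 0^'] --> c *: df.
  have -> : (fun h : R => h^-1 *: (f (h *: (c *: v) + x) - f x)) =
      (fun h : R => c *: ((fun k : R => k^-1 *: (f (k *: v + x) - f x)) (h * c))).
    apply/funext => h; rewrite /= !scalerA invfM.
    by rewrite mulrCA mulfV ?mulr1.
  have {}dv : h^-1 *: (f (h *: v + x) - f x) @[h --> 0^'] --> df.
    by rewrite -vE; exact: dv.
  apply: cvgZl_tmp; apply/cvgrPdist_le => e e0.
  move/cvgrPdist_le : dv => /(_ e e0)[/= r r0 rH].
  exists (r / `|c|) => /=; first by rewrite divr_gt0 ?normr_gt0.
  move=> h /=; rewrite !sub0r !normrN ltr_pdivlMr ?normr_gt0// => hr h0.
  by apply: rH => /=; rewrite ?sub0r ?normrN ?normrM ?mulf_neq0.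
by split; [apply/cvg_ex; exists (c *: df)|apply/cvg_lim].
Qed.

(** Only derivatives in the direction [v] at points of the segment enter, so functions known merely
    to have partial derivatives are covered. *)
Lemma line_MVT W (f df : W -> R) x v :
  (forall t, 0 <= t <= 1 -> is_derive (t *: v + x) v f (df (t *: v + x))) ->
  exists2 t, 0 <= t <= 1 & f (v + x) - f x = df (t *: v + x).
Proof.
move=> H; have Hd (t : R) : 0 <= t <= 1 ->
    is_derive t 1 (fun s : R => f (s *: v + x)) (df (t *: v + x)).
  by move=> ?; exact/is_derive_line/H.
have D (t : R) : t \in `]0, 1[%R ->
    is_derive t 1 (fun s : R => f (s *: v + x)) (df (t *: v + x)).
  by rewrite in_itv /= => /andP[t0 t1]; apply: Hd; rewrite !ltW.
have C : {within `[0, 1], continuous (fun s : R => f (s *: v + x))}.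
  apply: derivable_within_continuous => t; rewrite in_itv /= => t01.
  by have [] := Hd _ t01.
have [t] := MVT_segment ler01 D C.
rewrite in_itv /= subr0 mulr1 scale0r add0r scale1r => t01 ->.
by exists t.
Qed.

Lemma is_derive_comp1 W (f : W -> R) (phi : R -> R) x v df dphi :
  is_derive x v f df -> is_derive (f x) 1 phi dphi ->
  is_derive x v (fun y => phi (f y)) (dphi * df).
Proof.
move=> [dv vE] [dp pE].
have F1 : derivable (fun t : R => f (t *: v + x)) 0 1.
  exact: (derivable1P f x v).1 dv.
have F0 : f (0 *: v + x) = f x by rewrite scale0r add0r.
have dp' : derivable phi (f (0 *: v + x)) 1.
  by rewrite F0; exact: dp.
split.
  apply/derivable1P; apply/derivable1_diffP.
  by apply: (@differentiable_comp _ _ _ _ (fun t : R => f (t *: v + x)) phi);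
    [exact: (derivable1_diffP _ _).1 F1|exact: (derivable1_diffP _ _).1 dp'].
have lineD (g : W -> R) : 'D_v g x = derive1 (fun t : R => g (t *: v + x)) 0.
  rewrite derive1E /derive.
  suff -> : (fun h : R => h^-1 *: ((g \o shift x) (h *: v) - g x)) =
    (fun h : R => h^-1 *: (((fun t : R => g (t *: v + x)) \o shift 0) (h *: 1)
       - g (0 *: v + x))) by [].
  apply/funext => h /=.
  by rewrite /shift /= addr0 scale0r add0r [h *: 1]mulr1.
rewrite lineD (derive1_comp F1 dp').
by rewrite F0 -lineD vE derive1E pE.
Qed.

End Lines.

Section MatrixNorm.
Context {R : realType}.

Lemma mx_coord_le m n (x : 'M[R]_(m, n)) i j : `|x i j| <= `|x|.
Proof.
rewrite [leRHS]/Num.Def.normr/= mx_normrE.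
exact: (le_bigmax _ (fun ij => `|x ij.1 ij.2|) (i, j)).
Qed.

Lemma mx_norm_le m n (x : 'M[R]_(m, n)) c :
  0 <= c -> (forall i j, `|x i j| <= c) -> `|x| <= c.
Proof.
move=> c0 H; rewrite [leLHS]/Num.Def.normr/= mx_normrE.
by apply: bigmax_le => // -[i j] _ /=.
Qed.

Lemma continuous_mxP (T : topologicalType) m n (G : T -> 'M[R]_(m, n)) x :
  (forall i j, {for x, continuous (fun y => G y i j)}) ->
  {for x, continuous G}.
Proof.
move=> H; apply/cvgrPdist_le => e e0; near=> y.
apply: mx_norm_le (ltW e0) _ => i j; rewrite !mxE.
move: i j; near: y; apply: filter_forall => i; apply: filter_forall => j.
by move/cvgrPdist_le : (H i j) => /(_ e e0).
Unshelve. all: by end_near. Qed.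

End MatrixNorm.

(** * Taylor expansion of order one and the chain rule *)

Section Calculus.
Context {R : realType}.
Local Notation V := 'cV[R]_3.
Local Notation e i := (Defs.basis R i).
Implicit Types (A : set V) (x : V).

Lemma basisE (i j : 'I_3) : e i j 0 = (j == i)%:R.
Proof. by rewrite mxE eqxx andbT. Qed.

Lemma forall_ord3 (P : 'I_3 -> Prop) : P 0 -> P 1 -> P 2 -> forall i, P i.
Proof.
move=> P0 P1 P2 [[|[|[|//]]] Hi]; set i := Ordinal Hi.
- by rewrite (_ : i = 0) //; apply/val_inj.
- by rewrite (_ : i = 1) //; apply/val_inj.
- by rewrite (_ : i = 2) //; apply/val_inj.
Qed.

Lemma sum3 (U : nmodType) (F : 'I_3 -> U) : \sum_i F i = F 0 + F 1 + F 2.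
Proof.
rewrite !big_ord_recr big_ord0 /= add0r; congr (F _ + F _ + F _); exact/val_inj.
Qed.

Lemma cV3E (x : V) : x = x 0 0 *: e 0 + x 1 0 *: e 1 + x 2 0 *: e 2.
Proof.
by apply/colP; apply: forall_ord3; rewrite !mxE !eqxx /= !mulr1 !mulr0; lra.
Qed.

Lemma open_ball A x : open A -> A x ->
  exists2 d : R, 0 < d & forall y, `|y - x| < d -> A y.
Proof.
move=> oA Ax; have /nbhs_ballP[d /= d0 dA] : nbhs x A by apply: open_nbhs_nbhs.
by exists d => // y yx; apply: dA; rewrite -ball_normE /= distrC.
Qed.

Lemma near_ball A x : nbhs x A -> exists2 d : R, 0 < d & forall y, `|y - x| < d -> A y.
Proof.
move=> /nbhs_ballP[d /= d0 dA].
by exists d => // y yx; apply: dA; rewrite -ball_normE /= distrC.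
Qed.

Lemma ler_norm3 (a b c k : R) : `|a| <= k / 3 -> `|b| <= k / 3 ->
  `|c| <= k / 3 -> `|a + b + c| <= k.
Proof. by rewrite !ler_norml; lra. Qed.

(** From [x] to [h + x] one moves along the axes one at a time. The mean value theorem on each edge
    gives a partial derivative at a nearby point, which continuity replaces by its value at [x] up
    to [eps / 3]. *)
Lemma C1_taylor A (f : V -> R) x : open A -> Ck 1 A f -> A x ->
  forall eps : R, 0 < eps -> exists2 d : R, 0 < d & forall h : V, `|h| < d ->
   `|f (h + x) - f x - \sum_i h i 0 * 'D_(e i) f x| <= eps * `|h|.
Proof.
move=> oA [_ Cf] Ax eps eps0.
have eps3 : 0 < eps / 3 by rewrite divr_gt0.
have N1 : \forall y \near x, A y by apply: open_nbhs_nbhs.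
have N2 : \forall y \near x, forall i, `|'D_(e i) f x - 'D_(e i) f y| <= eps / 3.
  have H i : \forall y \near x, `|'D_(e i) f x - 'D_(e i) f y| <= eps / 3.
    have [_ [/(_ _ Ax) Ci _]] := Cf i.
    by move/cvgrPdist_le : Ci => /(_ _ eps3).
  exact: (@filter_forall _ _ _ _ (nbhs_filter x) H).
have [d d0 Hd] := near_ball (filterI N1 N2); exists d => // h hd.
(* [g] holds the coordinates already moved. In the max norm no point of the edge is farther from [x]
   than the norm of [h], so the edge stays in the ball of radius [d]. *)
have step i (g : V) : (forall j, `|g j 0| <= `|h|) -> g i 0 = 0 ->
  `|f (h i 0 *: e i + (g + x)) - f (g + x) - h i 0 * 'D_(e i) f x|
     <= eps * `|h| / 3.
  move=> gh gi; have inb t : 0 <= t <= 1 ->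
      `|t *: (h i 0 *: e i) + (g + x) - x| < d.
    move=> /andP[t0 t1]; apply: le_lt_trans hd; rewrite addrA addrK.
    apply: mx_norm_le => // j k; rewrite (ord1 k) !mxE eqxx andbT.
    have [->|] := eqVneq j i; last by rewrite !mulr0 add0r gh.
    rewrite gi addr0 mulr1 normrM (ger0_norm t0).
    apply: le_trans (mx_coord_le h i 0); exact: ler_piMl.
  have [t t01 E] := @line_MVT R _ f (fun y => h i 0 * 'D_(e i) f y) (g + x)
     (h i 0 *: e i) (fun t t01 => is_derive_dirZ _
       (derivableP ((Cf i).1 _ (Hd _ (inb t t01)).1))).
  rewrite mulrAC E -mulrBr normrM mulrC ler_pM//; last exact: mx_coord_le.
  by rewrite distrC (Hd _ (inb t t01)).2.
pose g1 : V := h 0 0 *: e 0; pose g2 := h 1 0 *: e 1 + g1.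
have s0 := step 0 0; have s1 := step 1 g1; have s2 := step 2 g2.
have {}s0 := s0 (fun j => _) _.
have E1 : h 0 0 *: e 0 + (0 + x) = g1 + x by rewrite add0r.
have E2 : h 1 0 *: e 1 + (g1 + x) = g2 + x by rewrite addrA.
have E3 : h 2 0 *: e 2 + (g2 + x) = h + x.
  by rewrite [in RHS](cV3E h) addrA /g2 /g1; congr (_ + x); rewrite addrC [h 1 0 *: _ + _]addrC.
rewrite E1 add0r in s0; rewrite E2 in s1; rewrite E3 in s2.
have b0 : `|f (g1 + x) - f x - h 0 0 * 'D_(e 0) f x| <= eps * `|h| / 3.
  by apply: s0; [move=> j|]; rewrite ?mxE ?normr0.
have b1 : `|f (g2 + x) - f (g1 + x) - h 1 0 * 'D_(e 1) f x| <= eps * `|h| / 3.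
  apply: s1; last by rewrite !mxE mulr0.
  by apply: forall_ord3; rewrite !mxE /= ?mulr1 ?mulr0 ?normr0 // mx_coord_le.
have b2 : `|f (h + x) - f (g2 + x) - h 2 0 * 'D_(e 2) f x| <= eps * `|h| / 3.
  apply: s2; last by rewrite !mxE !mulr0 addr0.
  by apply: forall_ord3; rewrite !mxE /= ?mulr1 ?mulr0 ?normr0 ?add0r ?addr0 ?normr0 // mx_coord_le.
rewrite sum3; have := ler_norm3 b0 b1 b2.
move=> /(le_trans _); apply.
move: (f _) (f _) (f _) (f _) ('D_ _ f _) ('D_ _ f _) ('D_ _ f _) => *.
by rewrite le_eqVlt; apply/orP; left; apply/eqP; congr `|_|; ring.
Qed.

(** The expansion of [f] at [G x] is applied to the increment [h *: q], with [q] the difference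
    quotient of [G] along [v]. *)
Lemma is_derive_comp (W : normedModType R) A (f : V -> R) (G : W -> V) (x v : W) dG :
  open A -> Ck 1 A f -> A (G x) -> is_derive x v G dG ->
  is_derive x v (fun y => f (G y)) (\sum_i dG i 0 * 'D_(e i) f (G x)).
Proof.
move=> oA C1 AG [dv vE]; set L := \sum_i _.
suff H : h^-1 *: (f (G (h *: v + x)) - f (G x)) @[h --> 0^'] --> L.
  by split; [apply/cvg_ex; exists L|apply/cvg_lim].
have {}dv : h^-1 *: (G (h *: v + x) - G x) @[h --> 0^'] --> dG by rewrite -vE.
apply/cvgrPdist_le => eps eps0.
(* [M] bounds [q], which ends up within 1 of [dG], and [S] bounds the sum of the partial
   derivatives; adding 1 makes it positive. Half of [eps] goes to the Taylor remainder, half to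
   [dG - q]. *)
pose M := `|dG| + 1; have M0 : 0 < M by rewrite ltr_wpDl.
pose S := \sum_i `|'D_(e i) f (G x)| + 1.
have S0 : 0 < S by rewrite ltr_wpDl // sumr_ge0.
have [d d0 Hd] := C1_taylor oA C1 AG (divr_gt0 eps0 (mulr_gt0 (ltr0Sn R 1) M0)).
have m0 : 0 < Num.min 1 (eps / (2 * S)) by rewrite lt_min ltr01 divr_gt0 ?mulr_gt0.
have near1 := dv; move/cvgrPdist_le : near1 => /(_ _ m0) near1.
have dM : 0 < d / M by rewrite divr_gt0.
near=> h.
have h0 : h != 0 by near: h; exact: nbhs_dnbhs_neq.
have hd : `|h| < d / M by near: h; exact: dnbhs0_lt.
have : `|dG - h^-1 *: (G (h *: v + x) - G x)| <= Num.min 1 (eps / (2 * S)).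
  by near: h; exact: near1.
set q := h^-1 *: (G (h *: v + x) - G x).
rewrite le_min => /andP[q1 q2].
have qM : `|q| <= M.
  rewrite -[q](subKr dG) (le_trans (ler_normB _ _)) // lerD2l //.
have kE : G (h *: v + x) = h *: q + G x by rewrite /q scalerKV // subrK.
clearbody q; have hq : `|h *: q| < d.
  by rewrite normrZ (le_lt_trans (ler_wpM2l _ qM)) // -ltr_pdivlMr.
have := Hd _ hq; rewrite -kE => B.
have E : h^-1 *: (f (G (h *: v + x)) - f (G x)) =
   h^-1 * (f (G (h *: v + x)) - f (G x) - \sum_i (h *: q) i 0 * 'D_(e i) f (G x))
   + \sum_i q i 0 * 'D_(e i) f (G x).
  rewrite mulrBr /GRing.scale /= -[LHS](subrK (\sum_i q i 0 * 'D_(e i) f (G x))).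
  congr (_ - _ + _); rewrite mulr_sumr; apply: eq_bigr => i _.
  by rewrite mxE !mulrA mulVf // mul1r.
rewrite E opprD addrCA (le_trans (ler_normD _ _)) // [eps]splitr lerD //.
  rewrite normrN normrM normfV ler_pdivrMl ?normr_gt0 //.
  apply: le_trans B _; rewrite normrZ mulrCA; apply: ler_wpM2l => //.
  have -> : eps / (2 * M) * `|q| = eps / 2 * (`|q| / M).
    by rewrite invfM !mulrA [in RHS]mulrAC.
  apply: ler_piMr; first by rewrite divr_ge0 // ltW.
  by rewrite ler_pdivrMr ?mul1r.
rewrite -sumrB (le_trans (ler_norm_sum _ _ _)) //.
apply: (@le_trans _ _ (\sum_i `|dG - q| * `|'D_(e i) f (G x)|)).
  apply: ler_sum => i _; rewrite -mulrBl normrM ler_wpM2r //.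
  by apply: le_trans (mx_coord_le _ i 0); rewrite !mxE.
rewrite -mulr_sumr; apply: (@le_trans _ _ (eps / (2 * S) * S)).
  by apply: ler_pM => //; [exact: sumr_ge0|rewrite lerDl].
by rewrite invfM mulrA divfK // gt_eqF.
Unshelve. all: by end_near. Qed.

End Calculus.

(** * Calculus of functions of class C^k and symmetry of second derivatives *)

Section CkRules.
Context {R : realType}.
Local Notation V := 'cV[R]_3.
Local Notation e i := (Defs.basis R i).
Implicit Types (A : set V) (x : V).

Lemma Ck_continuous (W : normedModType R) k A (f : V -> W) x :
  Ck k A f -> A x -> {for x, continuous f}.
Proof. by case: k => [|k] [cf _]; exact: cf. Qed.

Lemma Ck_near A (W : Type) (f g : V -> W) x : open A -> A x ->
  (forall y, A y -> f y = g y) -> \forall y \near x, f y = g y.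
Proof. by move=> oA Ax fg; apply: filterS fg _; exact: open_nbhs_nbhs. Qed.

Lemma Ck_ext (W : normedModType R) k A (f g : V -> W) : open A ->
  (forall x, A x -> f x = g x) -> Ck k A f -> Ck k A g.
Proof.
move=> oA; elim: k f g => [|k IH] f g fg [cf Hf]; split.
- move=> x Ax; rewrite /prop_for /continuous_at -(fg _ Ax).
  exact: cvg_trans (near_eq_cvg (Ck_near oA Ax fg)) (cf _ Ax).
- by [].
- move=> x Ax; rewrite /prop_for /continuous_at -(fg _ Ax).
  exact: cvg_trans (near_eq_cvg (Ck_near oA Ax fg)) (cf _ Ax).
- move=> i; have [df Cf] := Hf i; split.
    move=> x Ax; exact: (near_eq_derivable (Ck_near oA Ax fg) (df _ Ax)).
  apply: IH Cf => x Ax; exact: (near_eq_derive _ (Ck_near oA Ax fg)).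
Qed.

Lemma Ck_S (W : normedModType R) k A (f : V -> W) : Ck k.+1 A f -> Ck k A f.
Proof.
elim: k f => [|k IH] f [cf Hf]; split=> // i.
by have [df Cf] := Hf i; split=> //; exact: IH.
Qed.

Lemma Ck_le (W : normedModType R) k k' A (f : V -> W) :
  (k <= k')%N -> Ck k' A f -> Ck k A f.
Proof.
elim: k' => [|k' IH]; first by rewrite leqn0 => /eqP ->.
by rewrite leq_eqVlt => /predU1P[->//|/IH H /Ck_S].
Qed.

Lemma Ck_sub (W : normedModType R) k A B (f : V -> W) :
  A `<=` B -> Ck k B f -> Ck k A f.
Proof.
move=> AB; elim: k f => [|k IH] f [cf Hf]; split=> //; first by move=> x /AB/cf.
  by move=> x /AB/cf.
by move=> i; have [df Cf] := Hf i; split=> [x /AB/df//|]; exact: IH.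
Qed.

Lemma Ck_derive (W : normedModType R) k A (f : V -> W) i :
  Ck k.+1 A f -> Ck k A ('D_(e i) f).
Proof. by move=> [_ /(_ i)[]]. Qed.

Lemma Csmooth_derive (W : normedModType R) A (f : V -> W) i :
  Csmooth A f -> Csmooth A ('D_(e i) f).
Proof. by move=> Cf k; exact: Ck_derive (Cf k.+1). Qed.

Lemma Ck_is_derive (W : normedModType R) k A (f : V -> W) x i :
  Ck k.+1 A f -> A x -> is_derive x (e i) f ('D_(e i) f x).
Proof. by move=> [_ /(_ i)[df _]] Ax; exact/derivableP/df. Qed.

(** Introduction rule for the inductions on the order below: once the partial derivatives are given
    in closed form, it remains to see that these are of class C^k. *)
Lemma CkS_intro (W : normedModType R) k A (f : V -> W) (df : 'I_3 -> V -> W) :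
  open A -> (forall x, A x -> {for x, continuous f}) ->
  (forall i x, A x -> is_derive x (e i) f (df i x)) ->
  (forall i, Ck k A (df i)) -> Ck k.+1 A f.
Proof.
move=> oA cf H Cdf; split=> // i; split=> [x Ax|]; first by case: (H i x Ax).
by apply: Ck_ext (Cdf i) => // x Ax; case: (H i x Ax).
Qed.

Lemma Ck_cst (W : normedModType R) k A (c : W) : open A -> Ck k A (fun=> c).
Proof.
move=> oA; elim: k c => [|k IH] c.
  by split=> // x _; exact: cst_continuous.
apply: (CkS_intro (df := fun _ _ => 0)) => //.
by move=> x _; exact: cst_continuous.
Qed.

Lemma is_derive_coord (W : normedModType R) m n (G : W -> 'M[R]_(m, n)) (x v : W) dG i j :
  is_derive x v G dG -> is_derive x v (fun y => G y i j) (dG i j).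
Proof.
move=> [dG1 <-]; have dGij := (derivable_mxP G x v).1 dG1.
by split; [exact: dGij|rewrite derive_mx // mxE].
Qed.

Lemma is_derive_mx (W : normedModType R) m n (G : W -> 'M[R]_(m, n)) (x v : W) (dG : 'M[R]_(m, n)) :
  (forall i j, is_derive x v (fun y => G y i j) (dG i j)) -> is_derive x v G dG.
Proof.
move=> H; have d : derivable G x v by apply/derivable_mxP => i j; case: (H i j).
split=> //; rewrite derive_mx //; apply/matrixP => i j; rewrite mxE.
by case: (H i j).
Qed.

Lemma Ck_coord k A i : open A -> Ck k A (fun x : V => x i 0).
Proof.
move=> oA; have c x : {for x, continuous (fun x : V => x i 0)}.
  exact: coord_continuous.
case: k => [|k]; first by split=> // x _; exact: c.
apply: (CkS_intro (df := fun j _ => (e j) i 0)) => //.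
- by move=> j y _; apply: (is_derive_coord (G := id)).
- by move=> j; exact: Ck_cst.
Qed.

Lemma CkD (W : normedModType R) k A (f g : V -> W) : open A -> Ck k A f -> Ck k A g ->
  Ck k A (fun x => f x + g x).
Proof.
move=> oA; elim: k f g => [|k IH] f g Cf Cg.
  split=> // x Ax; exact: (cvgD (Ck_continuous Cf Ax) (Ck_continuous Cg Ax)).
apply: (CkS_intro (df := fun i x => 'D_(e i) f x + 'D_(e i) g x)) => //.
- by move=> x Ax; exact: (cvgD (Ck_continuous Cf Ax) (Ck_continuous Cg Ax)).
- by move=> i x Ax; exact: (is_deriveD (Ck_is_derive _ Cf Ax) (Ck_is_derive _ Cg Ax)).
- by move=> i; apply: IH; exact: Ck_derive.
Qed.

Lemma CkM k A (f g : V -> R) : open A -> Ck k A f -> Ck k A g ->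
  Ck k A (fun x => f x * g x).
Proof.
move=> oA; elim: k f g => [|k IH] f g Cf Cg.
  split=> // x Ax; exact: (cvgM (Ck_continuous Cf Ax) (Ck_continuous Cg Ax)).
apply: (CkS_intro (df := fun i x => f x * 'D_(e i) g x + g x * 'D_(e i) f x)) => //.
- by move=> x Ax; exact: (cvgM (Ck_continuous Cf Ax) (Ck_continuous Cg Ax)).
- by move=> i x Ax; exact: (is_deriveM (Ck_is_derive _ Cf Ax) (Ck_is_derive _ Cg Ax)).
- by move=> i; apply: CkD => //; apply: IH; do ?[exact: Ck_derive|exact: Ck_S].
Qed.

Lemma CkZ k A c (f : V -> R) : open A -> Ck k A f -> Ck k A (fun x => c * f x).
Proof. by move=> oA; apply: CkM => //; exact: Ck_cst. Qed.

Lemma CkN k A (f : V -> R) : open A -> Ck k A f -> Ck k A (fun x => - f x).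
Proof.
move=> oA /(CkZ (-1) oA); apply: Ck_ext => // x _; exact: mulN1r.
Qed.

Lemma CkB k A (f g : V -> R) : open A -> Ck k A f -> Ck k A g ->
  Ck k A (fun x => f x - g x).
Proof. by move=> oA Cf Cg; apply: CkD => //; exact: CkN. Qed.

Lemma Ck_sum k A (I : Type) (s : seq I) (P : pred I) (f : I -> V -> R) : open A ->
  (forall i, Ck k A (f i)) -> Ck k A (fun x => \sum_(i <- s | P i) f i x).
Proof.
move=> oA Cf; elim: s => [|i s IH].
  by apply: Ck_ext (Ck_cst k (0 : R) oA) => // x _; rewrite big_nil.
case Pi : (P i); last by apply: Ck_ext IH => // x _; rewrite big_cons Pi.
by apply: Ck_ext (CkD oA (Cf i) IH) => // x _; rewrite big_cons Pi.
Qed.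

Lemma Ck_prod k A (I : Type) (s : seq I) (P : pred I) (f : I -> V -> R) : open A ->
  (forall i, Ck k A (f i)) -> Ck k A (fun x => \prod_(i <- s | P i) f i x).
Proof.
move=> oA Cf; elim: s => [|i s IH].
  by apply: Ck_ext (Ck_cst k (1 : R) oA) => // x _; rewrite big_nil.
case Pi : (P i); last by apply: Ck_ext IH => // x _; rewrite big_cons Pi.
by apply: Ck_ext (CkM oA (Cf i) IH) => // x _; rewrite big_cons Pi.
Qed.

Lemma CkV k A (f : V -> R) : open A -> (forall x, A x -> f x != 0) ->
  Ck k A f -> Ck k A (fun x => (f x)^-1).
Proof.
move=> oA f0; elim: k f f0 => [|k IH] f f0 Cf.
  by split=> // x Ax; exact: (cvgV (f0 _ Ax) (Ck_continuous Cf Ax)).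
have H := IH _ f0 (Ck_S Cf).
apply: (CkS_intro (df := fun i x => (- 1 * ((f x)^-1 * (f x)^-1)) * 'D_(e i) f x)) => //.
- by move=> x Ax; exact: (cvgV (f0 _ Ax) (Ck_continuous Cf Ax)).
- move=> i x Ax; have [d _] := Ck_is_derive i Cf Ax.
  split; first by apply: derivableV => //; exact: f0.
  rewrite deriveV //; last exact: f0.
  by rewrite mulN1r -expr2 exprVn.
- by move=> i; do ?[apply: CkM => //]; do ?[exact: Ck_cst|exact: Ck_derive].
Qed.

Lemma Ck_exp k A (f : V -> R) : open A -> Ck k A f -> Ck k A (fun x => expR (f x)).
Proof.
move=> oA; elim: k f => [|k IH] f Cf; have c x : A x ->
    {for x, continuous (fun x => expR (f x))}.
- by move=> Ax; apply: (@continuous_comp _ _ _ f expR);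
    [exact: Ck_continuous Cf Ax|exact: continuous_expR].
- by split.
- by move=> Ax; apply: (@continuous_comp _ _ _ f expR);
    [exact: Ck_continuous Cf Ax|exact: continuous_expR].
apply: (CkS_intro (df := fun i x => expR (f x) * 'D_(e i) f x)) => //.
  move=> i x Ax.
  exact: (is_derive_comp1 (Ck_is_derive i Cf Ax) (is_derive_expR _)).
by move=> i; apply: CkM => //; [exact/IH/Ck_S|exact: Ck_derive].
Qed.

Lemma Ck_ln k A (f : V -> R) : open A -> (forall x, A x -> 0 < f x) ->
  Ck k A f -> Ck k A (fun x => ln (f x)).
Proof.
move=> oA f0 Cf; have c x : A x -> {for x, continuous (fun x => ln (f x))}.
  by move=> Ax; apply: (@continuous_comp _ _ _ f (@ln R));
    [exact: Ck_continuous Cf Ax|apply: continuous_ln; exact: f0].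
case: k Cf => [|k] Cf; first by split.
apply: (CkS_intro (df := fun i x => (f x)^-1 * 'D_(e i) f x)) => //.
  move=> i x Ax.
  exact: (is_derive_comp1 (Ck_is_derive i Cf Ax) (is_derive1_ln (f0 _ Ax))).
move=> i; apply: CkM => //; last exact: Ck_derive.
by apply: CkV => //; [move=> x /f0/lt0r_neq0|exact: Ck_S].
Qed.

Lemma Ck_mxP k A m n (G : V -> 'M[R]_(m, n)) : open A ->
  Ck k A G <-> forall i j, Ck k A (fun x => G x i j).
Proof.
move=> oA; elim: k G => [|k IH] G; split.
- move=> [cG _] i j; split=> // x Ax.
  apply: (@continuous_comp _ _ _ G (fun M => M i j)); first exact: cG.
  exact: coord_continuous.
- by move=> H; split=> // x Ax; apply: continuous_mxP => i j; exact: Ck_continuous (H i j) Ax.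
- move=> CG i j; apply: (CkS_intro (df := fun l x => ('D_(e l) G x) i j)) => //.
  + move=> x Ax; apply: (@continuous_comp _ _ _ G (fun M => M i j)).
      exact: Ck_continuous CG Ax.
    exact: coord_continuous.
  + by move=> l x Ax; apply: is_derive_coord; exact: Ck_is_derive CG Ax.
  + by move=> l; apply: (IH _).1; exact: Ck_derive.
- move=> H; apply: (CkS_intro
    (df := fun l x => \matrix_(i, j) 'D_(e l) (fun x => G x i j) x)) => //.
  + by move=> x Ax; apply: continuous_mxP => i j; exact: Ck_continuous (H i j) Ax.
  + by move=> l x Ax; apply: is_derive_mx => i j; rewrite mxE; exact: Ck_is_derive (H i j) Ax.
  + move=> l; apply: (IH _).2 => i j.
    by apply: Ck_ext (Ck_derive l (H i j)) => // x _; rewrite mxE.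
Qed.

(** [f] is generalised in the induction, since the chain rule brings in the partial derivatives of
    [f] composed with the same [G]. *)
Lemma Ck_comp k A B (f : V -> R) (G : V -> V) : open A -> open B ->
  Ck k A f -> (forall i, Ck k B (fun x => G x i 0)) -> (forall x, B x -> A (G x)) ->
  Ck k B (fun x => f (G x)).
Proof.
move=> oA oB; elim: k f => [|k IH] f Cf CG GA;
  have CG' : Ck _ B G := (Ck_mxP _ _ oB).2
    (fun i j => eq_ind_r (fun j => Ck _ B (fun x => G x i j)) (CG i) (ord1 j)).
  split=> // x Bx; apply: (@continuous_comp _ _ _ G f).
    exact: Ck_continuous CG' Bx.
  exact: Ck_continuous Cf (GA _ Bx).
apply: (CkS_intro (df := fun l x => \sum_i ('D_(e l) G x) i 0 * 'D_(e i) f (G x))) => //.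
- move=> x Bx; apply: (@continuous_comp _ _ _ G f).
    exact: Ck_continuous CG' Bx.
  exact: Ck_continuous Cf (GA _ Bx).
- move=> l x Bx; apply: (is_derive_comp oA) => //.
  + by apply: Ck_le Cf.
  + exact: GA.
  + exact: Ck_is_derive CG' Bx.
- move=> l; apply: Ck_sum => // i; apply: CkM => //.
    by apply: ((Ck_mxP _ _ oB).1 (Ck_derive l CG')).
  by apply: (IH ('D_(e i) f)) GA; [exact: Ck_derive|move=> j; exact: Ck_S].
Qed.

(** The second difference over a square of side [s]. The mean value theorem is applied along [e i]
    to the difference of [f] between two opposite sides, then along [e j] to ['D_(e i) f]. *)
Lemma Ck_square A (f : V -> R) x d i j (s : R) : open A -> Ck 2 A f -> 0 < d -> 0 < s ->
  s + s < d -> (forall y, `|y - x| < d -> A y) ->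
  exists2 y, `|y - x| < d &
   f (s *: e j + (s *: e i + x)) - f (s *: e i + x) - (f (s *: e j + x) - f x)
   = s * (s * 'D_(e j) ('D_(e i) f) y).
Proof.
move=> oA Cf d0 s0 sd xA.
have e1 k : `|e k| <= 1 :> R.
  apply: mx_norm_le => // a b; rewrite mxE; case: (_ && _); rewrite ?normr1 ?normr0 //.
have inb t u : 0 <= t <= 1 -> 0 <= u <= 1 ->
    `|u *: (s *: e j) + (t *: (s *: e i) + x) - x| < d.
  move=> /andP[t0 t1] /andP[u0 u1]; apply: le_lt_trans sd.
  rewrite addrA addrK (le_trans (ler_normD _ _)) // !normrZ (ger0_norm t0) (ger0_norm u0).
  rewrite (gtr0_norm s0); apply: lerD.
    by rewrite mulrA -[leRHS]mulr1 ler_pM ?mulr_ge0 ?(ltW s0) // ler_piMl // ltW.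
  by rewrite mulrA -[leRHS]mulr1 ler_pM ?mulr_ge0 ?(ltW s0) // ler_piMl // ltW.
have z01 : (0 : R) <= (0 : R) <= 1 by rewrite lexx ler01.
have o01 : (0 : R) <= (1 : R) <= 1 by rewrite lexx ler01.
have dshift (g : V -> R) c y v dg : is_derive (c + y) v g dg ->
    is_derive y v (fun z => g (c + z)) dg.
  move=> [dv E]; have EE : (fun h : R => h^-1 *: (g (h *: v + (c + y)) - g (c + y))) =
     (fun h : R => h^-1 *: (((fun z => g (c + z)) \o shift y) (h *: v) - g (c + y))).
    by apply/funext => h /=; rewrite /shift /= addrCA.
  by split; [move: dv; rewrite /derivable /= EE|move: E; rewrite /derive /= EE].
have [t t01 E1] := @line_MVT R _ (fun y => f (s *: e j + y) - f y)
   (fun y => s * 'D_(e i) f (s *: e j + y) - s * 'D_(e i) f y) x (s *: e i) (fun t t01 =>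
   is_deriveB
     (dshift _ _ _ _ _ (is_derive_dirZ s (Ck_is_derive i Cf
        (xA _ (eq_ind_r (fun w => `|w + _ - x| < d) (inb t 1 t01 o01) (esym (scale1r _)))))))
     (is_derive_dirZ s (Ck_is_derive i Cf
       (xA _ (eq_ind_r (fun w => `|w - x| < d) (inb t 0 t01 z01)
          (esym (etrans (congr1 (fun w => w + _) (scale0r _)) (add0r _)))))))).
have [u u01 E2] := @line_MVT R _ ('D_(e i) f)
   (fun y => s * 'D_(e j) ('D_(e i) f) y) (t *: (s *: e i) + x) (s *: e j) (fun u u01 =>
    is_derive_dirZ s (Ck_is_derive j (Ck_derive i Cf) (xA _ (inb t u t01 u01)))).
exists (u *: (s *: e j) + (t *: (s *: e i) + x)); first exact: inb.
by rewrite E1 -mulrBr E2.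
Qed.

Lemma dist_halves (a b c1 c2 eps : R) : a = b -> `|c1 - a| <= eps / 2 ->
  `|c2 - b| <= eps / 2 -> `|c2 - c1| <= eps.
Proof.
move=> -> H1 H2; rewrite -(subrKA b) [eps]splitr (le_trans (ler_normD _ _)) // lerD //.
by rewrite distrC.
Qed.

Lemma dist_lt_neq0 (a b : R) : `|a - b| < `|a| -> b != 0.
Proof. by move=> H; apply/eqP => b0; rewrite b0 subr0 ltxx in H. Qed.

(** The second difference is symmetric in [i] and [j], so [Ck_square] in both orders equates the two
    mixed derivatives at two points near [x]; their continuity does the rest. *)
Lemma Schwarz A (f : V -> R) x i j : open A -> Ck 2 A f -> A x ->
  'D_(e i) ('D_(e j) f) x = 'D_(e j) ('D_(e i) f) x.
Proof.
move=> oA Cf Ax; apply/eqP; rewrite -subr_eq0 -normr_le0; apply/ler_addgt0Pl => eps eps0.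
rewrite addr0.
have N1 : \forall y \near x, A y by apply: open_nbhs_nbhs.
have c a b := Ck_continuous (Ck_derive a (Ck_derive b Cf)) Ax.
have e2 : 0 < eps / 2 by rewrite divr_gt0.
have Nij := c i j; have Nji := c j i.
move/cvgrPdist_le : Nij => /(_ _ e2) Nij; move/cvgrPdist_le : Nji => /(_ _ e2) Nji.
have [d d0 Hd] := near_ball (filterI N1 (filterI Nij Nji)).
pose s := d / 3; have s0 : 0 < s by rewrite divr_gt0.
have sd : s + s < d by rewrite /s; lra.
have xA y : `|y - x| < d -> A y by move=> /Hd[].
have [y yd Ey] := Ck_square i j oA Cf d0 s0 sd xA.
have [z zd Ez] := Ck_square j i oA Cf d0 s0 sd xA.
have E : 'D_(e j) ('D_(e i) f) y = 'D_(e i) ('D_(e j) f) z.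
  apply: (mulfI (lt0r_neq0 s0)); apply: (mulfI (lt0r_neq0 s0)).
  apply: etrans (esym Ey) _; apply: etrans _ Ez.
  rewrite (addrCA (s *: e j) (s *: e i) x).
  by move: (f _) (f _) (f _) (f _) => *; ring.
have [_ [_ Hy]] := Hd _ yd; have [_ [Hz _]] := Hd _ zd.
exact: dist_halves E Hy Hz.
Qed.

End CkRules.

(** * Primitives along a coordinate axis *)

Section Cube.
Context {R : realType}.
Local Notation V := 'cV[R]_3.
Local Notation e i := (Defs.basis R i).
Implicit Types (A : set V) (x v w : V) (k : 'I_3).

Lemma mx_norm_lt m n (x : 'M[R]_(m, n)) c :
  0 < c -> (forall i j, `|x i j| < c) -> `|x| < c.
Proof.
move=> c0 H; rewrite [ltLHS]/Num.Def.normr/= mx_normrE.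
by apply/bigmax_ltP; split=> // -[i j] _ /=.
Qed.

(** The ball about 0 for the max norm is a product of intervals. It is stable under replacing one
    coordinate by a number of absolute value below [r], as needed for integrating along an axis and
    for substituting a function for a coordinate. *)
Definition cube (r : R) : set V := [set x | `|x| < r].

Lemma cube_open r : open (cube r).
Proof.
have -> : cube r = ball (0 : V) r.
  by rewrite -ball_normE; apply/seteqP; split=> x /=; rewrite sub0r normrN.
exact: ball_open.
Qed.

Lemma cube_coord r v i : cube r v -> `|v i 0| < r.
Proof. by move=> vr; apply: le_lt_trans vr; exact: mx_coord_le. Qed.

Lemma cubeP r v : 0 < r -> (forall i, `|v i 0| < r) -> cube r v.
Proof. by move=> r0 H; apply: mx_norm_lt => // i j; rewrite (ord1 j). Qed.

Lemma cube_gt0 r v : cube r v -> 0 < r.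
Proof. by move=> vr; apply: le_lt_trans vr. Qed.

Lemma cube_le r s : r <= s -> cube r `<=` cube s.
Proof. by move=> rs v vr; exact: lt_le_trans rs. Qed.

Lemma near_cube A : nbhs (0 : V) A -> exists2 d : R, 0 < d & cube d `<=` A.
Proof.
move=> /near_ball[d d0 H]; exists d => // v vd; apply: H.
by rewrite subr0.
Qed.

Definition upd k v t : V := v + (t - v k 0) *: e k.

Lemma updE k v t i : upd k v t i 0 = if i == k then t else v i 0.
Proof.
rewrite !mxE eqxx andbT; have [->|] := eqVneq i k; first by rewrite mulr1 addrC subrK.
by rewrite mulr0 addr0.
Qed.

Lemma cVP v w : (forall i, v i 0 = w i 0) -> v = w.
Proof. by move=> H; apply/colP. Qed.

Lemma upd_id k v : upd k v (v k 0) = v.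
Proof. by apply: cVP => i; rewrite updE; case: eqP => // ->. Qed.

Lemma upd_upd k v s t : upd k (upd k v s) t = upd k v t.
Proof. by apply: cVP => i; rewrite !updE; case: eqP. Qed.

Lemma upd_cube r k v t : cube r v -> `|t| < r -> cube r (upd k v t).
Proof.
move=> vr tr; apply: cubeP (cube_gt0 vr) _ => i; rewrite updE.
by case: eqP => // _; exact: cube_coord.
Qed.

Lemma upd_line k v t : upd k v t = t *: e k + upd k v 0.
Proof.
apply: cVP => i; rewrite [RHS]mxE [X in _ = X + _]mxE !updE basisE.
by case: eqP; rewrite ?mulr1 ?addr0 ?mulr0 ?add0r.
Qed.

Lemma upd_add k v h t : upd k (h *: e k + v) t = upd k v t.
Proof.
apply: cVP => i; rewrite !updE; case: eqP => // /eqP/negbTE ik.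
by rewrite 2!mxE basisE ik mulr0 add0r.
Qed.

Lemma upd_shift k j v h t : j != k -> upd k (h *: e j + v) t = h *: e j + upd k v t.
Proof.
move=> jk; apply: cVP => i; rewrite !updE [RHS]mxE [X in _ = X + _]mxE updE basisE.
case: (eqVneq i k) => [->|_]; last by rewrite 2!mxE basisE.
by rewrite eq_sym (negbTE jk) mulr0 add0r.
Qed.

Lemma upd_dist k v w t : `|upd k v t - upd k w t| <= `|v - w|.
Proof.
apply: mx_norm_le => // i j; rewrite (ord1 j) [X in `|X|]mxE [X in `|_ + X|]mxE !updE.
case: eqP => _; first by rewrite subrr normr0.
by apply: le_trans (mx_coord_le _ i 0); rewrite !mxE.
Qed.

Lemma is_derive_shiftV (f : V -> R) c y v df :
  is_derive (c + y) v f df -> is_derive y v (fun z => f (c + z)) df.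
Proof.
move=> [dv E]; have EE : (fun h : R => h^-1 *: (f (h *: v + (c + y)) - f (c + y))) =
    (fun h : R => h^-1 *: (((fun z => f (c + z)) \o shift y) (h *: v) - f (c + y))).
  by apply/funext => h /=; rewrite /shift /= addrCA.
by split; [move: dv; rewrite /derivable /= EE|move: E; rewrite /derive /= EE].
Qed.

Lemma is_derive_upd (f : V -> R) k v t df :
  is_derive (upd k v t) (e k) f df -> is_derive t 1 (fun t => f (upd k v t)) df.
Proof.
rewrite upd_line => /is_derive_line.
have -> // : (fun t => f (upd k v t)) = (fun s : R => f (s *: e k + upd k v 0)).
by apply/funext => s; rewrite upd_line.
Qed.

Lemma MVT_dir (f df : V -> R) k v s t :
  (forall u, Num.min s t <= u <= Num.max s t ->
     is_derive (upd k v u) (e k) f (df (upd k v u))) ->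
  exists2 u, Num.min s t <= u <= Num.max s t &
    f (upd k v t) - f (upd k v s) = (t - s) * df (upd k v u).
Proof.
move=> H; have inb l : 0 <= l <= 1 -> Num.min s t <= l * (t - s) + s <= Num.max s t.
  move=> /andP[l0 l1]; have [st|ts] := leP s t; apply/andP; split; nra.
have E l : l *: ((t - s) *: e k) + upd k v s = upd k v (l * (t - s) + s).
  by rewrite scalerA (upd_line k v s) (upd_line k v (_ + _)) scalerDl addrA.
have D l : 0 <= l <= 1 -> is_derive (l *: ((t - s) *: e k) + upd k v s)
    ((t - s) *: e k) f ((t - s) * df (l *: ((t - s) *: e k) + upd k v s)).
  by move=> l01; apply: is_derive_dirZ; rewrite E; apply: H; exact: inb.
have [l l01 E1] := line_MVT (df := fun y => (t - s) * df y) D.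
exists (l * (t - s) + s); first exact: inb.
rewrite -E -E1; congr (f _ - _).
by have := E 1; rewrite scale1r mul1r subrK => ->.
Qed.

Lemma MVT_dir0 (f df : V -> R) r k v :
  (forall w, cube r w -> is_derive w (e k) f (df w)) -> cube r v ->
  exists2 u, `|u| <= `|v k 0| &
    f v - f (upd k v 0) = v k 0 * df (upd k v u).
Proof.
move=> H vr; have vkr := cube_coord k vr.
have uB u : Num.min 0 (v k 0) <= u <= Num.max 0 (v k 0) -> `|u| <= `|v k 0|.
  have [v0|v0] := leP 0 (v k 0); move=> /andP[u1 u2]; rewrite ler_norml.
    by rewrite ger0_norm // u2 andbT (le_trans _ u1) // oppr_le0.
  by rewrite ltr0_norm // opprK u1 (le_trans u2) // oppr_ge0 ltW.
have [u ub E] := @MVT_dir f df k v 0 (v k 0)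
  (fun u ub => H _ (upd_cube k vr (le_lt_trans (uB u ub) vkr))).
by exists u; [exact: uB|move: E; rewrite upd_id subr0].
Qed.

End Cube.

(** * Antiderivatives on symmetric intervals and a Gronwall estimate *)

Section Antiderivative.
Context {R : realType}.
Implicit Types (r s t u rho eta c l : R).

Lemma antiderivative_unique (F G f : R -> R) (s : R) : F 0 = G 0 ->
  (forall t : R, `|t| < s -> is_derive t 1 F (f t)) ->
  (forall t : R, `|t| < s -> is_derive t 1 G (f t)) ->
  forall t : R, `|t| < s -> F t = G t.
Proof.
move=> FG0 dF dG t ts.
have D (l : R) : 0 <= l <= 1 -> is_derive (l *: t + 0) t (F - G) ((fun=> 0) (l *: t + 0)).
  move=> /andP[l0 l1]; have lt : `|l *: t + 0| < s.
    by rewrite addr0 normrM ger0_norm // (le_lt_trans _ ts) // ler_piMl.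
  have := is_derive_dirZ t (is_deriveB (dF _ lt) (dG _ lt)).
  by rewrite subrr scaler0 [t *: 1]mulr1.
have [l _] := line_MVT (df := fun=> 0) D.
rewrite addr0 => /eqP; rewrite subr_eq0 => /eqP.
rewrite /GRing.add /GRing.opp /= FG0 => /eqP.
by rewrite subrr subr_eq0 => /eqP.
Qed.

(** [f] may fail to be integrable up to [r]; on the smaller compact segment it is integrable, and
    subtracting the value at 0 normalises the integral. *)
Lemma antiderivative_sub (f : R -> R) (r s : R) : 0 < s -> s < r ->
  (forall t : R, `|t| < r -> {for t, continuous f}) ->
  exists F, F 0 = 0 /\ forall t : R, `|t| < s -> is_derive t 1 F (f t).
Proof.
move=> s0 sr cf; pose mu := @lebesgue_measure R.
pose G x := (\int[mu]_(t in [set` `[(- s), x]]) f t)%R.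
have ints : mu.-integrable `[(- s), s]%classic (EFin \o f).
  apply: continuous_compact_integrable; first exact: segment_compact.
  apply: continuous_in_subspaceT => t; rewrite inE /= in_itv /= => /andP[t1 t2].
  by apply: cf; rewrite (le_lt_trans _ sr) // ler_norml t1.
exists (fun x => G x - G 0); split; first by rewrite subrr.
move=> t ts; have /andP[t1 t2] : - s < t < s by rewrite -ltr_norml.
have [] := @continuous_FTC1_closed R f (- s) t s t2 ints t1.
  by apply: cf; exact: lt_trans sr.
rewrite derive1E => dG E.
have := is_deriveB (DeriveDef dG E) (is_derive_cst (G 0) t 1).
by rewrite subr0.
Qed.

(** The antiderivatives on smaller intervals, all zero at 0, agree on common domains and can be
    glued. *)
Lemma antiderivative_exists (f : R -> R) r : 0 < r ->
  (forall t, `|t| < r -> {for t, continuous f}) ->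
  exists F, F 0 = 0 /\ forall t, `|t| < r -> is_derive t 1 F (f t).
Proof.
move=> r0 cf.
pose P s (F : R -> R) := F 0 = 0 /\ forall t, `|t| < s -> is_derive t 1 F (f t).
have [F HF] : {F : R -> R -> R | forall s, 0 < s -> s < r -> P s (F s)}.
  have H s : {F | 0 < s -> s < r -> P s F}.
    apply: cid; have [s0|s0] := pselect (0 < s); last by exists f.
    have [sr|sr] := pselect (s < r); last by exists f.
    by have [F HF] := antiderivative_sub s0 sr cf; exists F.
  by exists (fun s => sval (H s)) => s; exact: svalP (H s).
(* At [t] the radius halfway between the absolute value of [t] and [r] is used: it is admissible,
   and [t] lies strictly inside. *)
pose S t := (`|t| + r) / 2; exists (fun t => F (S t) t).
have SP t : `|t| < r -> [/\ 0 < S t, S t < r & `|t| < S t].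
  by move=> tr; have := normr_ge0 t; rewrite /S; split; lra.
split.
  have /SP[a b _] : `|0 : R| < r by rewrite normr0.
  by case: (HF _ a b).
move=> t tr; have [a b c] := SP _ tr; have [F0 dF] := HF _ a b.
apply: near_eq_is_derive (dF _ c).
have : \forall y \near t, `|y| < S t.
  apply/nbhs_ballP; exists (S t - `|t|) => /=; first by rewrite subr_gt0.
  move=> y /=; rewrite /ball /= ltrBrDl distrC; apply: le_lt_trans.
  by rewrite -[X in `|X|](subrK t) addrC ler_normD.
apply: filterS => y yS.
have [a' b' c'] := SP _ (lt_trans yS b).
have [F0' dF'] := HF _ a' b'.
apply: (@antiderivative_unique _ _ f (Num.min (S y) (S t))).
- by rewrite F0 F0'.
- by move=> u; rewrite lt_min => /andP[_ ?]; exact: dF.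
- by move=> u; rewrite lt_min => /andP[? _]; exact: dF'.
- by rewrite lt_min c'.
Qed.

(** A choice made once for all functions, so that it can be applied to the restriction of a function
    of three variables to each line. The value at 0 makes it unique on the open interval of radius
    [r] when [f] is continuous there. *)
Definition antiderivative r (f : R -> R) : R -> R :=
  get [set F : R -> R | F 0 = 0 /\ forall t, `|t| < r -> is_derive t 1 F (f t)].

Lemma antiderivativeP r (f : R -> R) : 0 < r ->
  (forall t, `|t| < r -> {for t, continuous f}) ->
  antiderivative r f 0 = 0 /\
  forall t, `|t| < r -> is_derive t 1 (antiderivative r f) (f t).
Proof. by move=> r0 /(antiderivative_exists r0) /getPex. Qed.

Lemma antiderivative_dist (F G f g : R -> R) r s c : F 0 = G 0 -> `|s| < r ->
  (forall t, `|t| < r -> is_derive t 1 F (f t)) ->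
  (forall t, `|t| < r -> is_derive t 1 G (g t)) ->
  (forall t, `|t| <= `|s| -> `|f t - g t| <= c) -> `|F s - G s| <= `|s| * c.
Proof.
move=> FG0 sr dF dG H.
have D (l : R) : 0 <= l <= 1 -> is_derive (l *: s + 0) s (fun x => F x - G x)
    (s * (f (l *: s + 0) - g (l *: s + 0))).
  move=> /andP[l0 l1]; have lt : `|l *: s + 0| < r.
    by rewrite addr0 normrM ger0_norm // (le_lt_trans _ sr) // ler_piMl.
  have := is_derive_dirZ s (is_deriveB (dF _ lt) (dG _ lt)).
  by rewrite [s *: 1]mulr1.
have [l /andP[l0 l1]] := line_MVT (df := fun x => s * (f x - g x)) D.
rewrite addr0 FG0 subrr subr0 => ->; rewrite normrM ler_wpM2l // H //.
by rewrite addr0 normrM ger0_norm // ler_piMl.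
Qed.

(** On so short an interval no exponential appears. At a maximum [u] of the absolute value of [f],
    the mean value theorem bounds this maximum by [c + rho * eta] plus [rho * L] times the maximum
    itself, and [rho * L <= 1 / 2] absorbs the last term. *)
Lemma Gronwall (f df : R -> R) (rho L eta c : R) :
  0 <= rho -> 0 <= L -> rho * L <= 1 / 2 ->
  (forall t : R, `|t| <= rho -> is_derive t 1 f (df t)) ->
  (forall t : R, `|t| <= rho -> `|df t| <= L * `|f t| + eta) ->
  `|f 0| <= c ->
  forall t : R, `|t| <= rho -> `|f t| <= 2 * (c + rho * eta).
Proof.
move=> rho0 L0 rL dF dB f0 t trho.
have cf : {within `[(- rho), rho], continuous (fun t => `|f t|)}.
  apply: continuous_in_subspaceT => u; rewrite inE /= in_itv /= => urho.
  have [du _] := dF u ltac:(by rewrite ler_norml).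
  apply: (@continuous_comp _ _ _ f (fun x : R => `|x|)); last exact: norm_continuous.
  by apply: differentiable_continuous; exact/derivable1_diffP.
have [u urho umax] := EVT_max (ge0_cp rho0).2 cf.
move: urho; rewrite in_itv /= -ler_norml => urho.
have fu w : `|w| <= rho -> `|f w| <= `|f u|.
  by move=> wr; apply: umax; rewrite in_itv /= -ler_norml.
apply: le_trans (fu _ trho) _.
have D (l : R) : 0 <= l <= 1 -> is_derive (l *: u + 0) u f (u * df (l *: u + 0)).
  move=> /andP[l0 l1]; have lt : `|l *: u + 0| <= rho.
    by rewrite addr0 normrM ger0_norm // (le_trans _ urho) // ler_piMl.
  by have := is_derive_dirZ u (dF _ lt); rewrite [u *: 1]mulr1.
have [l /andP[l0 l1]] := line_MVT (df := fun y => u * df y) D.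
have lt : `|l *: u + 0| <= rho.
  by rewrite addr0 normrM ger0_norm // (le_trans _ urho) // ler_piMl.
rewrite addr0 in lt * => E; rewrite addr0 in E.
have E1 : `|f u| <= `|f 0| + rho * (L * `|f u| + eta).
  rewrite -[X in `|X| <= _](subrK (f 0)) addrC E (le_trans (ler_normD _ _)) // lerD2l normrM.
  by apply: ler_pM => //; apply: le_trans (dB _ lt) _; rewrite lerD2r ler_wpM2l // fu.
have : rho * (L * `|f u|) <= 1 / 2 * `|f u| by rewrite mulrA ler_wpM2r.
lra.
Qed.

End Antiderivative.

(** * Integration along one axis, the other coordinates being parameters *)

Section Primitive.
Context {R : realType}.
Local Notation V := 'cV[R]_3.
Local Notation e i := (Defs.basis R i).
Implicit Types (A : set V) (x v w : V) (k j : 'I_3) (r s t eps : R).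

(** A tube lemma: by compactness of the segment, one radius [d] serves all points of the curve. *)
Lemma uniform_along (c : R -> V) (phi : V -> R) (rho : R) A eps : open A -> 0 < eps ->
  (forall t, `|t| <= rho -> {for t, continuous c}) ->
  (forall t, `|t| <= rho -> A (c t)) ->
  (forall y, A y -> {for y, continuous phi}) ->
  exists2 d : R, 0 < d & forall t y, `|t| <= rho -> `|y - c t| < d ->
    A y /\ `|phi y - phi (c t)| <= eps.
Proof.
move=> oA eps0 cc cA cphi.
have /compact_near_coveringP K := @segment_compact R (- rho) rho.
have e2 : 0 < eps / 2 by rewrite divr_gt0.
pose P (d t : R) := forall y, `|y - c t| < d -> A y /\ `|phi y - phi (c t)| <= eps.
have H : \forall d \near (0 : R)^'+, `[(- rho), rho]%classic `<=` P d.
  apply: K => t /=; rewrite in_itv /= -ler_norml => trho.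
  have N1 : \forall y \near c t, A y by apply: open_nbhs_nbhs; split=> //; exact: cA.
  have := cphi _ (cA _ trho) => /cvgrPdist_le /(_ _ e2) N2.
  have [d d0 Hd] := near_ball (filterI N1 N2).
  have d2 : 0 < d / 2 by rewrite divr_gt0.
  have N3 := cc _ trho; move/cvgrPdist_lt : N3 => /(_ _ d2) N3.
  (* Half of the radius is spent on moving along the curve from [c t] to [c s], the other half on
     the distance from [c s] to [y]. *)
  exists ([set s | `|c t - c s| < d / 2], [set l | l < d / 2]).
    by split=> //=; exact: nbhs_right_lt.
  move=> [s l] /= [sd ld] y yd.
  have yt : `|y - c t| < d.
    rewrite -(subrKA (c s)) (le_lt_trans (ler_normD _ _)) // [d]splitr ltrD //.
      exact: lt_trans ld.
    by rewrite distrC.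
  have [Ay Hy] := Hd _ yt; split=> //.
  have st : `|c s - c t| < d by rewrite distrC (lt_trans sd) //; lra.
  have [_ Hs] := Hd _ st.
  rewrite -(subrKA (phi (c t))) [eps]splitr (le_trans (ler_normD _ _)) // lerD //.
  by rewrite distrC.
near (0 : R)^'+ => d.
exists d; first by near: d; exact: nbhs_right_gt.
move=> t y trho; have : `[(- rho), rho]%classic `<=` P d by near: d.
by apply; rewrite /= in_itv /= -ler_norml.
Unshelve. all: by end_near. Qed.

(** The integral of [f] over the segment parallel to [e k] from the plane $v_k=0$ to [v]. *)
Definition prim r k (f : V -> R) v : R :=
  antiderivative r (fun t => f (upd k v t)) (v k 0).

Lemma continuous_upd k v t : {for t, continuous (upd k v)}.
Proof.
apply: continuous_mxP => i j; rewrite (ord1 j).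
have -> : (fun y => upd k v y i 0) = if i == k then id else fun=> v i 0.
  by apply/funext => y; rewrite updE; case: eqP.
by case: eqP => _; [exact: cvg_id|exact: cst_continuous].
Qed.

Lemma primP r k (f : V -> R) v : (forall w, cube r w -> {for w, continuous f}) ->
  cube r v ->
  let F := antiderivative r (fun t => f (upd k v t)) in
  F 0 = 0 /\ forall t, `|t| < r -> is_derive t 1 F (f (upd k v t)).
Proof.
move=> cf vr; apply: antiderivativeP; first exact: cube_gt0 vr.
move=> t tr; apply: (@continuous_comp _ _ _ (upd k v) f).
  exact: continuous_upd.
by apply: cf; exact: upd_cube.
Qed.

Lemma prim_upd r k (f : V -> R) v t :
  prim r k f (upd k v t) = antiderivative r (fun t => f (upd k v t)) t.
Proof.
rewrite /prim updE eqxx; congr (antiderivative r _ t).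
by apply/funext => s; rewrite upd_upd.
Qed.

Lemma prim0 r k (f : V -> R) v : (forall w, cube r w -> {for w, continuous f}) ->
  cube r v -> v k 0 = 0 -> prim r k f v = 0.
Proof. by move=> cf vr vk; rewrite /prim vk; case: (primP k cf vr). Qed.

Lemma is_derive_prim r k (f : V -> R) v :
  (forall w, cube r w -> {for w, continuous f}) -> cube r v ->
  is_derive v (e k) (prim r k f) (f v).
Proof.
move=> cf vr; have [_ /(_ _ (cube_coord k vr)) [dF E]] := primP k cf vr.
set F := antiderivative r _ in dF E.
have H : (fun h : R => h^-1 *: ((F \o shift (v k 0)) (h *: 1) - F (v k 0))) =
    (fun h : R => h^-1 *: ((prim r k f \o shift v) (h *: e k) - prim r k f v)).
  apply/funext => h /=; congr (_ *: (_ - _)).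
  rewrite /shift /= -[h *: e k + v](upd_id k) prim_upd.
  have -> : (fun t => f (upd k (h *: e k + v) t)) = (fun t => f (upd k v t)).
    by apply/funext => t; rewrite upd_add.
  by rewrite mxE [(h *: e k) k 0]mxE basisE eqxx /GRing.scale /=.
rewrite upd_id in E; split; first by move: dF; rewrite /derivable H.
by move: E; rewrite /derive H.
Qed.

Lemma prim_dist r k (f g : V -> R) v (c : R) :
  (forall w, cube r w -> {for w, continuous f}) ->
  (forall w, cube r w -> {for w, continuous g}) -> cube r v ->
  (forall t, `|t| <= `|v k 0| -> `|f (upd k v t) - g (upd k v t)| <= c) ->
  `|prim r k f v - prim r k g v| <= `|v k 0| * c.
Proof.
move=> cf cg vr; have [F0 dF] := primP k cf vr; have [G0 dG] := primP k cg vr.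
by apply: antiderivative_dist dF dG; rewrite ?F0 ?G0 //; exact: cube_coord.
Qed.

Lemma prim_norm r k (f : V -> R) v (c : R) :
  (forall w, cube r w -> {for w, continuous f}) -> cube r v ->
  (forall t, `|t| <= `|v k 0| -> `|f (upd k v t)| <= c) ->
  `|prim r k f v| <= `|v k 0| * c.
Proof.
move=> cf vr H; have [F0 dF] := primP k cf vr.
rewrite -[prim r k f v]subr0.
apply: (antiderivative_dist (G := fun=> 0) _ _ dF (fun t _ => is_derive_cst 0 t 1)).
- by [].
- exact: cube_coord.
- by move=> t /H; rewrite subr0.
Qed.

(** Both the endpoint and the integrand move with the point. The first is handled by continuity of
    the antiderivative [F] at [v], the second by uniform continuity of [f] near the segment through
    [v]. *)
Lemma prim_continuous r k (f : V -> R) :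
  (forall w, cube r w -> {for w, continuous f}) ->
  forall v, cube r v -> {for v, continuous (prim r k f)}.
Proof.
move=> cf v vr; have r0 := cube_gt0 vr; have vkr := cube_coord k vr.
apply/(cvgrPdist_le (FF := nbhs_filter v)) => eps eps0.
have er : 0 < eps / (2 * r) by rewrite divr_gt0 ?mulr_gt0.
have [F0 dF] := primP k cf vr; set F := antiderivative _ _ in F0 dF.
(* A margin on both sides: the closed segment of radius [rho] through [v] stays in the cube, and it
   covers the [k]-th coordinates of all points near [v]. *)
pose rho := (`|v k 0| + r) / 2.
have rhor : rho < r by rewrite /rho; lra.
have [d d0 Hd] := @uniform_along (upd k v) f rho (cube r) _ (@cube_open R r) er
   (fun t _ => @continuous_upd k v t) (fun t trho => upd_cube k vr (le_lt_trans trho rhor)) cf.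
have cF : {for v k 0, continuous F}.
  have [dFv _] := dF _ vkr.
  by apply: differentiable_continuous; exact: (derivable1_diffP _ _).1 dFv.
have cFv : {for v, continuous (fun w : V => F (w k 0))}.
  by apply: (@continuous_comp _ _ _ (fun w : V => w k 0) F) => //; exact: coord_continuous.
have e2 : 0 < eps / 2 by rewrite divr_gt0.
move/cvgrPdist_le : cFv => /(_ _ e2) N1.
have N2 : \forall w \near v, cube r w by apply: open_nbhs_nbhs; split=> //; exact: cube_open.
have rv2 : 0 < (r - `|v k 0|) / 2 by rewrite divr_gt0 // subr_gt0.
have N3 : \forall w \near v, `|v - w| < d.
  by apply/nbhs_ballP; exists d => // w; rewrite -ball_normE.
have N4 : \forall w \near v, `|v - w| < (r - `|v k 0|) / 2.
  by apply/nbhs_ballP; exists ((r - `|v k 0|) / 2) => // w; rewrite -ball_normE.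
near=> w.
have Fw : `|F (v k 0) - F (w k 0)| <= eps / 2 by near: w.
have wr : cube r w by near: w.
have wd : `|v - w| < d by near: w.
have wd2 : `|v - w| < (r - `|v k 0|) / 2 by near: w.
have wk : `|w k 0| <= rho.
  have vw : `|v k 0 - w k 0| <= `|v - w|.
    by apply: le_trans (mx_coord_le _ k 0); rewrite !mxE.
  have := lerB_dist (w k 0) (v k 0); rewrite distrC /rho; lra.
have [G0 dG] := primP k cf wr.
have D : `|F (w k 0) - prim r k f w| <= `|w k 0| * (eps / (2 * r)).
  apply: antiderivative_dist dF dG _; rewrite ?F0 ?G0 //; first exact: cube_coord.
  move=> t tw; rewrite distrC; apply: (Hd _ _ _ _).2; first exact: le_trans wk.
  by apply: le_lt_trans (upd_dist _ _ _ _) _; rewrite distrC.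
rewrite -(subrKA (F (w k 0))) [eps]splitr (le_trans (ler_normD _ _)) // lerD //.
apply: le_trans D _; have -> : eps / 2 = r * (eps / (2 * r)).
  have rN0 : r != 0 by rewrite gt_eqF.
  by field.
by rewrite ler_wpM2r ?(ltW er) // ltW //; exact: cube_coord.
Unshelve. all: by end_near. Qed.

(** Differentiation under the integral sign. The difference quotient of [prim] is an antiderivative
    of the difference quotient of [f], which the mean value theorem turns into values of [df]
    uniformly close to those on the segment. *)
Lemma is_derive_prim_other r k j (f df : V -> R) v : j != k ->
  (forall w, cube r w -> {for w, continuous f}) ->
  (forall w, cube r w -> {for w, continuous df}) ->
  (forall w, cube r w -> is_derive w (e j) f (df w)) -> cube r v ->
  is_derive v (e j) (prim r k f) (prim r k df v).
Proof.
move=> jk cf cdf dfP vr; have r0 := cube_gt0 vr; have vkr := cube_coord k vr.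
set l := prim r k df v.
suff H : h^-1 *: (prim r k f (h *: e j + v) - prim r k f v) @[h --> 0^'] --> l.
  by split; [apply/cvg_ex; exists l|apply/cvg_lim].
apply/cvgrPdist_le => eps eps0.
have er : 0 < eps / r by rewrite divr_gt0.
have [d d0 Hd] := @uniform_along (upd k v) df `|v k 0| (cube r) _ (@cube_open R r) er
   (fun t _ => @continuous_upd k v t) (fun t trho => upd_cube k vr (le_lt_trans trho vkr)) cdf.
have ej : `|e j| <= 1 :> R.
  by apply: mx_norm_le => // a b; rewrite mxE; case: (_ && _); rewrite ?normr1 ?normr0.
near=> h.
have h0 : h != 0 by near: h; exact: nbhs_dnbhs_neq.
have hd : `|h| < d by near: h; exact: dnbhs0_lt.
have inb u t : 0 <= u <= 1 -> `|t| <= `|v k 0| ->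
    `|u *: (h *: e j) + upd k v t - upd k v t| < d.
  move=> /andP[u0 u1] tv; rewrite addrK scalerA normrZ.
  apply: le_lt_trans (ler_wpM2l (normr_ge0 _) ej) _; rewrite mulr1 normrM ger0_norm //.
  by apply: le_lt_trans hd; exact: ler_piMl.
have o01 : (0 : R) <= (1 : R) <= 1 by rewrite ler01 lexx.
have hr : cube r (h *: e j + v).
  have := Hd _ _ (lexx _) (inb 1 _ o01 (lexx _)).
  by rewrite scale1r upd_id => -[].
have [F0 dF] := primP k cf vr; have [F0' dF'] := primP k cf hr.
have [G0 dG] := primP k cdf vr.
rewrite /l {1 2 3}/prim.
have -> : (h *: e j + v) k 0 = v k 0.
  by rewrite 2!mxE basisE eq_sym (negbTE jk) mulr0 add0r.
set F := antiderivative r (fun t => f (upd k v t)) in F0 dF *.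
set F' := antiderivative r (fun t => f (upd k (h *: e j + v) t)) in F0' dF' *.
set G := antiderivative r (fun t => df (upd k v t)) in G0 dG *.
have dQ t : `|t| < r -> is_derive t 1 (h^-1 *: (F' - F))
    (h^-1 *: (f (upd k (h *: e j + v) t) - f (upd k v t))).
  by move=> tr; apply: is_deriveZ; apply: is_deriveB; [exact: dF'|exact: dF].
apply: (@le_trans _ _ (`|v k 0| * (eps / r))); last first.
  by rewrite mulrC -mulrA ler_piMr ?(ltW eps0) // mulrC ler_pdivrMr // mul1r ltW.
have := @antiderivative_dist _ G (h^-1 *: (F' - F)) _ _ _ (v k 0) (eps / r) _ vkr dG dQ.
apply.
  by rewrite G0 /GRing.scale /GRing.add /GRing.opp /= /GRing.scale /= F0 F0' addrN mulr0.
move=> t tv; have xr : cube r (upd k v t) by apply: upd_cube => //; exact: le_lt_trans vkr.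
have Du u : 0 <= u <= 1 -> is_derive (u *: (h *: e j) + upd k v t) (h *: e j) f
    (h * df (u *: (h *: e j) + upd k v t)).
  move=> u01; apply: is_derive_dirZ; apply: dfP.
  exact: (Hd _ _ tv (inb _ _ u01 tv)).1.
have [u u01] := line_MVT (df := fun y => h * df y) Du.
rewrite -upd_shift // => ->; rewrite /GRing.scale /= mulKf // distrC.
exact: (Hd _ _ tv (inb _ _ u01 tv)).2.
Unshelve. all: by end_near. Qed.

Lemma prim_Ck m r k (f : V -> R) : Ck m (cube r) f -> Ck m (cube r) (prim r k f).
Proof.
have oc := @cube_open R r.
elim: m f => [|m IH] f Cf.
  by split=> // v vr; apply: prim_continuous vr => w wr; exact: Ck_continuous Cf wr.
have cf w : cube r w -> {for w, continuous f} by move=> wr; exact: Ck_continuous Cf wr.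
apply: (CkS_intro (df := fun j => if j == k then f else prim r k ('D_(e j) f))) => //.
- by move=> v vr; exact: prim_continuous vr.
- move=> j v vr; case: eqVneq => [->|jk]; first exact: is_derive_prim.
  apply: is_derive_prim_other => // w wr.
    exact: Ck_continuous (Ck_derive j Cf) wr.
  exact: Ck_is_derive Cf wr.
- move=> j; case: eqP => _; first exact: Ck_S.
  by apply: IH; exact: Ck_derive.
Qed.

End Primitive.

(** * Ordinary differential equations with parameters *)

Section Picard.
Context {R : realType}.
Local Notation V := 'cV[R]_3.
Local Notation e i := (Defs.basis R i).
Implicit Types (A : set V) (x v w : V) (k j : 'I_3) (r s t eps : R).

(** The radius [2 * C / 2 ^+ n] is the tail of the geometric series, so the intervals from [a n] to
    [b n] are nested and the supremum of the left ends lies in all of them. *)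
Lemma geometric_limit (u : nat -> R) (C : R) :
  (forall n, `|u n.+1 - u n| <= C / 2 ^+ n) ->
  exists l, forall n, `|l - u n| <= 2 * C / 2 ^+ n.
Proof.
move=> H; pose a n := u n - 2 * C / 2 ^+ n; pose b n := u n + 2 * C / 2 ^+ n.
have p2 n : (0 : R) < 2 ^+ n by rewrite exprn_gt0.
have half n : 2 * C / 2 ^+ n = 2 * (2 * C / 2 ^+ n.+1).
  by rewrite exprS invfM; field; rewrite gt_eqF.
have Cn n : C / 2 ^+ n = 2 * C / 2 ^+ n.+1 by rewrite exprS invfM; field; rewrite gt_eqF.
have C0 : 0 <= C by have := le_trans (normr_ge0 _) (H 0%N); rewrite expr0 divr1.
have c0 n : 0 <= 2 * C / 2 ^+ n by rewrite divr_ge0 ?mulr_ge0 // ltW.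
have aS n : a n <= a n.+1.
  have := H n; rewrite ler_norml /a (half n) Cn; lra.
have bS n : b n.+1 <= b n.
  have := H n; rewrite ler_norml /b (half n) Cn; lra.
have amono n m : (n <= m)%N -> a n <= a m.
  by move=> /subnK <-; elim: (m - n)%N => // p IH; exact: le_trans (aS _).
have bmono n m : (n <= m)%N -> b m <= b n.
  by move=> /subnK <-; elim: (m - n)%N => // p IH; exact: le_trans (bS _) IH.
have ab n m : a n <= b m.
  have [nm|/ltnW mn] := leqP n m.
    apply: le_trans (amono _ _ nm) _; rewrite /a /b; have := c0 m; lra.
  apply: le_trans _ (bmono _ _ mn); rewrite /a /b; have := c0 n; lra.
have hs : has_sup (range a).
  by split; [exists (a 0%N); exists 0%N|exists (b 0%N) => _ [n _ <-]; exact: ab].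
exists (sup (range a)) => n.
have s1 : a n <= sup (range a) by apply: sup_upper_bound => //; exists n.
have s2 : sup (range a) <= b n.
  by apply: ge_sup => [|_ [m _ <-]]; [case: hs|exact: ab].
by rewrite ler_norml; move: s1 s2; rewrite /a /b; lra.
Qed.

Lemma continuous_upd_fun (Z : V -> R) v i :
  {for v, continuous Z} -> {for v, continuous (fun w => upd i w (Z w))}.
Proof.
move=> cZ; apply: continuous_mxP => a b; rewrite (ord1 b).
have -> : (fun y => upd i y (Z y) a 0) = if a == i then Z else fun y => y a 0.
  by apply/funext => y; rewrite updE; case: eqP.
by case: eqP => // _; exact: coord_continuous.
Qed.

Lemma continuous_subst (g Z : V -> R) v i r :
  (forall w, cube r w -> {for w, continuous g}) -> {for v, continuous Z} ->
  cube r v -> `|Z v| < r -> {for v, continuous (fun w => g (upd i w (Z w)))}.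
Proof.
move=> cg cZ vr Zr; apply: (@continuous_comp _ _ _ (fun w => upd i w (Z w)) g).
  exact: continuous_upd_fun.
by apply: cg; exact: upd_cube.
Qed.

(** For [k != 2] this is the integral form of $\partial Z/\partial x_k = g(x,Z)$, where the third
    coordinate is both the slot of the unknown in [g] and the initial value on the plane $v_k=0$.
    The bound [d + d * M < r] keeps the iterates where [g] is controlled, and [d * L <= 1 / 2] makes
    each iteration halve distances. *)
Lemma picard (g : V -> R) k r (d M L : R) :
  0 < d -> 0 <= M -> 0 <= L -> d + d * M < r -> d * L <= 1 / 2 ->
  (forall w, cube r w -> {for w, continuous g}) ->
  (forall w, cube r w -> `|g w| <= M) ->
  (forall w a b, cube r w -> `|a| < r -> `|b| < r ->
     `|g (upd 2 w a) - g (upd 2 w b)| <= L * `|a - b|) ->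
  exists Z : V -> R, forall v, cube d v -> [/\ {for v, continuous Z}, `|Z v| < r &
    Z v = v 2 0 + prim d k (fun w => g (upd 2 w (Z w))) v].
Proof.
move=> d0 M0 L0 dMr dL cg gM gL.
have dr : d < r by apply: le_lt_trans dMr; rewrite lerDl mulr_ge0 // ltW.
pose G (Z : V -> R) w := g (upd 2 w (Z w)).
pose T Z v : R := v 2 0 + prim d k (G Z) v.
pose ok (Z : V -> R) := forall v, cube d v -> {for v, continuous Z} /\ `|Z v| <= d + d * M.
have okG Z : ok Z -> forall w, cube d w -> {for w, continuous (G Z)}.
  move=> oZ w wd; have [cZ Zr] := oZ w wd.
  apply: continuous_subst cg cZ _ (le_lt_trans Zr dMr).
  by apply: cube_le wd; exact: ltW.
have okb Z w : ok Z -> cube d w -> `|G Z w| <= M.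
  move=> oZ wd; apply: gM; apply: upd_cube; last exact: le_lt_trans (oZ _ wd).2 dMr.
  by apply: cube_le wd; exact: ltW.
have okT Z : ok Z -> ok (T Z).
  move=> oZ v vd; split.
    have c1 : {for v, continuous (fun v : V => v 2 0)} by exact: coord_continuous.
    have c2 := prim_continuous (k := k) (okG _ oZ) vd.
    exact: (cvgD c1 c2).
  apply: le_trans (ler_normD _ _) _; apply: lerD.
    by apply: ltW; exact: cube_coord.
  apply: le_trans (prim_norm (c := M) (okG _ oZ) vd _) _.
    move=> t tv; apply: okb => //; apply: upd_cube => //.
    by apply: le_lt_trans tv _; exact: cube_coord.
  by rewrite ler_wpM2r // ltW //; exact: cube_coord.
have okD Z Z' (c : R) : ok Z -> ok Z' -> (forall v, cube d v -> `|Z v - Z' v| <= c) ->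
    forall v, cube d v -> `|prim d k (G Z) v - prim d k (G Z') v| <= c / 2.
  move=> oZ oZ' H v vd; have c0 : 0 <= c by apply: le_trans (H _ vd).
  apply: le_trans (prim_dist (c := L * c) (okG _ oZ) (okG _ oZ') vd _) _.
    move=> t tv; have ud : cube d (upd k v t).
      by apply: upd_cube => //; apply: le_lt_trans tv _; exact: cube_coord.
    apply: le_trans (gL _ _ _ _ (le_lt_trans (oZ _ ud).2 dMr) (le_lt_trans (oZ' _ ud).2 dMr)) _.
      by apply: cube_le ud; exact: ltW.
    by rewrite ler_wpM2l // H.
  apply: (@le_trans _ _ (d * (L * c))).
    by rewrite ler_wpM2r ?mulr_ge0 // ltW //; exact: cube_coord.
  by rewrite mulrA mulrC ler_wpM2l // -[2^-1]mul1r.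
pose Zn n := iter n T (fun v => v 2 0).
have C0 : 0 <= d * M by rewrite mulr_ge0 // ltW.
have okn n : ok (Zn n).
  elim: n => [|n IH]; last exact: okT.
  move=> v vd; split; first exact: coord_continuous.
  by apply: le_trans (ltW (cube_coord _ vd)) _; rewrite lerDl.
have Zd n v : cube d v -> `|Zn n.+1 v - Zn n v| <= d * M / 2 ^+ n.
  elim: n v => [|n IH] v vd.
    rewrite /Zn /= /T addrAC subrr add0r expr0 divr1.
    apply: le_trans (prim_norm (c := M) (okG _ (okn 0%N)) vd _) _.
      move=> t tv; apply: okb; first exact: (okn 0%N).
      by apply: upd_cube => //; apply: le_lt_trans tv _; exact: cube_coord.
    by rewrite ler_wpM2r // ltW //; exact: cube_coord.
  rewrite [Zn n.+2 v]/(T (Zn n.+1) v) [X in _ - X]/(T (Zn n) v) /T opprD addrACA subrr add0r.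
  apply: le_trans (okD _ _ _ (okn n.+1) (okn n) IH v vd) _.
  by rewrite exprS invfM mulrA mulrAC.
have Hl v : exists l, cube d v -> forall n, `|l - Zn n v| <= 2 * (d * M) / 2 ^+ n.
  have [vd|nvd] := pselect (cube d v); last by exists 0.
  by have [l Hl] := geometric_limit (fun n => Zd n v vd); exists l.
pose Z v := sval (cid (Hl v)).
have ZP v : cube d v -> forall n, `|Z v - Zn n v| <= 2 * (d * M) / 2 ^+ n.
  exact: (svalP (cid (Hl v))).
have small (c eps : R) : 0 < eps -> exists n : nat, c / 2 ^+ n <= eps.
  move=> eps0; have [c0|c0] := leP c 0.
    by exists 0%N; rewrite expr0 divr1 (le_trans c0) // ltW.
  have [n Hn] : exists n : nat, c / eps <= n%:R.
    by exists (Num.truncn (c / eps)).+1; apply/ltW/truncnS_gt.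
  exists n; rewrite ler_pdivrMr ?exprn_gt0 // mulrC -ler_pdivrMr //.
  apply: le_trans Hn _; rewrite -natrX ler_nat ltnW //; exact: ltn_expl.
have cZ v : cube d v -> {for v, continuous Z}.
  move=> vd; apply/(cvgrPdist_le (FF := nbhs_filter v)) => eps eps0.
  have e3 : 0 < eps / 3 by rewrite divr_gt0.
  have [n Hn] := small (2 * (d * M)) _ e3.
  have [cn _] := okn n _ vd; move/cvgrPdist_le : cn => /(_ _ e3) N1.
  have N2 : \forall w \near v, cube d w.
    by apply: open_nbhs_nbhs; split=> //; exact: cube_open.
  apply: filterS2 N1 N2 => w N1 wd.
  have -> : Z v - Z w = (Z v - Zn n v) + (Zn n v - Zn n w) + (Zn n w - Z w).
    by rewrite !subrKA.
  apply: ler_norm3 => //; first exact: le_trans (ZP _ vd n) Hn.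
  by rewrite distrC; exact: le_trans (ZP _ wd n) Hn.
have okZ : ok Z.
  move=> v vd; split; first exact: cZ.
  apply/ler_addgt0Pl => eps eps0; have [n Hn] := small (2 * (d * M)) _ eps0.
  rewrite -[Z v](subrK (Zn n v)) (le_trans (ler_normD _ _)) // lerD //.
    exact: le_trans (ZP _ vd n) Hn.
  exact: (okn n _ vd).2.
exists Z => v vd; split; [exact: cZ|exact: le_lt_trans (okZ _ vd).2 dMr|].
(* Both sides are close to the iterate [n.+1], the right-hand one because [T] halves the distance
   between [Z] and the iterate [n]. *)
apply/eqP; rewrite -subr_eq0 -normr_le0; apply/ler_addgt0Pl => eps eps0.
rewrite addr0; have [n Hn] := small (2 * (d * M)) _ eps0.
have D1 := ZP _ vd n.+1.
have ZP' w : cube d w -> `|Zn n w - Z w| <= 2 * (d * M) / 2 ^+ n.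
  by move=> wd; rewrite distrC; exact: ZP.
have D2 := okD _ _ _ (okn n) okZ ZP' v vd.
have E : Z v - (v 2 0 + prim d k (G Z) v) =
    (Z v - Zn n.+1 v) + (prim d k (G (Zn n)) v - prim d k (G Z) v).
  have -> : Zn n.+1 v = v 2 0 + prim d k (G (Zn n)) v by [].
  by move: (Z v) (v _ _) (prim _ _ _ _) (prim _ _ _ _) => *; ring.
rewrite -/(G Z) E (le_trans (ler_normD _ _)) //.
have e1 : 2 * (d * M) / 2 ^+ n.+1 <= eps / 2.
  have -> : 2 * (d * M) / 2 ^+ n.+1 = 2 * (d * M) / 2 ^+ n / 2.
    have pn : (2 : R) ^+ n != 0 by rewrite expf_neq0.
    by rewrite exprSr; field.
  by rewrite ler_pM2r.
have e2 : 2 * (d * M) / 2 ^+ n / 2 <= eps / 2 by rewrite ler_pM2r.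
by rewrite [eps]splitr lerD // ?(le_trans D1) // (le_trans D2).
Qed.

Lemma between_norm_lt (x y u c : R) : `|x| < c -> `|y| < c ->
  Num.min x y <= u <= Num.max x y -> `|u| < c.
Proof.
by rewrite !ltr_norml; have [xy|yx] := leP x y; move=> /andP[? ?] /andP[? ?] /andP[? ?];
  apply/andP; split; lra.
Qed.

Lemma between_dist (x y u : R) :
  Num.min x y <= u <= Num.max x y -> `|u - x| <= `|y - x|.
Proof.
have [xy|yx] := leP x y; move=> /andP[? ?].
  by rewrite !ger0_norm; lra.
by rewrite !ler0_norm; lra.
Qed.

Lemma basis_norm i : `|e i| <= 1.
Proof.
by apply: mx_norm_le => // a b; rewrite mxE; case: (_ && _); rewrite ?normr1 ?normr0.
Qed.

Lemma cube_segment r (x y : V) (l : R) : 0 <= l <= 1 -> cube r x -> cube r (y + x) ->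
  cube r (l *: y + x).
Proof.
move=> /andP[l0 l1] xr yr; apply: cubeP (cube_gt0 xr) _ => i.
have := cube_coord i xr; have := cube_coord i yr; rewrite !mxE !ltr_norml.
move: (y i 0) (x i 0) => a b /andP[? ?] /andP[? ?].
have [a0|a0] := leP 0 a.
  have := mulr_ge0 l0 a0; have := ler_piMl a0 l1; move: (l * a) => c *.
  by apply/andP; split; lra.
have := mulr_ge0_le0 l0 (ltW a0); have := ler_wnM2r (ltW a0) l1; rewrite mul1r.
by move: (l * a) => c *; apply/andP; split; lra.
Qed.

(** The substituted third coordinate is changed first, then the point is shifted along [e j]. For
    [j = 2] the substitution overwrites the shift, so only the first term remains and [xi2] is a
    dummy. *)
Lemma increment_subst (g Z : V -> R) r j (h : R) y : Ck 1 (cube r) g ->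
  cube r y -> cube r (h *: e j + y) -> `|Z y| < r -> `|Z (h *: e j + y)| < r ->
  let c w := upd 2 w (Z w) in
  exists xi1 xi2, [/\ `|xi1 - c y| <= `|h| + `|Z (h *: e j + y) - Z y|,
    `|xi2 - c y| <= `|h|, cube r xi1, cube r xi2 &
    g (c (h *: e j + y)) - g (c y) = (Z (h *: e j + y) - Z y) * 'D_(e 2) g xi1
       + h * (if j == 2 then 0 else 'D_(e j) g xi2)].
Proof.
set y' := h *: e j + y => Cg yr y'r Zr Z'r c.
have yy' : `|y' - y| <= `|h|.
  by rewrite addrK normrZ -[leRHS]mulr1 ler_wpM2l // basis_norm.
have [u ub E1] := @MVT_dir R g ('D_(e 2) g) 2 y' (Z y) (Z y') (fun u ub =>
  Ck_is_derive 2 Cg (upd_cube 2 y'r (between_norm_lt Zr Z'r ub))).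
have B1 : `|upd 2 y' u - c y| <= `|h| + `|Z y' - Z y|.
  apply: mx_norm_le => [|a b]; first by rewrite addr_ge0.
  rewrite (ord1 b) [X in `|X|]mxE [X in `|_ + X|]mxE !updE; case: eqP => _.
    by apply: le_trans (between_dist ub) _; rewrite lerDr.
  apply: le_trans _ (le_trans yy' _); last by rewrite lerDl.
  by apply: le_trans (mx_coord_le _ a 0); rewrite !mxE.
have C1 : cube r (upd 2 y' u) := upd_cube 2 y'r (between_norm_lt Zr Z'r ub).
have [j2|j2] := eqVneq j 2.
  exists (upd 2 y' u), (c y); split => //; first by rewrite subrr normr0.
    exact: upd_cube.
  rewrite mulr0 addr0 -E1; congr (_ - g _).
  by rewrite /c /y' j2 upd_add.
have inb (l : R) : 0 <= l <= 1 -> cube r (l *: (h *: e j) + c y).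
  move=> l01; apply: cube_segment => //; first exact: upd_cube.
  by rewrite -upd_shift //; exact: upd_cube.
have [l l01 E2] := @line_MVT R _ g (fun x => h * 'D_(e j) g x) (c y) (h *: e j)
  (fun l l01 => is_derive_dirZ h (Ck_is_derive j Cg (inb l l01))).
exists (upd 2 y' u), (l *: (h *: e j) + c y); split => //; last 2 first.
- exact: inb.
- by rewrite -E1 -E2 -upd_shift // subrKA.
rewrite addrK normrZ; move/andP: l01 => [l0 l1]; rewrite (ger0_norm l0).
apply: le_trans (ler_piMl _ l1) _ => //.
by rewrite normrZ -[leRHS]mulr1 ler_wpM2l // basis_norm.
Qed.

End Picard.

(** * Smooth dependence of solutions on parameters and initial values *)

Section ODE.
Context {R : realType}.
Local Notation V := 'cV[R]_3.
Local Notation e i := (Defs.basis R i).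
Implicit Types (A : set V) (x v w : V) (k j : 'I_3) (r s t eps : R).

(* The candidate for the derivative of the solution in the direction of a
   parameter: variation of constants for [W' = a W + b], [W = i] on [v_k = 0]. *)
Definition linear_solution d k (a b : V -> R) (i : R) v : R :=
  expR (prim d k a v) *
  (i + prim d k (fun w => expR (- prim d k a w) * b w) v).

Lemma linear_solution_Ck m d k (a b : V -> R) (i : R) :
  Ck m (cube d) a -> Ck m (cube d) b -> Ck m (cube d) (linear_solution d k a b i).
Proof.
have oc := @cube_open R d => Ca Cb; have CA := prim_Ck k Ca.
apply: CkM => //; first exact: Ck_exp.
apply: CkD => //; first exact: Ck_cst.
apply: prim_Ck; apply: CkM => //; apply: Ck_exp => //; exact: CkN.
Qed.

Lemma linear_solution0 d k (a b : V -> R) (i : R) v :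
  Ck 0 (cube d) a -> Ck 0 (cube d) b -> cube d v -> v k 0 = 0 ->
  linear_solution d k a b i v = i.
Proof.
have oc := @cube_open R d => Ca Cb vd v0; have CA := prim_Ck k Ca.
rewrite /linear_solution !prim0 //.
- by rewrite expR0 addr0 mul1r.
- have C : Ck 0 (cube d) (fun w => expR (- prim d k a w) * b w).
    exact: (CkM oc (Ck_exp oc (CkN oc CA)) Cb).
  by move=> w wd; exact: Ck_continuous C wd.
- by move=> w wd; exact: Ck_continuous Ca wd.
Qed.

Lemma linear_solution_derive d k (a b : V -> R) (i : R) v :
  Ck 0 (cube d) a -> Ck 0 (cube d) b -> cube d v ->
  is_derive v (e k) (linear_solution d k a b i)
    (a v * linear_solution d k a b i v + b v).
Proof.
have oc := @cube_open R d => Ca Cb vd; have CA := prim_Ck k Ca.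
have C : Ck 0 (cube d) (fun w => expR (- prim d k a w) * b w).
  exact: (CkM oc (Ck_exp oc (CkN oc CA)) Cb).
have D1 : is_derive v (e k) (prim d k a) (a v).
  by apply: is_derive_prim => // w wd; exact: Ck_continuous Ca wd.
have D2 : is_derive v (e k) (prim d k (fun w => expR (- prim d k a w) * b w))
    (expR (- prim d k a v) * b v).
  by apply: is_derive_prim => // w wd; exact: Ck_continuous C wd.
have D := is_deriveM (is_derive_comp1 D1 (is_derive_expR _))
  (is_deriveD (is_derive_cst i v (e k)) D2).
apply: is_derive_eq D _; rewrite /linear_solution add0r.
have -> : (cst i + prim d k (fun w => expR (- prim d k a w) * b w)) v =
   i + prim d k (fun w => expR (- prim d k a w) * b w) v by [].
have sc (x y : R) : x *: y = x * y by [].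
rewrite !sc expRN mulVKf; last by rewrite gt_eqF // expR_gt0.
by move: (expR _) (prim _ _ _ _) => *; ring.
Qed.

(** The increment [D] of [Z] along [h *: e j] and [h] times the variational solution [W] satisfy
    nearly the same linear equation and agree at 0; [Gronwall] bounds their difference [E] by [eps]
    times the absolute value of [h]. *)
Lemma ode_param_derive (g Z : V -> R) k j r (d M : R) v :
  let c w := upd 2 w (Z w) in
  let W := linear_solution d k (fun w => 'D_(e 2) g (c w))
    (fun w => if j == 2 then 0 else 'D_(e j) g (c w)) (j == 2)%:R in
  k != 2 -> j != k -> 0 < d -> d <= r -> 0 <= M -> d * M <= 1 / 2 ->
  Ck 1 (cube r) g -> (forall i w, cube r w -> `|'D_(e i) g w| <= M) ->
  (forall w, cube d w -> [/\ {for w, continuous Z}, `|Z w| < r,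
    is_derive w (e k) Z (g (c w)) & w k 0 = 0 -> Z w = w 2 0]) ->
  cube d v -> is_derive v (e j) Z (W v).
Proof.
move=> c W k2 jk d0 dr M0 dM Cg gM HZ vd.
have cr w : cube d w -> cube r (c w).
  move=> wd; have [_ Zr _ _] := HZ _ wd; apply: upd_cube => //; exact: cube_le wd.
have cDg i w : cube r w -> {for w, continuous ('D_(e i) g)}.
  by move=> wr; exact: Ck_continuous (Ck_derive i Cg) wr.
have Ca : Ck 0 (cube d) (fun w => 'D_(e 2) g (c w)).
  split=> // w wd; have [cZ Zr _ _] := HZ _ wd.
  by apply: continuous_subst (cDg 2) cZ _ Zr; exact: cube_le wd.
have Cb : Ck 0 (cube d) (fun w => if j == 2 then 0 else 'D_(e j) g (c w)).
  case: eqP => _; first by apply: Ck_cst; exact: cube_open.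
  split=> // w wd; have [cZ Zr _ _] := HZ _ wd.
  by apply: continuous_subst (cDg j) cZ _ Zr; exact: cube_le wd.
have dW w : cube d w -> is_derive w (e k) W ('D_(e 2) g (c w) * W w +
   (if j == 2 then 0 else 'D_(e j) g (c w))).
  by move=> wd; exact: linear_solution_derive.
have vkd := cube_coord k vd.
suff H : h^-1 *: (Z (h *: e j + v) - Z v) @[h --> 0^'] --> W v.
  by split; [apply/cvg_ex; exists (W v)|apply/cvg_lim].
apply/cvgrPdist_le => eps eps0.
(* The last estimate is [2 * (d * (4 * |h| * eps'))], which this choice makes equal to
   [|h| * eps]. *)
pose eps' := eps / (8 * d); have e0 : 0 < eps' by rewrite divr_gt0 ?mulr_gt0.
have vtd t : `|t| <= `|v k 0| -> cube d (upd k v t).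
  by move=> tv; apply: upd_cube => //; exact: le_lt_trans vkd.
have cc t : `|t| <= `|v k 0| -> {for t, continuous (fun t => c (upd k v t))}.
  move=> tv; apply: (@continuous_comp _ _ _ (upd k v) c); first exact: continuous_upd.
  by apply: continuous_upd_fun; case: (HZ _ (vtd _ tv)).
have [d1 d10 H1] := @uniform_along R _ ('D_(e 2) g) `|v k 0| (cube r) _
  (@cube_open R r) e0 cc (fun t tv => cr _ (vtd _ tv)) (cDg 2).
have [d2 d20 H2] := @uniform_along R _ ('D_(e j) g) `|v k 0| (cube r) _
  (@cube_open R r) e0 cc (fun t tv => cr _ (vtd _ tv)) (cDg j).
have [d3 d30 H3] := open_ball (@cube_open R d) vd.
(* The points [xi1] given by [increment_subst] are within [|h| + |D t| <= 4 * |h|] of the curve,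
   whence the factor 4. *)
have [d4 [d40 d41 d42 d43]] : exists d4, [/\ 0 < d4, 4 * d4 <= d1, 4 * d4 <= d2 & d4 <= d3].
  exists (Num.min (d1 / 4) (Num.min (d2 / 4) d3)); split.
  - by rewrite !lt_min d30 !divr_gt0.
  - by rewrite mulrC -ler_pdivlMr // ge_min lexx.
  - by rewrite mulrC -ler_pdivlMr // !ge_min lexx orbT.
  - by rewrite !ge_min lexx !orbT.
near=> h.
have h0 : h != 0 by near: h; exact: nbhs_dnbhs_neq.
have hd : `|h| < d4 by near: h; exact: dnbhs0_lt.
have hn : 0 < `|h| by rewrite normr_gt0.
have v'd : cube d (h *: e j + v).
  apply: H3; rewrite addrK normrZ; apply: le_lt_trans (lt_le_trans hd d43).
  by rewrite -[leRHS]mulr1 ler_wpM2l // basis_norm.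
have v'k : (h *: e j + v) k 0 = v k 0.
  by rewrite 2!mxE basisE eq_sym (negbTE jk) mulr0 add0r.
have v'td t : `|t| <= `|v k 0| -> cube d (h *: e j + upd k v t).
  move=> tv; rewrite -upd_shift //; apply: upd_cube => //.
  exact: le_lt_trans vkd.
pose D t := Z (h *: e j + upd k v t) - Z (upd k v t).
have dD t : `|t| <= `|v k 0| ->
    is_derive t 1 D (g (c (h *: e j + upd k v t)) - g (c (upd k v t))).
  move=> tv; apply: (is_derive_upd (f := fun w => Z (h *: e j + w) - Z w)).
  apply: is_deriveB; last by case: (HZ _ (vtd _ tv)).
  by apply: is_derive_shiftV; case: (HZ _ (v'td _ tv)).
have D0 : D 0 = h * (j == 2)%:R.
  have z0 : `|0 : R| <= `|v k 0| by rewrite normr0.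
  have [_ _ _ Z1] := HZ _ (vtd _ z0); have [_ _ _ Z2] := HZ _ (v'td _ z0).
  rewrite /D Z1 ?updE ?eqxx // Z2; last first.
    by rewrite 2!mxE updE eqxx addr0 basisE eq_sym (negbTE jk) mulr0.
  by rewrite 2!mxE !updE basisE eq_sym addrK.
have inc t : `|t| <= `|v k 0| -> exists xi1 xi2,
   [/\ `|xi1 - c (upd k v t)| <= `|h| + `|D t|,
    `|xi2 - c (upd k v t)| <= `|h|, cube r xi1, cube r xi2 &
    g (c (h *: e j + upd k v t)) - g (c (upd k v t)) = D t * 'D_(e 2) g xi1
       + h * (if j == 2 then 0 else 'D_(e j) g xi2)].
  move=> tv; apply: (increment_subst Cg).
  - by apply: cube_le (vtd _ tv).
  - by apply: cube_le (v'td _ tv).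
  - by case: (HZ _ (vtd _ tv)).
  - by case: (HZ _ (v'td _ tv)).
have vkM : `|v k 0| * M <= 1 / 2.
  by apply: le_trans dM; rewrite ler_wpM2r // ltW.
(* A first, rough use of [Gronwall]: the bound is [2 * (|h| + |v k 0| * |h| * M)], and
   [|v k 0| * M <= 1 / 2]. *)
have DB t : `|t| <= `|v k 0| -> `|D t| <= 3 * `|h|.
  move=> tv.
  have := Gronwall (eta := `|h| * M) (c := `|h|) (normr_ge0 _) M0 vkM dD _ _ tv.
  move=> /(_ _ _)/le_trans; apply.
  - move=> s sv; have [x1 [x2 [_ _ x1r x2r ->]]] := inc _ sv.
    rewrite (le_trans (ler_normD _ _)) // lerD // normrM.
      by rewrite mulrC ler_wpM2r // gM.
    by rewrite ler_wpM2l //; case: eqP => _; rewrite ?normr0 // gM.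
  - by rewrite D0 normrM; case: eqP => _; rewrite ?normr1 ?mulr1 // normr0 mulr0.
  - by rewrite mulrCA; nra.
pose E t := D t - h * W (upd k v t).
pose dE t := g (c (h *: e j + upd k v t)) - g (c (upd k v t)) - h *
   ('D_(e 2) g (c (upd k v t)) * W (upd k v t) +
   (if j == 2 then 0 else 'D_(e j) g (c (upd k v t)))).
have dEP t : `|t| <= `|v k 0| -> is_derive t 1 E (dE t).
  move=> tv; apply: is_deriveB; first exact: dD.
  by apply: is_deriveZ; apply: is_derive_upd; apply: dW; exact: vtd.
have bd1 (p : R) : p <= 3 * `|h| -> `|h| + p < d1.
  by move: (`|h|) hd d41 => q; clear; lra.
have bd2 : `|h| < d2 by move: (`|h|) hd hn d42 => q; clear; lra.
have EB : `|E (v k 0)| <= 2 * (0 + `|v k 0| * (4 * `|h| * eps')).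
  apply: (Gronwall (normr_ge0 _) M0 vkM dEP) => // [t tv|].
    have [x1 [x2 [x1c x2c x1r x2r gE]]] := inc _ tv; have Dt := DB _ tv.
    have [|_ A1] := H1 t x1 tv; first exact: (le_lt_trans x1c (bd1 _ Dt)).
    have [|_ A2] := H2 t x2 tv; first exact: (le_lt_trans x2c bd2).
    have A3 := gM 2 _ (cr _ (vtd _ tv)).
    rewrite /E /dE gE; move: A1 A2 A3 Dt.
    move: ('D_(e 2) g x1) ('D_(e 2) g (c (upd k v t))) ('D_(e j) g x2)
      ('D_(e j) g (c (upd k v t))) (W (upd k v t)) (D t) => p1 p2 q1 q2 w0 Dt A1 A2 A3 B.
    (* Isolates [p2] times [E t]; the remaining two terms are at most [3 * |h| * eps'] and
       [|h| * eps']. *)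
    have -> : Dt * p1 + h * (if j == 2 then 0 else q1)
        - h * (p2 * w0 + (if j == 2 then 0 else q2)) =
        p2 * (Dt - h * w0) + (Dt * (p1 - p2) + h * (if j == 2 then 0 else q1 - q2)).
      by case: ifP => _; ring.
    rewrite (le_trans (ler_normD _ _)) // lerD //.
      by rewrite normrM ler_wpM2r.
    have -> : 4 * `|h| * eps' = (3 * `|h|) * eps' + `|h| * eps' by ring.
    rewrite (le_trans (ler_normD _ _)) // lerD //.
      by rewrite normrM ler_pM.
    rewrite normrM ler_wpM2l //; case: ifP => _ //.
    by rewrite normr0 ltW.
  have z0 : `|0 : R| <= `|v k 0| by rewrite normr0.
  rewrite /E D0 /W linear_solution0 ?subrr ?normr0 //; first exact: vtd.
  by rewrite updE eqxx.
have -> : W v - h^-1 *: (Z (h *: e j + v) - Z v) = - (h^-1 * E (v k 0)).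
  rewrite /E /D upd_id mulrBr mulKf // opprB //.
rewrite normrN normrM normfV ler_pdivrMl //.
apply: le_trans EB _; rewrite add0r /eps'.
have -> : `|h| * eps = 2 * (d * (4 * `|h| * (eps / (8 * d)))).
  have dN0 : d != 0 by rewrite gt_eqF.
  by field.
rewrite ler_wpM2l // ler_wpM2r ?(ltW vkd) //.
by apply: mulr_ge0; [exact: mulr_ge0|exact: ltW].
Unshelve. all: by end_near. Qed.

(** Smoothness is a bootstrap: if [Z] is of class C^p, so are [g] along the graph of [Z] and the
    coefficients of the variational equation. Hence the partial derivatives of [Z] are of class C^p,
    and [Z] is of class C^(p+1). *)
Lemma ode_exists (g : V -> R) k r : k != 2 -> 0 < r -> Csmooth (cube r) g ->
  exists d (Z : V -> R), [/\ 0 < d, d <= r, Csmooth (cube d) Z &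
    forall v, cube d v -> [/\ `|Z v| < r, is_derive v (e k) Z (g (upd 2 v (Z v))) &
      v k 0 = 0 -> Z v = v 2 0]].
Proof.
move=> k2 r0 Cg; have cr0 : cube r (0 : V) by rewrite /cube /= normr0.
(* The summand 1 leaves room for [M] to bound [g] and its partial derivatives near 0 and not only at
   0. *)
pose M := `|g 0| + \sum_i `|'D_(e i) g 0| + 1.
have N1 : \forall w \near (0 : V), cube r w.
  by apply: open_nbhs_nbhs; split=> //; exact: cube_open.
have bd (f : V -> R) : {for 0, continuous f} -> `|f 0| + 1 <= M ->
    \forall w \near (0 : V), `|f w| <= M.
  move=> /cvgrPdist_le /(_ _ ltr01) cf HM.
  apply: (@filterS _ _ (nbhs_filter (0 : V)) _ _ _ cf) => w fw.
  apply: le_trans HM; rewrite -lerBlDl; apply: le_trans fw.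
  by rewrite distrC; exact: lerB_dist.
have s0 : 0 <= \sum_i `|'D_(e i) g 0| by exact: sumr_ge0.
have N2 : \forall w \near (0 : V), `|g w| <= M.
  apply: bd; first exact: Ck_continuous (Cg 0%N) cr0.
  by rewrite /M; lra.
have N3 : \forall w \near (0 : V), forall i, `|'D_(e i) g w| <= M.
  have H i : \forall w \near (0 : V), `|'D_(e i) g w| <= M.
    apply: bd; first exact: Ck_continuous (Ck_derive i (Cg 1%N)) cr0.
    rewrite /M lerD2r (bigD1 i) //= addrCA lerDl addr_ge0 //.
    by rewrite sumr_ge0.
  exact: (@filter_forall _ _ _ _ (nbhs_filter (0 : V)) H).
have [r1 [r10 r1r gM]] : exists r1, [/\ 0 < r1, r1 <= r & forall w, cube r1 w ->
    `|g w| <= M /\ forall i, `|'D_(e i) g w| <= M].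
  have [r1 r10 Hr1] := near_cube (filterI N2 N3).
  exists (Num.min r1 r); split; first by rewrite lt_min r10.
    by rewrite ge_min lexx orbT.
  by move=> w wr; apply: Hr1; apply: cube_le wr; rewrite ge_min lexx.
have cg m : Ck m (cube r1) g by apply: Ck_sub (Cg m); exact: cube_le.
have M0 : 0 < M by rewrite /M ltr_wpDl // addr_ge0.
have M1 : 0 < 2 * (1 + M) by rewrite mulr_gt0 // addr_gt0.
have [m [m0 m1 mr1]] : exists m : R, [/\ 0 < m, m <= 1 & m <= r1].
  by exists (Num.min 1 r1); rewrite lt_min ltr01 r10 !ge_min !lexx orbT.
(* Makes [d + d * M] equal to [m / 2], which is below [r1] and at most [1 / 2]: both smallness
   conditions of [picard] hold, with [M] serving also as the Lipschitz constant. *)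
pose d := m / (2 * (1 + M)).
have d0 : 0 < d by rewrite divr_gt0.
have dE : d + d * M = m / 2.
  have MN0 : 1 + M != 0 by rewrite gt_eqF // addr_gt0.
  by rewrite /d; field.
have dM0 : 0 < d * M by rewrite mulr_gt0.
have dM : d * M <= 1 / 2 by lra.
have dr1 : d <= r1 by lra.
have dr : d <= r by lra.
have dMr : d + d * M < r1 by lra.
have gL w a b : cube r1 w -> `|a| < r1 -> `|b| < r1 ->
    `|g (upd 2 w a) - g (upd 2 w b)| <= M * `|a - b|.
  move=> wr ar br; have [u ub ->] := @MVT_dir R g ('D_(e 2) g) 2 w b a
    (fun u ub => Ck_is_derive 2 (cg 1%N) (upd_cube 2 wr (between_norm_lt br ar ub))).
  rewrite normrM mulrC ler_wpM2r //; apply: (gM _ _).2.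
  exact: upd_cube wr (between_norm_lt br ar ub).
have [Z HZ] := @picard R g k r1 d M M d0 (ltW M0) (ltW M0) dMr dM
  (fun w wr => Ck_continuous (cg 0%N) wr) (fun w wr => (gM _ wr).1) gL.
pose c w := upd 2 w (Z w).
have cc w : cube d w -> {for w, continuous (fun w => g (c w))}.
  move=> wd; have [cZ Zr _] := HZ _ wd; apply: continuous_subst cZ _ Zr.
    by move=> y yr; exact: Ck_continuous (cg 0%N) yr.
  exact: cube_le wd.
have HZ' w : cube d w -> [/\ {for w, continuous Z}, `|Z w| < r1,
    is_derive w (e k) Z (g (c w)) & w k 0 = 0 -> Z w = w 2 0].
  move=> wd; have [cZ Zr ZE] := HZ _ wd; split=> //; last first.
    by move=> wk; rewrite ZE prim0 ?addr0.
  have D := is_deriveD (is_derive_coord 2 0 (is_derive_id w (e k)))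
    (is_derive_prim k cc wd).
  have E := Ck_near (f := fun y : V => y 2 0 + prim d k (fun w => g (c w)) y)
    (g := Z) (@cube_open R d) wd (fun y yd => let: And3 _ _ zE := HZ y yd in esym zE).
  apply: (near_eq_is_derive E); apply: is_derive_eq D _.
  by rewrite basisE eq_sym (negbTE k2) add0r.
have gM' i w : cube r1 w -> `|'D_(e i) g w| <= M by move=> /gM[_]; exact.
exists d, Z; split => //; last first.
  move=> v vd; have [_ Zr dZ Z0] := HZ' _ vd; split=> //.
  exact: lt_le_trans r1r.
move=> p; elim: p => [|p IH].
  by split=> // v vd; case: (HZ _ vd).
have Cc i : Ck p (cube d) (fun x => c x i 0).
  have H : (fun x => c x i 0) = if i == 2 then Z else fun x => x i 0.
    by apply/funext => x; rewrite updE; case: eqP.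
  by rewrite H; case: eqP => _ //; apply: Ck_coord; exact: cube_open.
have cr w : cube d w -> cube r1 (c w).
  move=> wd; have [_ Zr _] := HZ _ wd; apply: upd_cube => //; exact: cube_le wd.
have Cgc (f : V -> R) : Ck p (cube r1) f -> Ck p (cube d) (fun w => f (c w)).
  by move=> Cf; apply: Ck_comp Cf Cc cr; exact: cube_open.
apply: (CkS_intro (df := fun j => if j == k then fun w => g (c w) else
  linear_solution d k (fun w => 'D_(e 2) g (c w))
    (fun w => if j == 2 then 0 else 'D_(e j) g (c w)) (j == 2)%:R)).
- exact: cube_open.
- by move=> v vd; case: (HZ _ vd).
- move=> j v vd; case: eqVneq => [->|jk]; first by case: (HZ' _ vd).
  exact: (ode_param_derive k2 jk d0 dr1 (ltW M0) dM (cg 1%N) gM' HZ' vd).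
- move=> j; case: eqP => _; first exact: Cgc.
  apply: linear_solution_Ck; first exact: (Cgc _ (Ck_derive _ (cg p.+1))).
  case: eqP => _; first by apply: Ck_cst; exact: cube_open.
  exact: (Cgc _ (Ck_derive _ (cg p.+1))).
Qed.

End ODE.

(** * Jacobian matrices and inverse functions *)

(** Completeness of the space of columns, for the fixed point theorem used in [inverse_function]. *)
HB.instance Definition _ (R : realType) m n :=
  Uniform_isComplete.Build (matrix R m n) (@mx_complete R m n).

Section Jacobian.
Context {R : realType}.
Local Notation V := 'cV[R]_3.
Local Notation e i := (Defs.basis R i).
Implicit Types (A B D : set V) (x y v w : V).

Lemma is_derive_fsum (W : normedModType R) n (h : 'I_n -> W -> R) (dh : 'I_n -> R) (x v : W) :
  (forall i, is_derive x v (h i) (dh i)) ->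
  is_derive x v (fun y : W => \sum_i h i y) (\sum_i dh i).
Proof.
move=> H; have := is_derive_sum H.
by congr is_derive; apply/funext => y; rewrite fct_sumE.
Qed.

Lemma is_derive_mulmx (W : normedModType R) m n p (F : W -> 'M[R]_(m, n))
    (G : W -> 'M[R]_(n, p)) (x v : W) (dF : 'M[R]_(m, n)) (dG : 'M[R]_(n, p)) :
  is_derive x v F dF -> is_derive x v G dG ->
  is_derive x v (fun y : W => F y *m G y) (dF *m G x + F x *m dG).
Proof.
move=> HF HG; apply: is_derive_mx => i j.
have -> : (fun y : W => (F y *m G y) i j) = (fun y : W => \sum_l F y i l * G y l j).
  by apply/funext => y; rewrite mxE.
apply: (is_derive_eq (f' := \sum_l (F x i l * dG l j + G x l j * dF i l))).
  apply: is_derive_fsum => l.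
  exact: (is_deriveM (is_derive_coord i l HF) (is_derive_coord l j HG)).
by rewrite !mxE -big_split; apply: eq_bigr => l _; rewrite addrC [G x l j * _]mulrC.
Qed.

Lemma is_derive_mulmxl (W : normedModType R) m n p (P : 'M[R]_(m, n))
    (G : W -> 'M[R]_(n, p)) (x v : W) (dG : 'M[R]_(n, p)) :
  is_derive x v G dG -> is_derive x v (fun y : W => P *m G y) (P *m dG).
Proof.
move=> HG; apply: is_derive_eq (is_derive_mulmx (is_derive_cst P x v) HG) _.
by rewrite mul0mx add0r.
Qed.

Definition jac (f : V -> V) x : 'M[R]_3 := \matrix_(i, j) 'D_(e j) f x i 0.

Lemma Ck_cV k A (f : V -> V) : open A ->
  Ck k A f <-> forall i, Ck k A (fun x => f x i 0).
Proof.
move=> oA; split=> [Cf i|Cf]; first exact: (Ck_mxP _ _ oA).1 Cf _ _.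
by apply/(Ck_mxP _ _ oA) => i j; rewrite (ord1 j).
Qed.

Lemma Csmooth_mxP A m n (G : V -> 'M[R]_(m, n)) : open A ->
  Csmooth A G <-> forall i j, Csmooth A (fun x => G x i j).
Proof.
move=> oA; split=> [CG i j k|CG k]; first exact: (Ck_mxP _ _ oA).1 (CG k) _ _.
by apply/(Ck_mxP _ _ oA) => i j; exact: CG.
Qed.

Lemma Csmooth_cV A (f : V -> V) : open A ->
  Csmooth A f <-> forall i, Csmooth A (fun x => f x i 0).
Proof.
move=> oA; split=> [Cf i k|Cf k]; first exact: (Ck_cV _ _ oA).1 (Cf k) i.
by apply/(Ck_cV _ _ oA) => i; exact: Cf.
Qed.

Lemma jacE k A (f : V -> V) x i j : Ck k.+1 A f -> A x ->
  jac f x i j = 'D_(e j) (fun x => f x i 0) x.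
Proof.
move=> Cf Ax; rewrite mxE.
by have [_ <-] := is_derive_coord i 0 (Ck_is_derive j Cf Ax).
Qed.

Lemma is_derive_dir A (f : V -> R) x v : open A -> Ck 1 A f -> A x ->
  is_derive x v f (\sum_i v i 0 * 'D_(e i) f x).
Proof. by move=> oA Cf Ax; apply: is_derive_comp Cf Ax _. Qed.

Lemma is_derive_jac A (f : V -> V) x v : open A -> Ck 1 A f -> A x ->
  is_derive x v f (jac f x *m v).
Proof.
move=> oA Cf Ax; apply: is_derive_mx => i j; rewrite (ord1 j).
have Ci := (Ck_cV _ _ oA).1 Cf i.
apply: is_derive_eq (is_derive_dir v oA Ci Ax) _.
by rewrite mxE; apply: eq_bigr => l _; rewrite mulrC (jacE _ _ Cf).
Qed.

Lemma is_derive_jac_comp (W : normedModType R) A (f : V -> V) (G : W -> V) (x v : W) (dG : V) :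
  open A -> Ck 1 A f -> A (G x) -> is_derive x v G dG ->
  is_derive x v (fun y : W => f (G y)) (jac f (G x) *m dG).
Proof.
move=> oA Cf Ax dGP; apply: is_derive_mx => i j; rewrite (ord1 j).
have Ci := (Ck_cV _ _ oA).1 Cf i.
apply: is_derive_eq (is_derive_comp oA Ci Ax dGP) _.
by rewrite mxE; apply: eq_bigr => l _; rewrite mulrC (jacE _ _ Cf).
Qed.

Lemma jac_comp A B (f g : V -> V) x : open A -> open B -> Ck 1 A f -> Ck 1 B g ->
  B x -> A (g x) -> jac (fun y => f (g y)) x = jac f (g x) *m jac g x.
Proof.
move=> oA oB Cf Cg Bx Agx; apply/matrixP => i j; rewrite [LHS]mxE.
have [_ ->] := is_derive_jac_comp oA Cf Agx (Ck_is_derive j Cg Bx).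
by rewrite !mxE; apply: eq_bigr => l _; rewrite !mxE.
Qed.

Lemma jac_near (f g : V -> V) x A : open A -> A x -> (forall y, A y -> f y = g y) ->
  jac f x = jac g x.
Proof.
move=> oA Ax fg; apply/matrixP => i j; rewrite !mxE.
by rewrite (near_eq_derive (e j) (Ck_near oA Ax fg)).
Qed.

Lemma jac_id x : jac id x = 1%:M.
Proof.
apply/matrixP => i j; rewrite !mxE.
by have [_ ->] := is_derive_id x (e j); rewrite basisE.
Qed.

Lemma Csmooth_comp A B (f : V -> R) (G : V -> V) :
  open A -> open B -> Csmooth A f -> Csmooth B G -> (forall x, B x -> A (G x)) ->
  Csmooth B (fun x => f (G x)).
Proof.
move=> oA oB Cf CG GA k; apply: Ck_comp (Cf k) _ GA => // i.
exact: (Ck_cV _ _ oB).1.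
Qed.

Lemma Csmooth_comp_mx A B m n (f : V -> 'M[R]_(m, n)) (G : V -> V) :
  open A -> open B -> Csmooth A f -> Csmooth B G -> (forall x, B x -> A (G x)) ->
  Csmooth B (fun x => f (G x)).
Proof.
move=> oA oB Cf CG GA; apply/(Csmooth_mxP _ oB) => i j k.
apply: (Ck_comp (f := fun y => f y i j)) GA => //; last first.
  by move=> l; exact: (Ck_cV _ _ oB).1.
exact: (Ck_mxP _ _ oA).1.
Qed.

Lemma Ck_mulmx k A m n p (F : V -> 'M[R]_(m, n)) (G : V -> 'M[R]_(n, p)) :
  open A -> Ck k A F -> Ck k A G -> Ck k A (fun x => F x *m G x).
Proof.
move=> oA /(Ck_mxP _ _ oA) CF /(Ck_mxP _ _ oA) CG.
apply/(Ck_mxP _ _ oA) => i j.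
apply: (Ck_ext (f := fun x => \sum_l F x i l * G x l j)) => //.
  by move=> x _; rewrite mxE.
by apply: Ck_sum => // l; exact: CkM.
Qed.

Lemma Ck_det k A n (M : V -> 'M[R]_n) : open A ->
  (forall i j, Ck k A (fun x => M x i j)) -> Ck k A (fun x => \det (M x)).
Proof.
move=> oA CM; apply: Ck_sum => // s; apply: CkM => //; first exact: Ck_cst.
by apply: Ck_prod => // i; exact: CM.
Qed.

Lemma Ck_invmx k A n (M : V -> 'M[R]_n) : open A ->
  (forall x, A x -> M x \in unitmx) -> Ck k A M -> Ck k A (fun x => invmx (M x)).
Proof.
move=> oA uM /(Ck_mxP _ _ oA) CM; apply/(Ck_mxP _ _ oA) => i j.
apply: (Ck_ext (f := fun x => (\det (M x))^-1 * ((-1) ^+ (j + i) *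
    \det (row' j (col' i (M x)))))) => //.
  by move=> x Ax; rewrite /invmx uM // !mxE.
apply: CkM => //; first apply: CkV => //.
- by move=> x /uM; rewrite unitmxE unitfE.
- exact: Ck_det.
apply: CkM => //; first exact: Ck_cst.
apply: Ck_det => // a b; apply: Ck_ext (CM (lift j a) (lift i b)) => // x _.
by rewrite !mxE.
Qed.

Lemma Ck_jac k A (f : V -> V) : open A -> Ck k.+1 A f -> Ck k A (jac f).
Proof.
move=> oA Cf; apply/(Ck_mxP _ _ oA) => i j.
apply: (Ck_ext (f := fun x => 'D_(e j) f x i 0)) => //.
  by move=> x _; rewrite mxE.
exact: (Ck_mxP _ _ oA).1 (Ck_derive j Cf) i 0.
Qed.

Lemma mulmx_norm_le (P : 'M[R]_3) v : `|P *m v| <= 3 * `|P| * `|v|.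
Proof.
apply: mx_norm_le => [|i j]; first by rewrite !mulr_ge0.
have H l : `|P i l * v l j| <= 3 * (`|P| * `|v|) / 3.
  by rewrite mulrAC mulfV // mul1r normrM ler_pM // mx_coord_le.
by rewrite mxE sum3 -mulrA; exact: ler_norm3.
Qed.

Definition diffeo D (f g : V -> V) := [/\ open D, open (f @` D),
  forall x, D x -> g (f x) = x, Csmooth D f & Csmooth (f @` D) g].

(** The Lipschitz bound makes [z - x] of order [h], so the Taylor remainder of [f] at [x] is
    negligible with respect to [h]; applying [invmx (jac f x)] to the expansion gives the derivative
    of [g]. *)
Lemma inverse_derive A (f g : V -> V) x (C : R) : 0 <= C -> open A -> Ck 1 A f -> A x ->
  jac f x \in unitmx -> open (f @` A) -> (forall z, A z -> g (f z) = z) ->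
  (forall y z, A y -> A z -> `|y - z| <= C * `|f y - f z|) ->
  forall j, is_derive (f x) (e j) g (invmx (jac f x) *m e j).
Proof.
move=> C0 oA Cf Ax uJ ofA gK HC j; set J := jac f x; set l := invmx J *m e j.
suff H : h^-1 *: (g (h *: e j + f x) - g (f x)) @[h --> 0^'] --> l.
  by split; [apply/cvg_ex; exists l|apply/cvg_lim].
apply/cvgrPdist_le => eps eps0.
(* Collects the factor 3 of [mulmx_norm_le] and the Lipschitz constant, so that the final error is
   at most [eps]. *)
pose K := 3 * `|invmx J| * (C + 1) + 1.
have K0 : 0 < K by rewrite ltr_wpDl // !mulr_ge0 // addr_ge0.
have e0 : 0 < eps / K by rewrite divr_gt0.
have T i := C1_taylor oA ((Ck_cV _ _ oA).1 Cf i) Ax e0.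
have [d1 d10 Hd1] : exists2 d : R, 0 < d & forall h : V, `|h| < d ->
    `|f (h + x) - f x - J *m h| <= eps / K * `|h|.
  have [d0 d00 H0] := T 0; have [d1 d10 H1] := T 1; have [d2 d20 H2] := T 2.
  exists (Num.min d0 (Num.min d1 d2)); first by rewrite !lt_min d00 d10.
  move=> h; rewrite !lt_min => /andP[/H0 {}H0 /andP[/H1 {}H1 /H2 {}H2]].
  apply: mx_norm_le => [|i k]; first by rewrite mulr_ge0 // ltW.
  rewrite (ord1 k) 4!mxE.
  have -> : (J *m h) i 0 = \sum_k h k 0 * 'D_(e k) (fun z => f z i 0) x.
    by rewrite mxE; apply: eq_bigr => a _; rewrite mulrC (jacE _ _ Cf).
  by move: i; apply: forall_ord3; [exact: H0|exact: H1|exact: H2].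
have [d2 d20 Hd2] := open_ball ofA (ex_intro2 _ _ x Ax erefl : (f @` A) (f x)).
have [d3 d30 d3P] : exists2 d3 : R, 0 < d3 & d3 <= d2 /\ (C + 1) * d3 <= d1.
  exists (Num.min d2 (d1 / (C + 1))).
    by rewrite lt_min d20 divr_gt0 // ltr_wpDl.
  split; first by rewrite ge_min lexx.
  by rewrite mulrC -ler_pdivlMr ?ltr_wpDl // ge_min lexx orbT.
near=> h.
have h0 : h != 0 by near: h; exact: nbhs_dnbhs_neq.
have hd : `|h| < d3 by near: h; exact: dnbhs0_lt.
have hej : `|h *: e j| <= `|h|.
  by rewrite normrZ -[leRHS]mulr1 ler_wpM2l // basis_norm.
have [|z Az fz] := Hd2 (h *: e j + f x).
  by rewrite addrK (le_lt_trans hej) // (lt_le_trans hd) //; case: d3P.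
rewrite -fz !gK //.
have zx : `|z - x| <= (C + 1) * `|h|.
  apply: le_trans (HC _ _ Az Ax) _; rewrite fz addrK.
  apply: ler_pM => //; first by rewrite lerDl.
have zd : `|z - x| < d1.
  apply: le_lt_trans zx _; apply: lt_le_trans (d3P.2).
  by rewrite ltr_pM2l // ltr_wpDl.
have := Hd1 _ zd; rewrite subrK fz addrK => B.
have E : l - h^-1 *: (z - x) = h^-1 *: (invmx J *m (h *: e j - J *m (z - x))).
  have -> : invmx J *m (h *: e j - J *m (z - x)) = h *: l - (z - x).
    by rewrite mulmxBr mulKmx // -scalemxAr.
  move: (l) (z - x) => p q; apply/matrixP => a b; rewrite !mxE.
  by field.
rewrite E normrZ normfV ler_pdivrMl ?normr_gt0 //.
apply: le_trans (mulmx_norm_le _ _) _.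
apply: (@le_trans _ _ (3 * `|invmx J| * (eps / K * ((C + 1) * `|h|)))).
  apply: ler_wpM2l; first by rewrite mulr_ge0.
  by apply: le_trans B _; rewrite ler_wpM2l // ltW.
have -> : 3 * `|invmx J| * (eps / K * ((C + 1) * `|h|)) =
  `|h| * (eps * ((3 * `|invmx J| * (C + 1)) / K)).
  have KN : K != 0 by rewrite gt_eqF.
  by move: (`|invmx J|) (`|h|) => a b; field.
rewrite ler_wpM2l // ler_piMr ?(ltW eps0) // ler_pdivrMr // mul1r.
by rewrite /K lerDl.
Unshelve. all: by end_near. Qed.

(** [r x = x - P *m f x] has zero Jacobian matrix at [a], hence contracts by 1/2 near [a], and the
    solutions of [f x = y] are the fixed points of [r x + P *m y]. The derivative of the inverse is
    the inverse Jacobian matrix composed with the inverse, which raises its class by one at each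
    step. *)
Theorem inverse_function A (f : V -> V) a : open A -> Csmooth A f -> A a ->
  jac f a \in unitmx -> exists D g, [/\ D `<=` A, D a & diffeo D f g].
Proof.
move=> oA Cf Aa uJ; set P := invmx (jac f a).
have PN0 : 0 <= 3 * `|P| by rewrite mulr_ge0.
pose r x := x - P *m f x.
have Cr k : Ck k A r.
  apply/(Ck_cV _ _ oA) => i; apply: (Ck_ext (f := fun x => x i 0 - \sum_l P i l * f x l 0)) => //.
    by move=> x _; rewrite !mxE.
  apply: CkB => //; first exact: Ck_coord.
  apply: Ck_sum => // l; apply: CkZ => //; exact: (Ck_cV _ _ oA).1.
have Jr x : A x -> jac r x = 1%:M - P *m jac f x.
  move=> Ax; apply/matrixP => i j; rewrite [LHS]mxE.
  have [_ ->] := is_deriveB (is_derive_id x (e j))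
    (is_derive_mulmxl P (is_derive_jac (e j) oA (Cf 1%N) Ax)).
  rewrite mulmxA !mxE; congr (_ - _); first by rewrite eqxx andbT.
  by rewrite (bigD1 j) //= big1 ?addr0 => [|l lj]; rewrite !mxE ?eqxx ?mulr1 // (negbTE lj) mulr0.
have Jra : jac r a = 0 by rewrite Jr // mulVmx // subrr.
have N1 : \forall x \near a, A x by apply: open_nbhs_nbhs.
(* Three entries bounded by 1/6 in each row give the contraction factor 1/2 in the max norm. *)
have N2 : \forall x \near a, forall ij : 'I_3 * 'I_3, `|jac r x ij.1 ij.2| <= 1 / 6.
  have H (ij : 'I_3 * 'I_3) : \forall x \near a, `|jac r x ij.1 ij.2| <= 1 / 6.
    have c : {for a, continuous (fun x => jac r x ij.1 ij.2)}.
      exact: Ck_continuous ((Ck_mxP _ _ oA).1 (Ck_jac oA (Cr 1%N)) ij.1 ij.2) Aa.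
    have p6 : (0 : R) < 1 / 6 by rewrite divr_gt0.
    move/cvgrPdist_le : c => /(_ _ p6); apply: (@filterS _ _ (nbhs_filter a)) => x.
    by rewrite Jra mxE sub0r normrN.
  exact: (@filter_forall _ _ _ _ (nbhs_filter a) H).
have N3 : \forall x \near a, \det (jac f x) != 0.
  have c : {for a, continuous (fun x => \det (jac f x))}.
    have CJ := Ck_det oA ((Ck_mxP _ _ oA).1 (Ck_jac oA (Cf 1%N))).
    exact: Ck_continuous CJ Aa.
  have d0 : 0 < `|\det (jac f a)| by rewrite normr_gt0 -unitfE -unitmxE.
  move/cvgrPdist_lt : c => /(_ _ d0); apply: (@filterS _ _ (nbhs_filter a)) => x.
  exact: dist_lt_neq0.
have [d d0 Hd] := near_ball (filterI N1 (filterI N2 N3)).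
pose D := [set x | `|x - a| < d].
have DA x : D x -> A x by move=> /Hd[].
have oD : open D.
  have -> : D = ball a d.
    by rewrite -ball_normE; apply/seteqP; split=> x /=; rewrite distrC.
  exact: ball_open.
have Dconv x y (t : R) : D x -> D y -> 0 <= t <= 1 -> D (t *: (x - y) + y).
  move=> Dx Dy /andP[t0 t1]; rewrite /D /=.
  have -> : t *: (x - y) + y - a = t *: (x - a) + (1 - t) *: (y - a).
    by apply/matrixP => i j; rewrite !mxE; ring.
  apply: le_lt_trans (ler_normD _ _) _; rewrite !normrZ !ger0_norm ?subr_ge0 //.
  move: Dx Dy; rewrite /D /=; move: (`|x - a|) (`|y - a|) => b c ? ?.
  have [bc|cb] := leP b c.
    apply: (@le_lt_trans _ _ c) => //; have := ler_wpM2l t0 bc; lra.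
  apply: (@le_lt_trans _ _ b) => //.
  have t1' : 0 <= 1 - t by rewrite subr_ge0.
  have := ler_wpM2l t1' (ltW cb); lra.
have Lr x y : D x -> D y -> `|r x - r y| <= 1 / 2 * `|x - y|.
  move=> Dx Dy; apply: mx_norm_le => [|i k]; first by rewrite mulr_ge0.
  rewrite (ord1 k); have -> : (r x - r y) i 0 = r x i 0 - r y i 0 by rewrite !mxE.
  have Ci := (Ck_cV _ _ oA).1 (Cr 1%N) i.
  have [t t01] := @line_MVT R _ (fun x => r x i 0)
    (fun w => \sum_l (x - y) l 0 * 'D_(e l) (fun x => r x i 0) w) y (x - y) (fun t t01 =>
    is_derive_dir (x - y) oA Ci (DA _ (Dconv _ _ t Dx Dy t01))).
  rewrite subrK => ->; set w := t *: (x - y) + y.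
  have [Aw [Jw _]] := Hd w (Dconv _ _ t Dx Dy t01).
  rewrite sum3; have B l : `|(x - y) l 0 * 'D_(e l) (fun x => r x i 0) w| <= 1 / 2 * `|x - y| / 3.
    rewrite normrM; have := Jw (i, l); rewrite /= (jacE _ _ (Cr 1%N)) //.
    move=> B; apply: le_trans (ler_pM _ _ (mx_coord_le _ l 0) B) _ => //.
    by move: (`|x - y|) => c; lra.
  exact: ler_norm3.
have fE x y : P *m (f x - f y) = (x - y) - (r x - r y).
  rewrite mulmxBr /r; move: (P *m f x) (P *m f y) => b c.
  by apply/matrixP => i j; rewrite !mxE; ring.
(* From [|x - y| <= 3 * |P| * |f x - f y| + |x - y| / 2]. This gives injectivity on [D] and the
   Lipschitz bound on the inverse. *)
have Lf x y : D x -> D y -> `|x - y| <= 6 * `|P| * `|f x - f y|.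
  move=> Dx Dy; have := Lr _ _ Dx Dy.
  have : `|x - y| <= `|P *m (f x - f y)| + `|r x - r y|.
    by rewrite -[X in `|X|](subrK (r x - r y)) -fE ler_normD.
  have := mulmx_norm_le P (f x - f y); rewrite -!mulrA; lra.
(* For [y] this close to [f x0], [Phi] moves the centre [x0] by at most [eta / 2], so with the
   factor 1/2 it maps the closed ball of radius [eta] to itself. *)
have surj x0 (eta : R) y : 0 < eta -> (forall x, `|x0 - x| <= eta -> D x) ->
    `|P *m (y - f x0)| <= eta / 2 -> exists2 x, D x & f x = y.
  move=> eta0 etaD yP; pose U := [set x | `|x0 - x| <= eta].
  pose Phi x := r x + P *m y.
  have Phi0 : `|x0 - Phi x0| <= eta / 2.
    apply: le_trans yP; rewrite -[leRHS]normrN mulmxBr /Phi /r.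
    move: (P *m f x0) (P *m y) => b c.
    rewrite le_eqVlt; apply/orP; left; apply/eqP; congr `|_|.
    by apply/matrixP => i j; rewrite !mxE; ring.
  have PhiL x x' : U x -> U x' -> `|Phi x - Phi x'| <= 1 / 2 * `|x - x'|.
    move=> /etaD Dx /etaD Dx'.
    by rewrite /Phi opprD addrACA subrr addr0 Lr.
  have Ux0 : U x0 by rewrite /U /= subrr normr0 ltW.
  have PhiU : {homo Phi : x / U x >-> U x}.
    move=> x Ux; rewrite /U /= -(subrKA (Phi x0)) [eta]splitr.
    apply: le_trans (ler_normD _ _) _; apply: lerD; first exact: Phi0.
    apply: le_trans (PhiL _ _ Ux0 Ux) _.
    by rewrite mulrC mul1r ler_pM2r.
  have clU : closed U.
    have := @closed_ball_closed R V x0 eta; rewrite closed_ballE //.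
  have ctr : is_contraction (mkfun_fun PhiU).
    have h0 : (0 : R) <= 1 / 2 by rewrite divr_ge0.
    exists (NngNum h0); split => /=; first by rewrite ltr_pdivrMr // mul1r ltr1n.
    by move=> [x x'] [/= Ux Ux']; exact: PhiL.
  have [x Ux xE] := banach_fixed_point ctr clU (ex_intro _ x0 Ux0).
  exists x; first exact: etaD.
  have : P *m (f x - y) = 0.
    rewrite mulmxBr; move: xE; rewrite /= /mkfun /Phi /r.
    move: (P *m f x) (P *m y) => b c xE; apply/eqP; rewrite subr_eq0; apply/eqP.
    apply: (addIr (x - b)); rewrite [in RHS]addrC -[RHS]xE addrCA subrr addr0 //.
  move=> /(congr1 (fun z => jac f a *m z)); rewrite mulmx0 mulKVmx // => /eqP.
  by rewrite subr_eq0 => /eqP.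
have oF : open (f @` D).
  rewrite openE => _ [x0 Dx0 <-]; rewrite /interior.
  have [eta eta0 etaD] := open_ball oD Dx0.
  have K0 : 0 < 3 * `|P| + 1 by rewrite ltr_wpDl.
  have eta2 : 0 < eta / 2 by rewrite divr_gt0.
  apply/nbhs_ballP; exists (eta / 2 / 2 / (3 * `|P| + 1)) => /=.
    by rewrite !divr_gt0.
  move=> y; rewrite -ball_normE /= distrC => yd.
  have [||x] := surj x0 (eta / 2) y eta2.
  - move=> x xd; apply: etaD; rewrite distrC (le_lt_trans xd) // ltr_pdivrMr //.
    by rewrite ltr_pMr // ltr1n.
  - apply: le_trans (mulmx_norm_le _ _) _.
    apply: (@le_trans _ _ ((3 * `|P| + 1) * `|y - f x0|)).
      by rewrite ler_wpM2r // lerDl.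
    by rewrite mulrC -ler_pdivlMr // ltW.
  - by move=> Dx <-; exists x.
pose g y := get [set x | D x /\ f x = y].
have gP y : (f @` D) y -> D (g y) /\ f (g y) = y.
  by move=> [x Dx fx]; apply: (@getPex _ [set x | D x /\ f x = y]); exists x.
have gK x : D x -> g (f x) = x.
  move=> Dx; have [|Dg fg] := gP (f x); first by exists x.
  have := Lf _ _ Dg Dx; rewrite fg subrr normr0 mulr0 normr_le0 subr_eq0.
  by move=> /eqP.
have CfD k : Ck k D f by apply: Ck_sub (Cf k).
have uJD x : D x -> jac f x \in unitmx.
  by move=> /Hd[_ [_]]; rewrite unitmxE unitfE.
have C0 : 0 <= 6 * `|P| by rewrite mulr_ge0.
have dg x j : D x -> is_derive (f x) (e j) g (invmx (jac f x) *m e j).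
  by move=> Dx; apply: (inverse_derive C0 oD (CfD 1%N) Dx (uJD _ Dx) oF gK).
exists D, g; split => //; first by rewrite /D /= subrr normr0.
split=> // k; elim: k => [|k IH].
  split=> [y /gP[Dg fg]|//]; rewrite -fg.
  apply/(cvgrPdist_le (FF := nbhs_filter (f (g y)))) => eps eps0.
  rewrite gK //.
  have K0 : 0 < 6 * `|P| + 1 by rewrite ltr_wpDl.
  have [d1 d10 Hd1] := open_ball oF (ex_intro2 _ _ (g y) Dg erefl : (f @` D) (f (g y))).
  apply/nbhs_ballP; exists (Num.min d1 (eps / (6 * `|P| + 1))) => /=.
    by rewrite lt_min d10 divr_gt0.
  move=> z; rewrite -ball_normE /= lt_min => /andP[z1 z2].
  have [|Dz fz] := gP z; first by apply: Hd1; rewrite distrC.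
  apply: le_trans (Lf _ _ Dg Dz) _; rewrite fz.
  apply: (@le_trans _ _ ((6 * `|P| + 1) * `|f (g y) - z|)).
    by rewrite ler_wpM2r // lerDl.
  by rewrite mulrC -ler_pdivlMr // ltW.
apply: (CkS_intro (df := fun j y => invmx (jac f (g y)) *m e j) oF).
- by move=> y fy; exact: Ck_continuous IH fy.
- by move=> j y fy; have [Dg fg] := gP _ fy; rewrite -{1}fg; exact: dg.
- move=> j; apply: (Ck_mulmx oF); last exact: Ck_cst.
  apply/(Ck_mxP _ _ oF) => a' b.
  apply: (Ck_comp (f := fun x => invmx (jac f x) a' b) oD oF).
  + exact: (Ck_mxP _ _ oD).1 (Ck_invmx oD uJD (Ck_jac oD (CfD k.+1))) a' b.
  + exact: (Ck_cV _ _ oF).1 IH.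
  + by move=> y /gP[].
Qed.

End Jacobian.

(** * The Nijenhuis tensor in R^3 *)

Section Nijenhuis.
Context {R : realType}.
Local Notation V := 'cV[R]_3.
Local Notation e i := (Defs.basis R i).
Implicit Types (A B D U : set V) (x y v w : V).

Lemma derive_dir_mx A m n (f : V -> 'M[R]_(m, n)) x v : open A -> Ck 1 A f -> A x ->
  is_derive x v f (\sum_i v i 0 *: 'D_(e i) f x).
Proof.
move=> oA Cf Ax; apply: is_derive_mx => i j.
apply: is_derive_eq (is_derive_dir v oA ((Ck_mxP _ _ oA).1 Cf i j) Ax) _.
rewrite summxE; apply: eq_bigr => l _; rewrite mxE; congr (_ * _).
by have [_ ->] := is_derive_coord i j (Ck_is_derive l Cf Ax).
Qed.

Lemma derive_mx_comp A m n (f : V -> 'M[R]_(m, n)) (G : V -> V) x v (dG : V) :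
  open A -> Ck 1 A f -> A (G x) -> is_derive x v G dG ->
  is_derive x v (fun y => f (G y)) ('D_dG f (G x)).
Proof.
move=> oA Cf Ax dGP; have [_ ->] := derive_dir_mx dG oA Cf Ax.
apply: is_derive_mx => i j.
apply: is_derive_eq (is_derive_comp oA ((Ck_mxP _ _ oA).1 Cf i j) Ax dGP) _.
rewrite summxE; apply: eq_bigr => l _; rewrite [RHS]mxE; congr (_ * _).
by have [_ ->] := is_derive_coord i j (Ck_is_derive l Cf Ax).
Qed.

Lemma derive_dirP A m n (f : V -> 'M[R]_(m, n)) x v : open A -> Ck 1 A f -> A x ->
  is_derive x v f ('D_v f x).
Proof.
move=> oA Cf Ax; have D := derive_dir_mx v oA Cf Ax.
by have [d E] := D; split.
Qed.

Lemma jac_derive_sym A (f : V -> V) x v w : open A -> Ck 2 A f -> A x ->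
  'D_v (jac f) x *m w = 'D_w (jac f) x *m v.
Proof.
move=> oA Cf Ax; have CJ := Ck_jac oA Cf.
have [_ ->] := derive_dir_mx v oA CJ Ax; have [_ ->] := derive_dir_mx w oA CJ Ax.
have E k i j : ('D_(e k) (jac f) x) i j = 'D_(e k) ('D_(e j) (fun z => f z i 0)) x.
  have [_ <-] := is_derive_coord i j (Ck_is_derive k CJ Ax).
  apply: near_eq_derive; apply: (Ck_near oA Ax) => y Ay.
  exact: jacE Cf Ay.
apply/colP => i; rewrite !mxE.
transitivity (\sum_j \sum_k v k 0 * w j 0 * 'D_(e k) ('D_(e j) (fun z => f z i 0)) x).
  apply: eq_bigr => j _; rewrite summxE mulr_suml; apply: eq_bigr => k _.
  by rewrite mxE E mulrAC.
rewrite exchange_big /=; apply: eq_bigr => k _.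
rewrite summxE mulr_suml; apply: eq_bigr => j _; rewrite mxE E.
have := Schwarz k j oA ((Ck_cV _ _ oA).1 Cf i) Ax.
by move=> ->; move: ('D_(e j) _ x) => c; ring.
Qed.

(* Half of the Nijenhuis tensor, after cancellation of the derivatives of the
   two vector fields; [dH a] is the derivative of the tensor in the direction [a]. *)
Definition nij_form (H : 'M[R]_3) (dH : V -> 'M[R]_3) v w : V :=
  dH (H *m v) *m w - dH (H *m w) *m v + H *m (dH w *m v) - H *m (dH v *m w).

Definition nij (h : V -> 'M[R]_3) x v w : V :=
  nij_form (h x) (fun a => 'D_a h x) v w.

(** The algebra of tensoriality. The third hypothesis is the derivative of the relation [H J = J K]
    along a change of coordinates with Jacobian matrix [J]; [S] is its second derivative, which
    cancels by symmetry. *)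
Lemma nij_form_transport (H J K : 'M[R]_3) (dH dK : V -> 'M[R]_3)
    (S : V -> V -> V) v w :
  H *m J = J *m K -> (forall a b, S a b = S b a) ->
  (forall a b, dH (J *m a) *m (J *m b) =
     S a (K *m b) + J *m (dK a *m b) - H *m S a b) ->
  nij_form H dH (J *m v) (J *m w) = J *m nij_form K dK v w.
Proof.
move=> HJ Ssym key.
have hJ a : H *m (J *m a) = J *m (K *m a) :> V by rewrite !mulmxA HJ.
rewrite /nij_form !hJ !key (Ssym (K *m w) (K *m v)) (Ssym (K *m v) w).
rewrite (Ssym (K *m w) v) (Ssym w v) !(mulmxBr, mulmxDr, mulmxN) !hJ.
move: (S (K *m v) (K *m w)) (H *m S w (K *m v)) (H *m S v (K *m w))
  (H *m (H *m S v w)) => s1 s2 s3 s4.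
move: (J *m (dK (K *m v) *m w)) (J *m (dK (K *m w) *m v))
  (J *m (K *m (dK w *m v))) (J *m (K *m (dK v *m w))) => t1 t2 t3 t4.
by apply/colP => i; rewrite !mxE; ring.
Qed.

Lemma nij_transport D U (h k : V -> 'M[R]_3) (f : V -> V) x v w :
  open D -> open U -> Ck 2 D f -> Ck 1 U h -> Ck 1 D k ->
  (forall y, D y -> U (f y)) ->
  (forall y, D y -> h (f y) *m jac f y = jac f y *m k y) -> D x ->
  nij h (f x) (jac f x *m v) (jac f x *m w) = jac f x *m nij k x v w.
Proof.
move=> oD oU Cf Ch Ck1 DU hk Dx; set J := jac f x.
have CJ := Ck_jac oD Cf.
pose S v w := 'D_v (jac f) x *m w.
apply: (nij_form_transport (S := S)) => [|a b|a b]; [exact: hk|exact: jac_derive_sym Cf Dx|].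
  have D1 : is_derive x a (fun y => h (f y) *m jac f y)
      ('D_(J *m a) h (f x) *m J + h (f x) *m 'D_a (jac f) x).
    apply: is_derive_mulmx; last exact: derive_dirP CJ Dx.
    apply: derive_mx_comp Ch (DU _ Dx) _ => //.
    exact: (is_derive_jac a oD (Ck_S Cf) Dx).
  have D2 : is_derive x a (fun y => jac f y *m k y)
      ('D_a (jac f) x *m k x + J *m 'D_a k x).
    by apply: is_derive_mulmx; [exact: derive_dirP CJ Dx|exact: derive_dirP Ck1 Dx].
  have E : 'D_(J *m a) h (f x) *m J + h (f x) *m 'D_a (jac f) x =
      'D_a (jac f) x *m k x + J *m 'D_a k x.
    have [_ <-] := D1; have [_ <-] := D2.
    exact: (near_eq_derive _ (Ck_near oD Dx hk)).
  apply/eqP; rewrite /S !mulmxA -subr_eq opprK -mulmxDl; apply/eqP.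
  by rewrite E mulmxDl.
Qed.

(** The exterior derivative of [th] on constant vectors, where no bracket term appears; forms are
    rows, so the value is a 1 x 1 matrix. *)
Definition dform (th : V -> 'rV[R]_3) x v w : 'M[R]_1 :=
  'D_v th x *m w - 'D_w th x *m v.

(** [d1] and [d2] are the Leibniz derivatives of the forms [th h] and [th h h]; with them the
    identity becomes a formal one between products. *)
Lemma dform_nij_algebra (th : 'rV[R]_3) (H : 'M[R]_3) (dth : V -> 'rV[R]_3)
    (dH : V -> 'M[R]_3) v w (d1 d2 : V -> 'rV[R]_3) :
  (forall a, d1 a = dth a *m H + th *m dH a) ->
  (forall a, d2 a = (dth a *m H + th *m dH a) *m H + th *m H *m dH a) ->
  (dth (H *m v) *m (H *m w) - dth (H *m w) *m (H *m v))
  - (d1 (H *m v) *m w - d1 w *m (H *m v))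
  - (d1 v *m (H *m w) - d1 (H *m w) *m v)
  + (d2 v *m w - d2 w *m v) = - (th *m nij_form H dH v w).
Proof.
move=> E1 E2; rewrite /nij_form !E1 !E2 !(mulmxBr, mulmxDr, mulmxDl, mulmxN, mulmxA).
set t1 := dth (H *m v) *m H *m w; set t2 := dth (H *m w) *m H *m v.
set t3 := dth w *m H *m H *m v; set t4 := dth v *m H *m H *m w.
set t5 := th *m dH (H *m v) *m w; set t6 := th *m dH (H *m w) *m v.
set t7 := th *m dH w *m H *m v; set t8 := th *m dH v *m H *m w.
set t9 := th *m H *m dH v *m w; set t10 := th *m H *m dH w *m v.
move: t1 t2 t3 t4 t5 t6 t7 t8 t9 t10 => t1 t2 t3 t4 t5 t6 t7 t8 t9 t10.
by apply/matrixP => i j; rewrite !mxE; ring.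
Qed.

Lemma dform_nij D (h : V -> 'M[R]_3) (th : V -> 'rV[R]_3) x v w :
  open D -> Ck 1 D h -> Ck 1 D th -> D x ->
  dform th x (h x *m v) (h x *m w)
  - dform (fun y => th y *m h y) x (h x *m v) w
  - dform (fun y => th y *m h y) x v (h x *m w)
  + dform (fun y => th y *m h y *m h y) x v w = - (th x *m nij h x v w).
Proof.
move=> oD Ch Ct Dx; apply: dform_nij_algebra => a.
  by have [_] := is_derive_mulmx (derive_dirP a oD Ct Dx) (derive_dirP a oD Ch Dx).
by have [_] := is_derive_mulmx (is_derive_mulmx (derive_dirP a oD Ct Dx)
    (derive_dirP a oD Ch Dx)) (derive_dirP a oD Ch Dx).
Qed.

(** Applied to three pairs (phi, chi): (0, 0) for the Frobenius condition, then (dx3, 0) and (dX2,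
    dx3) for the closedness along the leaves of the covectors that become dX2 and dX1. *)
Lemma dform_image D (h : V -> 'M[R]_3) (th phi chi : V -> 'rV[R]_3) x v w :
  open D -> Ck 1 D h -> Ck 1 D th -> D x ->
  (forall y, D y -> th y *m h y = phi y) -> (forall y, D y -> phi y *m h y = chi y) ->
  (forall a b, dform phi x a b = 0) -> (forall a b, dform chi x a b = 0) ->
  nij h x v w = 0 -> dform th x (h x *m v) (h x *m w) = 0.
Proof.
move=> oD Ch Ct Dx th1 th2 dphi dchi n0.
have E1 a b : dform (fun y => th y *m h y) x a b = 0.
  rewrite -(dphi a b) /dform.
  by rewrite !(near_eq_derive _ (Ck_near oD Dx th1)).
have E2 a b : dform (fun y => th y *m h y *m h y) x a b = 0.
  have th3 y : D y -> th y *m h y *m h y = chi y by move=> Dy; rewrite th1 ?th2.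
  rewrite -(dchi a b) /dform.
  by rewrite !(near_eq_derive _ (Ck_near oD Dx th3)).
have := dform_nij v w oD Ch Ct Dx.
by rewrite !E1 E2 !subr0 addr0 n0 mulmx0 oppr0.
Qed.

End Nijenhuis.

(** * Diffeomorphisms between open subsets of R^3 *)

Section Diffeo.
Context {R : realType}.
Local Notation V := 'cV[R]_3.
Local Notation e i := (Defs.basis R i).
Implicit Types (A B D U : set V) (x y v w : V).

Lemma Csmooth_sub (W : normedModType R) A B (f : V -> W) :
  A `<=` B -> Csmooth B f -> Csmooth A f.
Proof. by move=> AB Cf k; exact: Ck_sub (Cf k). Qed.

Lemma open_preimage A B (g : V -> V) : open A -> open B ->
  (forall y, A y -> {for y, continuous g}) -> open [set y | A y /\ B (g y)].
Proof.
move=> oA oB cg; rewrite openE => y [Ay By]; rewrite /interior.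
have N1 : \forall z \near y, A z by apply: open_nbhs_nbhs.
have N2 : \forall z \near y, B (g z).
  by apply: (cg _ Ay); apply: open_nbhs_nbhs.
exact: filterI N1 N2.
Qed.

Lemma diffeo_open_image D f g E : diffeo D f g -> open E -> E `<=` D ->
  open (f @` E).
Proof.
move=> [oD ofD gK Cf Cg] oE ED.
have -> : f @` E = [set y | (f @` D) y /\ E (g y)].
  apply/seteqP; split=> [_ [x Ex <-]|y [[x Dx <-]]].
    by split; [exists x => //; exact: ED|rewrite gK //; exact: ED].
  by rewrite gK // => Ex; exists x.
exact: (open_preimage ofD oE (fun y fy => Ck_continuous (Cg 0%N) fy)).
Qed.

Lemma diffeo_restrict D f g E : diffeo D f g -> open E -> E `<=` D -> diffeo E f g.
Proof.
move=> df oE ED; have oI := diffeo_open_image df oE ED; have [oD ofD gK Cf Cg] := df.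
split=> //; [by move=> x /ED/gK|exact: Csmooth_sub Cf|].
by apply: Csmooth_sub Cg => _ [x Ex <-]; exists x => //; exact: ED.
Qed.

Lemma diffeo_inv D f g : diffeo D f g -> diffeo (f @` D) g f.
Proof.
move=> [oD ofD gK Cf Cg].
have E : g @` (f @` D) = D.
  apply/seteqP; split=> [_ [_ [x Dx <-] <-]|x Dx]; first by rewrite gK.
  by exists (f x); [exists x|rewrite gK].
by split; rewrite ?E // => _ [x Dx <-]; rewrite gK.
Qed.

Lemma diffeo_comp D f g D' f' g' : diffeo D f g -> diffeo D' f' g' ->
  (forall x, D' x -> D (f' x)) -> diffeo D' (fun x => f (f' x)) (fun y => g' (g y)).
Proof.
move=> df df' D'D; have [oD ofD gK Cf Cg] := df; have [oD' ofD' gK' Cf' Cg'] := df'.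
have sub : f' @` D' `<=` D by move=> _ [x D'x <-]; exact: D'D.
have E : [set f (f' x) | x in D'] = f @` (f' @` D').
  apply/seteqP; split=> [_ [x D'x <-]|_ [_ [x D'x <-] <-]]; last by exists x.
  by exists (f' x) => //; exists x.
have oI := diffeo_open_image df ofD' sub.
split=> //; first by rewrite E.
- by move=> x D'x; rewrite gK ?gK' //; exact: D'D.
- exact: Csmooth_comp_mx Cf Cf' D'D.
rewrite E; apply: (Csmooth_comp_mx ofD' oI Cg').
  by apply: Csmooth_sub Cg => _ [_ [x D'x <-] <-]; exists (f' x) => //; exact: D'D.
by move=> _ [_ [x D'x <-] <-]; rewrite gK; [exists x|exact: D'D].
Qed.

Lemma diffeo_jac D f g x : diffeo D f g -> D x -> jac g (f x) *m jac f x = 1%:M.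
Proof.
move=> [oD ofD gK Cf Cg] Dx.
rewrite -(jac_comp ofD oD (Cg 1%N) (Cf 1%N) Dx) /=; last by exists x.
by rewrite (jac_near oD Dx gK) jac_id.
Qed.

Lemma diffeo_unit D f g x : diffeo D f g -> D x -> jac f x \in unitmx.
Proof. by move=> df Dx; have [] := mulmx1_unit (diffeo_jac df Dx). Qed.

Lemma diffeo_jac_inv D f g x : diffeo D f g -> D x ->
  jac g (f x) = invmx (jac f x).
Proof.
move=> df Dx; rewrite -[LHS]mulmx1 -(mulmxV (diffeo_unit df Dx)) mulmxA.
by rewrite (diffeo_jac df Dx) mul1mx.
Qed.

Lemma affine_diffeo (F : 'M[R]_3) a r : F \in unitmx ->
  diffeo (cube r) (fun x => F *m x + a) (fun y => invmx F *m (y - a)).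
Proof.
move=> uF; have C1 (M : 'M[R]_3) b A : open A -> Csmooth A (fun x : V => M *m x + b).
  move=> oA; apply/(Csmooth_cV _ oA) => i k.
  apply: (Ck_ext (f := fun x : V => \sum_l M i l * x l 0 + b i 0)) => //.
    by move=> x _; rewrite !mxE.
  apply: CkD => //; last exact: Ck_cst.
  by apply: Ck_sum => // l; apply: CkZ => //; exact: Ck_coord.
have gK x : invmx F *m (F *m x + a - a) = x by rewrite addrK mulKmx.
have cts (M : 'M[R]_3) b y : {for y, continuous (fun x : V => M *m x + b)}.
  exact: Ck_continuous (C1 M b setT openT 0%N) _.
have E y : invmx F *m (y - a) = invmx F *m y + - (invmx F *m a) by rewrite mulmxBr.
have oI : open [set F *m x + a | x in cube r].
  have -> : [set F *m x + a | x in cube r] = [set y | setT y /\ cube r (invmx F *m (y - a))].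
    apply/seteqP; split=> [_ [x xr <-]|y [_ yr]]; first by split=> //=; rewrite gK.
    by exists (invmx F *m (y - a)) => //; rewrite mulKVmx // subrK.
  apply: open_preimage; [exact: openT|exact: cube_open|move=> y _].
  have -> : (fun y => invmx F *m (y - a)) = (fun y => invmx F *m y + - (invmx F *m a)).
    by apply/funext.
  exact: cts.
split=> //; [exact: cube_open|by apply: C1; exact: cube_open|].
have -> : (fun y => invmx F *m (y - a)) = (fun y => invmx F *m y + - (invmx F *m a)).
  by apply/funext.
exact: C1.
Qed.

Lemma jac_affine (F : 'M[R]_3) a x : jac (fun x => F *m x + a) x = F.
Proof.
apply/matrixP => i j; rewrite mxE.
have [_ ->] := is_deriveD (is_derive_mulmxl F (is_derive_id x (e j))) (is_derive_cst a x (e j)).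
by rewrite addr0 mxE (bigD1 j) //= big1 ?addr0 => [|l lj];
  rewrite basisE ?eqxx ?mulr1 // (negbTE lj) mulr0.
Qed.

End Diffeo.

(** * Integrable plane fields *)

Section Leaves.
Context {R : realType}.
Local Notation V := 'cV[R]_3.
Local Notation e i := (Defs.basis R i).
Implicit Types (A B D U : set V) (x y v w : V).

Lemma near_line A x v : open A -> A x -> \forall h \near (0 : R), A (h *: v + x).
Proof.
move=> oA Ax; have [d d0 H] := open_ball oA Ax.
have K0 : 0 < `|v| + 1 by rewrite ltr_wpDl.
apply/nbhs_ballP; exists (d / (`|v| + 1)) => /=; first by rewrite divr_gt0.
move=> h; rewrite /ball /= sub0r normrN ltr_pdivlMr // => hd.
apply: H; rewrite addrK normrZ; apply: le_lt_trans hd.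
by rewrite ler_wpM2l // lerDl.
Qed.

(** The base points may differ: a function built by substitution agrees along an axis with a
    solution based at the substituted point. *)
Lemma is_derive_transfer (f g : V -> R) x y v df :
  (\forall h \near (0 : R), f (h *: v + x) = g (h *: v + y)) ->
  is_derive y v g df -> is_derive x v f df.
Proof.
move=> fg [dg E]; have fg0 : f x = g y.
  by have := nbhs_singleton fg; rewrite !scale0r !add0r.
have H : {near 0^', (fun h : R => h^-1 *: ((g \o shift y) (h *: v) - g y)) =1
    (fun h : R => h^-1 *: ((f \o shift x) (h *: v) - f x))}.
  have : \forall h \near (0 : R)^', f (h *: v + x) = g (h *: v + y).
    exact: (nbhs_dnbhs fg).
  by apply: filterS => h /= E'; rewrite fg0 E'.
suff L : h^-1 *: ((f \o shift x) (h *: v) - f x) @[h --> 0^'] --> df.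
  by split; [apply/cvg_ex; exists df|apply/cvg_lim].
by apply: (cvg_trans (near_eq_cvg H)); rewrite -E; exact: dg.
Qed.

Lemma is_derive_const (f : V -> R) x v : (forall h : R, f (h *: v + x) = f x) ->
  is_derive x v f 0.
Proof.
move=> H; apply: (is_derive_transfer (g := fun=> f x) (y := x)).
  by apply: (@filterE _ _ (nbhs_filter (0 : R))) => h; exact: H.
Qed.

Lemma upd_Csmooth A i (f : V -> R) : open A -> Csmooth A f ->
  Csmooth A (fun v => upd i v (f v)).
Proof.
move=> oA Cf; apply/(Csmooth_cV _ oA) => j.
have -> : (fun v => upd i v (f v) j 0) = if j == i then f else fun v => v j 0.
  by apply/funext => v; rewrite updE; case: eqP.
by case: eqP => _ // k; exact: Ck_coord.
Qed.

Lemma prim_Csmooth r k (f : V -> R) : Csmooth (cube r) f -> Csmooth (cube r) (prim r k f).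
Proof. by move=> Cf m; exact: prim_Ck. Qed.

Lemma Csmooth_continuous (W : normedModType R) A (f : V -> W) x :
  Csmooth A f -> A x -> {for x, continuous f}.
Proof. by move=> Cf; exact: Ck_continuous (Cf 0%N). Qed.

Lemma prim_zero r k v : cube r v -> prim r k (fun=> 0) v = 0.
Proof.
move=> vr; apply/eqP; rewrite -normr_le0.
apply: le_trans (prim_norm (c := 0) _ vr _) _; last by rewrite mulr0.
  by move=> w _; exact: cst_continuous.
by move=> t _; rewrite normr0.
Qed.

(** The form [al dx1 + be dx2] is closed on each plane $x^3=cst$. It is integrated along the second
    axis in the plane $x^1=0$, then along the first axis, smoothly in the parameter $x^3$. *)
Lemma leaf_poincare r (al be : V -> R) : Csmooth (cube r) al -> Csmooth (cube r) be ->
  (forall v, cube r v -> 'D_(e 1) al v = 'D_(e 0) be v) -> cube r 0 ->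
  exists X : V -> R, [/\ Csmooth (cube r) X, X 0 = 0 &
    forall v, cube r v -> is_derive v (e 0) X (al v) /\ is_derive v (e 1) X (be v)].
Proof.
move=> Ca Cb H r0; have oc := @cube_open R r.
pose b0 w := be (upd 0 w 0).
have ud w : cube r w -> cube r (upd 0 w 0).
  by move=> wr; apply: upd_cube => //; rewrite normr0 (cube_gt0 wr).
have Cb0 : Csmooth (cube r) b0.
  have C0 : Csmooth (cube r) (fun=> 0 : R) by move=> k; exact: Ck_cst.
  exact: (Csmooth_comp oc oc Cb (upd_Csmooth 0 oc C0) ud).
have ca w : cube r w -> {for w, continuous al} by move=> wr; exact: Csmooth_continuous Ca wr.
have cb w : cube r w -> {for w, continuous b0} by move=> wr; exact: Csmooth_continuous Cb0 wr.
exists (fun v => prim r 0 al v + prim r 1 b0 v); split.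
- by move=> k; apply: CkD => //; exact: prim_Csmooth.
- by rewrite !prim0 ?mxE ?addr0.
move=> v vr; split.
  apply: is_derive_eq (is_deriveD (is_derive_prim 0 ca vr)
    (is_derive_prim_other (df := fun=> 0) _ cb _ _ vr)) _ => //.
  - by move=> w _; exact: cst_continuous.
  - by move=> w _; apply: is_derive_const => h; rewrite /b0 upd_add.
  - by rewrite prim_zero // addr0.
have cda w : cube r w -> {for w, continuous ('D_(e 1) al)}.
  by move=> wr; exact: Csmooth_continuous (Csmooth_derive 1 Ca) wr.
apply: is_derive_eq (is_deriveD (is_derive_prim_other (df := 'D_(e 1) al) _ ca cda _ vr)
    (is_derive_prim 1 cb vr)) _ => //.
  by move=> w wr; exact: Ck_is_derive (Ca 1%N) wr.
(* By closedness this difference is constant along the first axis, so it equals its value [- b0] on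
   the plane $x^1=0$. *)
have D w : cube r w -> is_derive w (e 0) (prim r 0 ('D_(e 1) al) - be) ((fun=> 0) w).
  move=> wr; apply: is_derive_eq (is_deriveB (is_derive_prim 0 cda wr)
    (Ck_is_derive 0 (Cb 1%N) wr)) _.
  by rewrite H // subrr.
have [u _] := MVT_dir0 (df := fun=> 0) D vr; rewrite mulr0.
have E w : (prim r 0 ('D_(e 1) al) - be) w = prim r 0 ('D_(e 1) al) w - be w by [].
rewrite !E [prim r 0 _ (upd 0 v 0)]prim0 ?updE ?eqxx //; last exact: ud.
rewrite -/(b0 v); move: (prim r 0 ('D_(e 1) al) v) (be v) (b0 v) => a b c; lra.
Qed.

(** The exponential of minus the primitive of [a] is an integrating factor: its product with [E] is
    constant along the axis. *)
Lemma linear_ode_zero r k (a E : V -> R) : Ck 0 (cube r) a ->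
  (forall w, cube r w -> is_derive w (e k) E (a w * E w)) ->
  (forall w, cube r w -> w k 0 = 0 -> E w = 0) -> forall v, cube r v -> E v = 0.
Proof.
move=> Ca dE E0 v vr; have oc := @cube_open R r.
have ca w : cube r w -> {for w, continuous a} by move=> wr; exact: Ck_continuous Ca wr.
have D w : cube r w -> is_derive w (e k) ((fun w => expR (- prim r k a w)) * E) ((fun=> 0) w).
  move=> wr; have d1 := is_deriveN (is_derive_prim k ca wr).
  apply: is_derive_eq (is_deriveM (is_derive_comp1 d1 (is_derive_expR _)) (dE _ wr)) _.
  rewrite /GRing.scale /=; move: (expR _) (a w) (E w) => x y z; ring.
have [u _] := MVT_dir0 (df := fun=> 0) D vr; rewrite mulr0.
have M w : ((fun w => expR (- prim r k a w)) * E) w = expR (- prim r k a w) * E w by [].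
have u0 : cube r (upd k v 0) by apply: upd_cube => //; rewrite normr0 (cube_gt0 vr).
rewrite !M (E0 (upd k v 0)) ?updE ?eqxx // mulr0 subr0 => /eqP.
by rewrite mulf_eq0 gt_eqF ?expR_gt0 //= => /eqP.
Qed.

Lemma subst_derive A B (f Z : V -> R) v (j : 'I_3) : open A -> open B -> Ck 1 A f -> Ck 1 B Z ->
  B v -> A (upd 2 v (Z v)) -> j != 2 ->
  is_derive v (e j) (fun w => f (upd 2 w (Z w)))
    ('D_(e j) f (upd 2 v (Z v)) + 'D_(e j) Z v * 'D_(e 2) f (upd 2 v (Z v))).
Proof.
move=> oA oB Cf CZ Bv Av j2; have dZ := Ck_is_derive j CZ Bv.
have dc : is_derive v (e j) (fun w => upd 2 w (Z w)) (upd 2 (e j) ('D_(e j) Z v)).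
  apply: is_derive_mx => a b; rewrite (ord1 b) updE.
  have -> : (fun y : V => upd 2 y (Z y) a 0) = if a == 2 then Z else fun y : V => y a 0.
    by apply/funext => y; rewrite updE; case: eqP.
  case: eqP => _ //; exact: (is_derive_coord a 0 (is_derive_id v (e j))).
have D := is_derive_comp (G := fun w => upd 2 w (Z w)) oA Cf Av dc.
apply: (is_derive_eq D).
rewrite sum3 !updE; move: j j2 {dZ dc D}; apply: forall_ord3 => // _; rewrite !basisE /=.
- by rewrite mul1r mul0r addr0.
- by rewrite mul1r mul0r add0r.
Qed.

(* [Z] is found by integrating along the second axis in the plane [x1 = 0], then
   along the first one; integrability makes the defect ['D_(e 1) Z - Q] solve a
   linear homogeneous equation. *)
Lemma leaf_function r (P Q : V -> R) : 0 < r -> Csmooth (cube r) P -> Csmooth (cube r) Q ->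
  (forall x, cube r x -> 'D_(e 1) P x + Q x * 'D_(e 2) P x =
     'D_(e 0) Q x + P x * 'D_(e 2) Q x) ->
  exists d (Z : V -> R), [/\ 0 < d, d <= r, Csmooth (cube d) Z,
    Z 0 = 0 /\ 'D_(e 2) Z 0 = 1 &
    forall v, cube d v -> [/\ `|Z v| < r,
      'D_(e 0) Z v = P (upd 2 v (Z v)) & 'D_(e 1) Z v = Q (upd 2 v (Z v))]].
Proof.
move=> r0 CP CQ integ; have oc s := @cube_open R s.
have CQ0 : Csmooth (cube r) (fun w => Q (upd 0 w 0)).
  have C0 : Csmooth (cube r) (fun=> 0 : R) by move=> k; exact: Ck_cst.
  apply: Csmooth_comp (oc _) (oc _) CQ (upd_Csmooth 0 (oc _) C0) _ => // w wr.
  by apply: upd_cube; rewrite ?normr0.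
have [d1 [ze [d10 d1r Cze Hze]]] := ode_exists (k := 1) isT r0 CQ0.
have [d2 [ZP [d20 d2r CZP HZP]]] := ode_exists (k := 0) isT r0 CP.
have c00 s : 0 < s -> cube s (0 : V) by rewrite /cube /= normr0.
have ze0 : ze 0 = 0.
  by have [_ _ ->] := Hze _ (c00 _ d10); rewrite ?mxE.
have [d [d0 dd1 dd2 dze]] : exists d, [/\ 0 < d, d <= d1, d <= d2 &
    forall v, cube d v -> `|ze v| < d2].
  have := Csmooth_continuous Cze (c00 _ d10); rewrite /prop_for /continuous_at ze0.
  move=> /cvgrPdist_lt /(_ _ d20) /near_cube[d3 d30 H].
  exists (Num.min d3 (Num.min d1 d2)); rewrite !lt_min d30 d10 d20 !ge_min !lexx !orbT.
  split=> // v; rewrite /cube /= lt_min => /andP[v3 _].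
  by have := H _ v3; rewrite sub0r normrN.
(* [z0 v] is the height reached over the point (0, x2); [ZP] takes it as initial value for the first
   axis, which [dze] allows. *)
pose z0 v := ze (upd 0 v 0); pose c v := upd 2 v (z0 v); pose Z v := ZP (c v).
have ud w : cube d w -> cube d (upd 0 w 0).
  by move=> wr; apply: upd_cube; rewrite ?normr0.
have Cz0 : Csmooth (cube d) z0.
  have C0 : Csmooth (cube d) (fun=> 0 : R) by move=> k; exact: Ck_cst.
  apply: Csmooth_comp (oc _) (oc _) (Csmooth_sub _ Cze) (upd_Csmooth 0 (oc _) C0) ud => //.
  exact: cube_le.
have cd v : cube d v -> cube d2 (c v).
  move=> vd; apply: upd_cube; first exact: cube_le vd.
  by apply: dze; exact: ud.
have CZ : Csmooth (cube d) Z.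
  by apply: Csmooth_comp (oc _) (oc _) CZP (upd_Csmooth 2 (oc _) Cz0) cd.
have Zr v : cube d v -> `|Z v| < r by move=> /cd/HZP[].
pose s v := upd 2 v (Z v).
have sr v : cube d v -> cube r (s v).
  move=> vd; apply: upd_cube; last exact: Zr.
  by apply: cube_le vd; exact: le_trans d2r.
have dZ0 v : cube d v -> 'D_(e 0) Z v = P (s v).
  move=> vd; have [_ dZP _] := HZP _ (cd _ vd).
  have H : is_derive v (e 0) Z (P (upd 2 (c v) (ZP (c v)))).
    apply: is_derive_transfer dZP; apply: (@filterE _ _ (nbhs_filter (0 : R))) => h.
    by rewrite /Z /c /z0 upd_add upd_shift.
  by have [_ ->] := H; rewrite /c upd_upd.
have ZE v : cube d v -> v 0 0 = 0 -> Z v = ze v.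
  move=> vd v0; have [_ _ Z0] := HZP _ (cd _ vd).
  by rewrite /Z Z0 /c updE //= /z0 -[X in upd 0 v X]v0 upd_id.
pose E v := 'D_(e 1) Z v - Q (s v).
have CPs : Csmooth (cube d) (fun v => P (s v)).
  by apply: Csmooth_comp (oc _) (oc _) CP (upd_Csmooth 2 (oc _) CZ) sr.
(* [Schwarz] turns the derivative of ['D_(e 1) Z] into that of [P] along the graph of [Z]; the
   integrability condition then cancels every term without the factor [E]. *)
have dE v : cube d v -> is_derive v (e 0) E ('D_(e 2) P (s v) * E v).
  move=> vd.
  have D1 := Ck_is_derive 0 (Csmooth_derive 1 CZ 1%N) vd.
  have D2 := subst_derive (oc r) (oc d) (CQ 1%N) (CZ 1%N) vd (sr _ vd) (j := 0) isT.
  apply: is_derive_eq (is_deriveB D1 D2) _.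
  rewrite (Schwarz 0 1 (oc d) (CZ 2%N) vd).
  have -> : 'D_(e 1) ('D_(e 0) Z) v = 'D_(e 1) (fun v => P (s v)) v.
    exact: near_eq_derive _ (Ck_near (oc d) vd dZ0).
  have [_ ->] := subst_derive (oc r) (oc d) (CP 1%N) (CZ 1%N) vd (sr _ vd) (j := 1) isT.
  rewrite -/(s v) dZ0 // /E; have := integ _ (sr _ vd).
  move: ('D_(e 1) P (s v)) ('D_(e 2) P (s v)) ('D_(e 0) Q (s v))
    ('D_(e 2) Q (s v)) (P (s v)) (Q (s v)) ('D_(e 1) Z v) => p1 p2 q0 q2 p q z H.
  have -> : p1 = q0 + p * q2 - q * p2 by rewrite -H addrK.
  ring.
have E0 v : cube d v -> v 0 0 = 0 -> E v = 0.
  move=> vd v0; have [_ dze' _] := Hze _ (cube_le dd1 vd).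
  have D1 : is_derive v (e 1) Z (Q (upd 0 (upd 2 v (ze v)) 0)).
    apply: is_derive_transfer dze'.
    have := near_line (e 1) (oc d) vd; apply: filterS => h hd.
    by rewrite ZE // 2!mxE basisE /= mulr0 add0r.
  have [_ D1E] := D1; rewrite /E D1E /s (ZE _ vd v0).
  have v00 : upd 2 v (ze v) 0 0 = 0 by rewrite updE.
  by rewrite -{1}v00 upd_id subrr.
have EZ v : cube d v -> 'D_(e 1) Z v = Q (s v).
  move=> vd; apply/eqP; rewrite -subr_eq0; apply/eqP.
  apply: (linear_ode_zero _ dE E0 vd).
  by apply: Ck_comp (Csmooth_derive 2 CP 0%N) _ sr => // i;
    exact: (Ck_cV _ _ _).1 (upd_Csmooth 2 (oc _) CZ 0%N) i.
exists d, Z; split => //; first exact: le_trans d2r.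
  have Z0 : Z 0 = 0 by rewrite ZE ?ze0 ?mxE //; exact: c00.
  split=> //.
  (* On the third axis both solutions still have their initial values, so there [Z] is the third
     coordinate. *)
  have : is_derive (0 : V) (e 2) Z (e 2 2 0).
    apply: is_derive_transfer (is_derive_coord 2 0 (is_derive_id (0 : V) (e 2))).
    have := near_line (e 2) (oc d) (c00 _ d0); apply: filterS => h hd.
    have z (i : 'I_3) : i != 2 -> (h *: e 2 + 0) i 0 = 0.
      by move=> /negbTE i2; rewrite addr0 mxE basisE i2 mulr0.
    rewrite (ZE _ hd (z 0 isT)); have [_ _ ->] := Hze _ (cube_le dd1 hd) => //.
    exact: z.
  by case=> _ ->; rewrite basisE.
by move=> v vd; split; [exact: Zr|exact: dZ0|exact: EZ].
Qed.

End Leaves.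

(** * Normal form of a nilpotent field with vanishing Nijenhuis tensor *)

Section Flattening.
Context {R : realType}.
Local Notation V := 'cV[R]_3.
Local Notation e i := (Defs.basis R i).
Local Notation u := (u_mx R).
Implicit Types (A B D U : set V) (x y v w : V).

Lemma mulmx3 m n (A : 'M[R]_(m, 3)) (B : 'M[R]_(3, n)) i j :
  (A *m B) i j = A i 0 * B 0 j + A i 1 * B 1 j + A i 2 * B 2 j.
Proof. by rewrite mxE sum3. Qed.

Lemma mulmx_basis m (A : 'M[R]_(m, 3)) j i : (A *m e j) i 0 = A i j.
Proof. by rewrite -colE mxE. Qed.

Lemma u_mxE i j : u i j = ((i == 0) && (j == 1))%:R + ((i == 1) && (j == 2))%:R.
Proof. by rewrite !mxE. Qed.

Lemma matrix3P n (A B : 'M[R]_(3, n)) :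
  (forall j, [/\ A 0 j = B 0 j, A 1 j = B 1 j & A 2 j = B 2 j]) -> A = B.
Proof.
by move=> H; apply/matrixP => i j; case: (H j) => a b c; move: i; apply: forall_ord3.
Qed.

Lemma u_cube : u *m u *m u = 0.
Proof.
apply: matrix3P; apply: forall_ord3; rewrite !mulmx3 !u_mxE !mxE /=; split; ring.
Qed.

Lemma alternating_pairing (d : 'I_3 -> 'rV[R]_3) (T : 'I_3 -> 'I_3 -> R) v w :
  (forall i j, d i 0 j = T i j) ->
  ((\sum_i v i 0 *: d i) *m w - (\sum_i w i 0 *: d i) *m v) 0 0 =
  (v 0 0 * w 1 0 - v 1 0 * w 0 0) * (T 0 1 - T 1 0)
  + (v 0 0 * w 2 0 - v 2 0 * w 0 0) * (T 0 2 - T 2 0)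
  + (v 1 0 * w 2 0 - v 2 0 * w 1 0) * (T 1 2 - T 2 1).
Proof.
move=> dT; rewrite [LHS]mxE [X in _ + X = _]mxE !mulmx3 !sum3 !mxE !dT.
move: (v 0 0) (v 1 0) (v 2 0) (w 0 0) (w 1 0) (w 2 0) => *; ring.
Qed.

Lemma dformE D (th : V -> 'rV[R]_3) x v w : open D -> Ck 1 D th -> D x ->
  dform th x v w 0 0 =
  (v 0 0 * w 1 0 - v 1 0 * w 0 0) *
    ('D_(e 0) (fun y => th y 0 1) x - 'D_(e 1) (fun y => th y 0 0) x)
  + (v 0 0 * w 2 0 - v 2 0 * w 0 0) *
    ('D_(e 0) (fun y => th y 0 2) x - 'D_(e 2) (fun y => th y 0 0) x)
  + (v 1 0 * w 2 0 - v 2 0 * w 1 0) *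
    ('D_(e 1) (fun y => th y 0 2) x - 'D_(e 2) (fun y => th y 0 1) x).
Proof.
move=> oD Ct Dx; rewrite /dform.
have [_ ->] := derive_dir_mx v oD Ct Dx; have [_ ->] := derive_dir_mx w oD Ct Dx.
have E i j : ('D_(e i) th x) 0 j = 'D_(e i) (fun y => th y 0 j) x.
  by have [_ <-] := is_derive_coord 0 j (Ck_is_derive i Ct Dx).
exact: (@alternating_pairing (fun i => 'D_(e i) th x)
  (fun i j => 'D_(e i) (fun y => th y 0 j) x) v w E).
Qed.

Definition row3 (a b c : R) : 'rV[R]_3 :=
  \row_i (if i == 0 then a else if i == 1 then b else c).

Lemma row3E a b c : [/\ row3 a b c 0 0 = a, row3 a b c 0 1 = b & row3 a b c 0 2 = c].
Proof. by split; rewrite mxE. Qed.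

Lemma Csmooth_row3 A (a b c : V -> R) : open A -> Csmooth A a -> Csmooth A b ->
  Csmooth A c -> Csmooth A (fun x => row3 (a x) (b x) (c x)).
Proof.
move=> oA Ca Cb Cc; apply/(Csmooth_mxP _ oA) => i j.
rewrite (ord1 i); have [E0 E1 E2] : [/\ (fun x => row3 (a x) (b x) (c x) 0 0) = a,
    (fun x => row3 (a x) (b x) (c x) 0 1) = b & (fun x => row3 (a x) (b x) (c x) 0 2) = c].
  by split; apply/funext => x; rewrite mxE.
by move: j; apply: forall_ord3; rewrite ?E0 ?E1 ?E2.
Qed.

(** The minors of two vectors of the plane [x3 = p x1 + q x2] are in the ratio 1 : q : -p, and the
    nonzero common factor can be divided out. *)
Lemma pfaff_algebra (p q a0 a1 a2 b0 b1 b2 d01 d02 d12 : R) :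
  a0 * b1 - a1 * b0 != 0 -> a2 = p * a0 + q * a1 -> b2 = p * b0 + q * b1 ->
  (a0 * b1 - a1 * b0) * d01 + (a0 * b2 - a2 * b0) * d02 + (a1 * b2 - a2 * b1) * d12 = 0 ->
  d01 + q * d02 - p * d12 = 0.
Proof.
move=> N0 -> -> H; apply: (mulfI N0); rewrite mulr0 -H; ring.
Qed.

(** The data handed from one change of coordinates to the next. The normalisation [h 0 = u] keeps
    the quantities to be inverted nonzero near the origin. *)
Definition nilpotent_field r (h : V -> 'M[R]_3) :=
  [/\ 0 < r, Csmooth (cube r) h, h 0 = u,
    forall x, cube r x -> h x *m h x *m h x = 0 &
    forall x v w, cube r x -> nij h x v w = 0].

Lemma cube0 r : 0 < r -> cube r (0 : V).
Proof. by move=> r0; rewrite /cube /= normr0. Qed.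

Lemma nonzero_near r (f : V -> R) : 0 < r -> Csmooth (cube r) f -> f 0 != 0 ->
  exists s, [/\ 0 < s, s <= r & forall x, cube s x -> f x != 0].
Proof.
move=> r0 Cf f0; have f00 : 0 < `|f 0| by rewrite normr_gt0.
have := Csmooth_continuous Cf (cube0 r0); rewrite /prop_for /continuous_at.
move=> /cvgrPdist_lt /(_ _ f00) /near_cube[s s0 H].
exists (Num.min s r); rewrite lt_min s0 r0 ge_min lexx orbT; split=> // x.
rewrite /cube /= lt_min => /andP[xs _].
exact: dist_lt_neq0 (H _ xs).
Qed.

Lemma Csmooth_M A (f g : V -> R) : open A -> Csmooth A f -> Csmooth A g ->
  Csmooth A (fun x => f x * g x).
Proof. by move=> oA Cf Cg k; exact: CkM. Qed.

Lemma Csmooth_B A (f g : V -> R) : open A -> Csmooth A f -> Csmooth A g ->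
  Csmooth A (fun x => f x - g x).
Proof. by move=> oA Cf Cg k; exact: CkB. Qed.

Lemma Csmooth_mulmx A m n p (F : V -> 'M[R]_(m, n)) (G : V -> 'M[R]_(n, p)) :
  open A -> Csmooth A F -> Csmooth A G -> Csmooth A (fun x => F x *m G x).
Proof. by move=> oA CF CG k; exact: Ck_mulmx. Qed.

Lemma Csmooth_cst (W : normedModType R) A (c : W) : open A -> Csmooth A (fun=> c).
Proof. by move=> oA k; exact: Ck_cst. Qed.

Lemma Csmooth_entry A m n (h : V -> 'M[R]_(m, n)) i j : open A -> Csmooth A h ->
  Csmooth A (fun x => h x i j).
Proof. by move=> oA Ch; exact: (Csmooth_mxP _ oA).1. Qed.

Lemma dform_cst (c : 'rV[R]_3) x v w : dform (fun=> c) x v w = 0.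
Proof.
rewrite /dform; have [_ ->] := is_derive_cst c x v; have [_ ->] := is_derive_cst c x w.
by rewrite !mul0mx subrr.
Qed.

(* The row [(-P, -Q, 1)] annihilates the image of [h], and the differential
   equation is the Frobenius condition for this plane field. *)
Lemma pfaff_form r h : nilpotent_field r h ->
  exists s (P Q : V -> R), [/\ 0 < s <= r, Csmooth (cube s) P, Csmooth (cube s) Q,
    P 0 = 0 /\ Q 0 = 0 & forall x, cube s x -> row3 (- P x) (- Q x) 1 *m h x = 0 /\
     'D_(e 1) P x + Q x * 'D_(e 2) P x = 'D_(e 0) Q x + P x * 'D_(e 2) Q x].
Proof.
move=> [r0 Ch h0 h3 nh]; have oc s := @cube_open R s.
(* [N] is a minor of the last two columns of [h], the vectors on which [dform_image] is evaluated.
   [et] satisfies [et h = 0] because $h^3=0$, and it is (0, 0, 1) at the origin, so dividing by its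
   third entry gives (-P, -Q, 1). *)
pose N x := h x 0 1 * h x 1 2 - h x 1 1 * h x 0 2.
pose et x := row 0 (h x *m h x).
have Ce i j : Csmooth (cube r) (fun x => h x i j) by exact: Csmooth_entry.
have CN : Csmooth (cube r) N by apply: Csmooth_B => //; exact: Csmooth_M.
have N0 : N 0 != 0.
  have -> : N 0 = 1 by rewrite /N h0 !u_mxE /=; ring.
  exact: oner_neq0.
have Cet j : Csmooth (cube r) (fun x => et x 0 j).
  have := Csmooth_entry 0 j (oc r) (Csmooth_mulmx (oc r) Ch Ch).
  by move=> H k; apply: Ck_ext (H k) => // x _; rewrite /et [in RHS]mxE.
have et0 j : et 0 0 j = (j == 2)%:R.
  rewrite /et mxE h0 mulmx3 !u_mxE /=; move: j; apply: forall_ord3 => /=; ring.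
have [s1 [s10 s1r N1]] := nonzero_near r0 CN N0.
have et20 : et 0 0 2 != 0 by rewrite et0 oner_eq0.
have [s2 [s20 s2r E1]] := nonzero_near r0 (Cet 2) et20.
pose s := Num.min s1 s2; have s0 : 0 < s by rewrite lt_min s10.
have ss1 : s <= s1 by rewrite ge_min lexx.
have ss2 : s <= s2 by rewrite ge_min lexx orbT.
have sr : s <= r by exact: le_trans s1r.
pose P x := - (et x 0 0 / et x 0 2); pose Q x := - (et x 0 1 / et x 0 2).
have CQ j : Csmooth (cube s) (fun x => - (et x 0 j / et x 0 2)).
  move=> k; apply: CkN => //; apply: CkM => //; first exact: Ck_sub (cube_le sr) (Cet j k).
  apply: CkV => //; last exact: Ck_sub (cube_le sr) (Cet 2 k).
  by move=> x xs; apply: E1; exact: cube_le xs.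
have Cth : Csmooth (cube s) (fun x => row3 (- P x) (- Q x) 1).
  apply: Csmooth_row3 => //; last exact: Csmooth_cst.
  - by move=> k; apply: CkN => //; exact: CQ.
  - by move=> k; apply: CkN => //; exact: CQ.
have thh x : cube s x -> row3 (- P x) (- Q x) 1 *m h x = 0.
  move=> xs; have xr := cube_le sr xs; have x2 := E1 _ (cube_le ss2 xs).
  have -> : row3 (- P x) (- Q x) 1 = (et x 0 2)^-1 *: et x.
    apply/rowP; apply: forall_ord3; rewrite mxE [RHS]mxE /P /Q /= ?opprK ?mulVf //;
      exact: mulrC.
  by rewrite -scalemxAl /et -row_mul h3 // row0 scaler0.
exists s, P, Q; rewrite s0 sr; split=> //; try exact: CQ.
  by rewrite /P /Q !et0 /= !mul0r oppr0.
move=> x xs; split; first exact: thh.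
have xr := cube_le sr xs.
have dz := dform_image (v := e 1) (w := e 2) (oc s) (Csmooth_sub (cube_le sr) Ch 1%N)
  (Cth 1%N) xs thh (fun y _ => mul0mx _ (h y)) (fun a b => dform_cst 0 x a b)
  (fun a b => dform_cst 0 x a b) (nh _ _ _ xr).
have := congr1 (fun M : 'M[R]_1 => M 0 0) dz.
rewrite (dformE _ _ (oc s) (Cth 1%N) xs) [X in _ = X]mxE !mulmx_basis.
have dE i (f : V -> R) : Csmooth (cube s) f -> 'D_(e i) (fun y => - f y) x = - 'D_(e i) f x.
  by move=> Cf; have [_ ->] := is_deriveN (Ck_is_derive i (Cf 1%N) xs).
have E0 : (fun y => row3 (- P y) (- Q y) 1 0 0) = (fun y => - P y).
  by apply/funext => y; rewrite mxE.
have E1' : (fun y => row3 (- P y) (- Q y) 1 0 1) = (fun y => - Q y).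
  by apply/funext => y; rewrite mxE.
have E2 : (fun y => row3 (- P y) (- Q y) 1 0 2) = (fun=> 1).
  by apply/funext => y; rewrite mxE.
have [_ D0] := is_derive_cst (1 : R) x (e 0); have [_ D1] := is_derive_cst (1 : R) x (e 1).
rewrite E0 E1' E2 D0 D1 !(dE _ P (CQ _)) !(dE _ Q (CQ _)) => /pfaff_algebra H.
have hrow j : h x 2 j = P x * h x 0 j + Q x * h x 1 j.
  have := congr1 (fun M : 'rV[R]_3 => M 0 j) (thh _ xs).
  rewrite mulmx3 [X in _ = X]mxE; have [-> -> ->] := row3E (- P x) (- Q x) 1.
  move: (h x 2 j) (h x 0 j) (h x 1 j) => a b c Z.
  by apply/eqP; rewrite -subr_eq0 -Z; apply/eqP; ring.
have := H _ _ (N1 _ (cube_le ss1 xs)) (hrow 1) (hrow 2).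
move: ('D_ _ _ x) ('D_ _ _ x) ('D_ _ _ x) ('D_ _ _ x) (P x) (Q x) => a b c d p q Z.
by lra.
Qed.

Lemma conj_cube (M J : 'M[R]_3) : J \in unitmx -> let C := invmx J *m M *m J in
  C *m C *m C = invmx J *m (M *m M *m M) *m J.
Proof. by move=> uJ /=; rewrite -!mulmxA !(mulKVmx uJ). Qed.

Lemma conj_intertwine (M J : 'M[R]_3) : J \in unitmx ->
  M *m J = J *m (invmx J *m M *m J).
Proof. by move=> uJ; rewrite -mulmxA mulKVmx. Qed.

Lemma pullback_field U h s F g : open U -> Csmooth U h ->
  (forall x, U x -> h x *m h x *m h x = 0) ->
  (forall x v w, U x -> nij h x v w = 0) -> 0 < s -> diffeo (cube s) F g ->
  (forall x, cube s x -> U (F x)) -> h (F 0) *m jac F 0 = jac F 0 *m u ->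
  nilpotent_field s (fun x => invmx (jac F x) *m h (F x) *m jac F x).
Proof.
move=> oU Ch h3 nh s0 dF FU hu; have oc := @cube_open R s.
have [_ _ _ CF _] := dF; have uF x : cube s x -> jac F x \in unitmx.
  by move=> xs; exact: (diffeo_unit dF xs).
have Ck : Csmooth (cube s) (fun x => invmx (jac F x) *m h (F x) *m jac F x).
  have CJ k : Ck k (cube s) (jac F) by exact: Ck_jac.
  apply: Csmooth_mulmx => //; apply: Csmooth_mulmx => //.
    by move=> k; exact: Ck_invmx.
  exact: (Csmooth_comp_mx oU oc Ch CF FU).
split=> //.
- by rewrite -mulmxA hu mulKmx // uF //; exact: cube0.
- by move=> x xs; rewrite (conj_cube _ (uF _ xs)) h3 ?mulmx0 ?mul0mx //; exact: FU.
move=> x v w xs; have ux := uF _ xs.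
have hk y : cube s y -> h (F y) *m jac F y =
    jac F y *m (invmx (jac F y) *m h (F y) *m jac F y).
  by move=> ys; exact: conj_intertwine (uF _ ys).
have := nij_transport v w oc oU (CF 2%N) (Ch 1%N) (Ck 1%N) FU hk xs.
rewrite nh; last exact: FU.
by move=> /esym /(congr1 (mulmx (invmx (jac F x)))); rewrite mulKmx // mulmx0.
Qed.

(* The leaves [x3 = Z(x1, x2, z)] of the image of [h] become the planes [z = cst]. *)
Lemma straighten r h : nilpotent_field r h ->
  exists s F g k, [/\ diffeo (cube s) F g, F 0 = 0, forall x, cube s x -> cube r (F x),
    nilpotent_field s k & forall x, cube s x -> h (F x) *m jac F x = jac F x *m k x /\
      forall j, k x 2 j = 0].
Proof.
move=> nf; have [r0 Ch h0 h3 nh] := nf; have oc s := @cube_open R s.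
have [s [P [Q [/andP[s0 sr] CP CQ [P0 Q0] HPQ]]]] := pfaff_form nf.
have [d [Z [d0 ds CZ [Z0 Z1] HZ]]] := leaf_function s0 CP CQ (fun x xs => (HPQ x xs).2).
pose F v := upd 2 v (Z v).
have CF : Csmooth (cube d) F by exact: upd_Csmooth.
have Fs x : cube d x -> cube s (F x).
  move=> xd; have [Zs _ _] := HZ _ xd; apply: upd_cube => //; exact: cube_le xd.
have F0 : F 0 = 0.
  by rewrite /F Z0; have := upd_id 2 (0 : V); rewrite mxE.
have J2 x j : cube d x -> jac F x 2 j = 'D_(e j) Z x.
  move=> xd; rewrite (jacE _ _ (CF 1%N) xd).
  by have -> : (fun x => F x 2 0) = Z by apply/funext => y; rewrite /F updE.
have Ji x (i j : 'I_3) : cube d x -> i != 2 -> jac F x i j = (i == j)%:R.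
  move=> xd /negbTE i2; rewrite (jacE _ _ (CF 1%N) xd).
  have -> : (fun x => F x i 0) = (fun x => x i 0).
    by apply/funext => y; rewrite /F updE i2.
  by have [_ ->] := is_derive_coord i 0 (is_derive_id x (e j)); rewrite basisE.
(* The equations of the leaves say that the annihilator of the image of [h] pulls back to a multiple
   of the third coordinate form; hence, below, the last row of [k] vanishes. *)
have thJ x : cube d x -> row3 (- P (F x)) (- Q (F x)) 1 *m jac F x =
    row3 0 0 ('D_(e 2) Z x).
  move=> xd; have [_ ZP ZQ] := HZ _ xd.
  apply/rowP; apply: forall_ord3; rewrite mulmx3 (Ji x 0) // (Ji x 1) // J2 // ?ZP ?ZQ;
    rewrite !mxE /= -?/(F x);
    [move: (P _) (Q _)|move: (P _) (Q _)|move: (P _) (Q _) ('D_ _ _ _)] => *; ring.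
have J0 : jac F 0 = 1%:M.
  have c0 := cube0 d0; have [_ ZP ZQ] := HZ _ c0.
  apply: matrix3P => j; rewrite (Ji 0 0) // (Ji 0 1) // J2 // !mxE; split=> //.
  move: j; apply: forall_ord3; rewrite ?ZP ?ZQ ?Z1 // -/(F 0) F0 ?P0 ?Q0 //.
have [D [g [Dd D0 dF]]] : exists D g, [/\ D `<=` cube d, D 0 & diffeo D F g].
  by apply: inverse_function => //; [exact: cube0|rewrite J0 unitmx1].
have [t t0 tD] : exists2 t : R, 0 < t & cube t `<=` D.
  by apply: near_cube; apply: open_nbhs_nbhs; split=> //; case: dF.
have dFt := diffeo_restrict dF (oc t) tD.
have td x : cube t x -> cube d x by move=> /tD/Dd.
have uJ x : cube t x -> jac F x \in unitmx by move=> xt; exact: (diffeo_unit dFt xt).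
have Fr x : cube t x -> cube r (F x) by move=> /td/Fs; exact: cube_le.
exists t, F, g, (fun x => invmx (jac F x) *m h (F x) *m jac F x); split=> //.
  apply: (pullback_field (oc r) Ch h3 nh t0 dFt Fr).
  by rewrite F0 h0 J0 mulmx1 mul1mx.
move=> x xt; have hk := conj_intertwine (h (F x)) (uJ _ xt); split=> // j.
move: (invmx (jac F x) *m h (F x) *m jac F x) hk => k hk.
have [th0 _] := HPQ _ (Fs _ (td _ xt)).
have K0 : row3 0 0 ('D_(e 2) Z x) *m k = 0.
  by rewrite -(thJ _ (td _ xt)) -mulmxA -hk mulmxA th0 mul0mx.
have Zn : 'D_(e 2) Z x != 0.
  apply/eqP => Z2; have := thJ _ (td _ xt); rewrite Z2.
  have -> : row3 0 0 0 = 0 by apply/rowP; apply: forall_ord3; rewrite !mxE.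
  move=> /(congr1 (mulmx^~ (invmx (jac F x)))); rewrite mulmxK ?uJ // mul0mx.
  by move=> /rowP /(_ 2); rewrite !mxE => /eqP; rewrite oner_eq0.
have := congr1 (fun M : 'rV[R]_3 => M 0 j) K0.
rewrite mulmx3 [X in _ = X]mxE; have [-> -> ->] := row3E 0 0 ('D_(e 2) Z x).
by rewrite !mul0r !add0r => /eqP; rewrite mulf_eq0 (negbTE Zn) => /eqP.
Qed.

(** As the last row is zero, the upper left 2 x 2 block $b$ has zero cube. Its determinant has cube
    0, and then $(\mathrm{tr}\,b)^3=\mathrm{tr}\,b^3+3\,\mathrm{tr}\,b\,\det b$ kills its trace. *)
Lemma nilpotent_block (M : 'M[R]_3) : M *m M *m M = 0 -> (forall j, M 2 j = 0) ->
  M 0 0 = - M 1 1 /\ M 0 1 * M 1 0 + M 1 1 * M 1 1 = 0.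
Proof.
move=> M3 M2; have E i j : (M *m M *m M) i j = 0 by rewrite M3 mxE.
have := E 0 0; have := E 0 1; have := E 1 0; have := E 1 1.
rewrite !mulmx3 !M2; move: (M 0 0) (M 0 1) (M 1 0) (M 1 1) => a b c d.
rewrite !(mulr0, mul0r, addr0) => e11 e10 e01 e00.
have D0 : a * d - b * c = 0.
  have : (a * d - b * c) ^+ 3 = 0.
    transitivity ((((a * a + b * c) * a + (a * b + b * d) * c) *
       ((c * a + d * c) * b + (c * b + d * d) * d)) -
      (((a * a + b * c) * b + (a * b + b * d) * d) *
      ((c * a + d * c) * a + (c * b + d * d) * c))); first by ring.
    by rewrite e00 e01 !mul0r subrr.
  by move=> /eqP; rewrite expf_eq0 => /eqP.
have T0 : a + d = 0.
  have : (a + d) ^+ 3 = 0.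
    transitivity (((a * a + b * c) * a + (a * b + b * d) * c) +
      ((c * a + d * c) * b + (c * b + d * d) * d) + 3 * (a + d) * (a * d - b * c)).
      by ring.
    by rewrite e00 e11 D0 mulr0 !addr0.
  by move=> /eqP; rewrite expf_eq0 => /eqP.
have aE : a = - d by apply/eqP; rewrite -addr_eq0 T0.
split=> //; rewrite aE in D0; have -> : b * c + d * d = - (- d * d - b * c) by ring.
by rewrite D0 oppr0.
Qed.

Local Notation grad f y := (row3 ('D_(e 0) f y) ('D_(e 1) f y) ('D_(e 2) f y)).

Lemma lincomb3_zero (a b c p q r : R) : a = 0 -> b = 0 -> c = 0 -> p * a + q * b + r * c = 0.
Proof. by move=> -> -> ->; rewrite !mulr0 !addr0. Qed.

Lemma dform_exact A (f : V -> R) x v w : open A -> Csmooth A f -> A x ->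
  dform (fun y => grad f y) x v w = 0.
Proof.
move=> oA Cf Ax; have Cd i : Csmooth A ('D_(e i) f) by exact: Csmooth_derive.
have C := Csmooth_row3 oA (Cd 0) (Cd 1) (Cd 2).
apply/matrixP => i j; rewrite (ord1 i) (ord1 j) (dformE v w oA (C 1%N) Ax) [RHS]mxE.
have [-> -> ->] : [/\ (fun y => grad f y 0 0) = 'D_(e 0) f,
    (fun y => grad f y 0 1) = 'D_(e 1) f &
    (fun y => grad f y 0 2) = 'D_(e 2) f].
  by split; apply/funext => y; rewrite mxE.
have S a b : 'D_(e a) ('D_(e b) f) x - 'D_(e b) ('D_(e a) f) x = 0.
  by rewrite (Schwarz a b oA (Cf 2%N) Ax) subrr.
by apply: lincomb3_zero; exact: S.
Qed.

(** The last row of [k] being zero, [dform_image] sees only derivatives along the leaf, multiplied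
    by the minor assumed nonzero. *)
Lemma closed_pair s k (al be : V -> R) (phi chi : V -> 'rV[R]_3) x :
  Csmooth (cube s) k -> Csmooth (cube s) al -> Csmooth (cube s) be ->
  (forall y, cube s y -> row3 (al y) (be y) 0 *m k y = phi y) ->
  (forall y, cube s y -> phi y *m k y = chi y) ->
  (forall a b, dform phi x a b = 0) -> (forall a b, dform chi x a b = 0) ->
  cube s x -> (forall v w, nij k x v w = 0) -> (forall j, k x 2 j = 0) ->
  k x 0 1 * k x 1 2 - k x 1 1 * k x 0 2 != 0 -> 'D_(e 1) al x = 'D_(e 0) be x.
Proof.
move=> Ck Ca Cb H1 H2 dphi dchi xs nk k2 N0; have oc := @cube_open R s.
have Cth := Csmooth_row3 oc Ca Cb (Csmooth_cst 0 oc).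
have dz := dform_image (v := e 1) (w := e 2) oc (Ck 1%N) (Cth 1%N) xs H1 H2 dphi dchi (nk _ _).
have := congr1 (fun M : 'M[R]_1 => M 0 0) dz.
rewrite (dformE _ _ oc (Cth 1%N) xs) [X in _ = X]mxE !mulmx_basis !k2.
have [-> ->] : (fun y => row3 (al y) (be y) 0 0 0) = al /\
    (fun y => row3 (al y) (be y) 0 0 1) = be.
  by split; apply/funext => y; rewrite mxE.
rewrite !(mul0r, mulr0) !subr0 !mul0r !addr0 => /eqP.
by rewrite mulf_eq0 (negbTE N0) /= subr_eq0 => /eqP.
Qed.

(** Three equations for two unknowns: Cramer's rule solves the last two, and the relations of
    [nilpotent_block] give the first. *)
Lemma second_covector (a b c d p q : R) : b * q - d * p != 0 -> a = - d ->
  b * c + d * d = 0 -> let N := b * q - d * p in let al := - d / N in let be := b / N in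
  [/\ al * a + be * c = 0, al * b + be * d = 0 & al * p + be * q = 1].
Proof.
move=> N0 -> D /=; split; [|by field|by field].
transitivity ((b * c + d * d) / (b * q - d * p)); first by field.
by rewrite D mul0r.
Qed.

(** The right-hand side is dX2: [al] and [be] come from [second_covector], while [ga] will be the
    derivative of X2 in the third variable, known only once X2 has been integrated. *)
Lemma first_covector (a b c d p q ga : R) : b * q - d * p != 0 -> a = - d ->
  b * c + d * d = 0 -> let N := b * q - d * p in let al := - d / N in let be := b / N in
  let al1 := (be * q - ga * d) / N in let be1 := (b * ga - p * be) / N in
  [/\ al1 * a + be1 * c = al, al1 * b + be1 * d = be & al1 * p + be1 * q = ga].
Proof.
move=> N0 -> D /=; split; [|by field|by field].
apply/eqP; rewrite -subr_eq0; apply/eqP.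
transitivity ((ga / (b * q - d * p) - p / (b * q - d * p) ^+ 2) * (b * c + d * d)).
  by field.
by rewrite D mulr0.
Qed.

Lemma intertwine_rows (J K : 'M[R]_3) : (forall j, K 2 j = 0) ->
  (forall j, J 2 j = (2 == j)%:R) ->
  (forall j, J 0 0 * K 0 j + J 0 1 * K 1 j = J 1 j) ->
  (forall j, J 1 0 * K 0 j + J 1 1 * K 1 j = J 2 j) -> J *m K = u *m J.
Proof.
move=> K2 J2 E0 E1; apply: matrix3P => j; rewrite !mulmx3 !u_mxE /= !K2.
rewrite !(mulr0, addr0, mul0r, add0r, mul1r) E0 E1; split=> //.
by rewrite !J2 !mul0r addr0.
Qed.

(* [dX2] and then [dX1] are found from [dX2 k = dX3] and [dX1 k = dX2], where
   [X3] is the third variable; closedness along the leaves comes from [dform_image]. *)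
Lemma flatten r k : nilpotent_field r k -> (forall x j, cube r x -> k x 2 j = 0) ->
  exists D X g, [/\ D `<=` cube r, D 0, diffeo D X g, X 0 = 0 &
    forall x, D x -> jac X x *m k x = u *m jac X x].
Proof.
move=> [r0 Ck k0 k3 nk] k2; have oc s := @cube_open R s.
pose N x := k x 0 1 * k x 1 2 - k x 1 1 * k x 0 2.
have Ce i j : Csmooth (cube r) (fun x => k x i j) by exact: Csmooth_entry.
have CN : Csmooth (cube r) N by apply: Csmooth_B => //; exact: Csmooth_M.
have N0 : N 0 = 1 by rewrite /N k0 !u_mxE /=; ring.
have N00 : N 0 != 0 by rewrite N0 oner_neq0.
have [s [s0 sr Ns]] := nonzero_near r0 CN N00.
have kb x : cube s x -> k x 0 0 = - k x 1 1 /\ k x 0 1 * k x 1 0 + k x 1 1 * k x 1 1 = 0.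
  move=> /(cube_le sr) xr; apply: nilpotent_block => [|j]; [exact: k3|exact: k2].
have Cks : Csmooth (cube s) k by exact: Csmooth_sub (cube_le sr) Ck.
have Cs i j : Csmooth (cube s) (fun x => k x i j) by exact: Csmooth_entry.
have CVs : Csmooth (cube s) (fun x => (N x)^-1).
  by move=> m; apply: CkV => //; exact: Ck_sub (cube_le sr) (CN m).
have k2s x j : cube s x -> k x 2 j = 0 by move=> xs; apply: k2; exact: cube_le xs.
have nks x v w : cube s x -> nij k x v w = 0 by move=> xs; apply: nk; exact: cube_le xs.
(* The leaf components of dX2. In the row its third component is replaced by 0, which the zero last
   row of [k] hides. *)
pose al x := - k x 1 1 / N x; pose be x := k x 0 1 / N x.
have Cal : Csmooth (cube s) al.
  by apply: Csmooth_M => // m; apply: CkN => //; exact: Cs.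
have Cbe : Csmooth (cube s) be by exact: Csmooth_M.
have H2 y : cube s y -> row3 (al y) (be y) 0 *m k y = row3 0 0 1.
  move=> ys; have [kb1 kb2] := kb _ ys.
  have [E0 E1 E2] := second_covector (Ns _ ys) kb1 kb2.
  apply/rowP; apply: forall_ord3; rewrite mulmx3 k2s // mulr0 addr0;
    have [-> -> _] := row3E (al y) (be y) 0; have [A0 A1 A2] := row3E 0 0 1.
  - by rewrite A0; exact: E0.
  - by rewrite A1; exact: E1.
  - by rewrite A2; exact: E2.
have H2' y : cube s y -> row3 0 0 1 *m k y = 0.
  move=> ys; apply/rowP; apply: forall_ord3; rewrite mulmx3 k2s // !mxE /=; ring.
have dphi x := dform_cst (row3 0 0 1) x; have dchi x := dform_cst 0 x.
have cl2 x : cube s x -> 'D_(e 1) al x = 'D_(e 0) be x.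
  move=> xs; apply: (closed_pair Cks Cal Cbe H2 H2' (dphi x) (dchi x) xs _ _ (Ns _ xs)).
    by move=> v w; exact: nks.
  by move=> j; exact: k2s.
have c0 := cube0 s0.
have [X2 [CX2 X20 dX2]] := leaf_poincare Cal Cbe cl2 c0.
have D20 x : cube s x -> 'D_(e 0) X2 x = al x by move=> /dX2[[]].
have D21 x : cube s x -> 'D_(e 1) X2 x = be x by move=> /dX2[_ []].
have Cga : Csmooth (cube s) ('D_(e 2) X2) by exact: Csmooth_derive.
pose al1 x := (be x * k x 1 2 - 'D_(e 2) X2 x * k x 1 1) / N x.
pose be1 x := (k x 0 1 * 'D_(e 2) X2 x - k x 0 2 * be x) / N x.
have Cal1 : Csmooth (cube s) al1.
  by apply: Csmooth_M => //; apply: Csmooth_B => //; exact: Csmooth_M.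
have Cbe1 : Csmooth (cube s) be1.
  by apply: Csmooth_M => //; apply: Csmooth_B => //; exact: Csmooth_M.
have F1 y : cube s y -> [/\ al1 y * k y 0 0 + be1 y * k y 1 0 = al y,
    al1 y * k y 0 1 + be1 y * k y 1 1 = be y &
    al1 y * k y 0 2 + be1 y * k y 1 2 = 'D_(e 2) X2 y].
  move=> ys; have [kb1 kb2] := kb _ ys; exact: first_covector (Ns _ ys) kb1 kb2.
have H1 y : cube s y -> row3 (al1 y) (be1 y) 0 *m k y =
    grad X2 y.
  move=> ys; have [E0 E1 E2] := F1 _ ys.
  apply/rowP; apply: forall_ord3; rewrite mulmx3 k2s // mulr0 addr0;
    have [-> -> _] := row3E (al1 y) (be1 y) 0;
    have [A0 A1 A2] := row3E ('D_(e 0) X2 y) ('D_(e 1) X2 y) ('D_(e 2) X2 y).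
  - by rewrite A0 (D20 _ ys); exact: E0.
  - by rewrite A1 (D21 _ ys); exact: E1.
  - by rewrite A2; exact: E2.
(* The uncontrolled derivative of [X2] in the third variable multiplies the zero row of [k]. *)
have H1' y : cube s y -> grad X2 y *m k y =
    row3 0 0 1.
  move=> ys; rewrite -(H2 _ ys) D20 // D21 //.
  apply/rowP => j; rewrite !mulmx3 k2s // !mulr0 !addr0.
  have [-> -> _] := row3E (al y) (be y) 0.
  by have [-> -> _] := row3E (al y) (be y) ('D_(e 2) X2 y).
have cl1 x : cube s x -> 'D_(e 1) al1 x = 'D_(e 0) be1 x.
  move=> xs; apply: (closed_pair Cks Cal1 Cbe1 H1 H1' _ (dphi x) xs _ _ (Ns _ xs)).
  - by move=> a b; exact: dform_exact (oc s) CX2 xs.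
  - by move=> v w; exact: nks.
  - by move=> j; exact: k2s.
have [X1 [CX1 X10 dX1]] := leaf_poincare Cal1 Cbe1 cl1 c0.
have D10 x : cube s x -> 'D_(e 0) X1 x = al1 x by move=> /dX1[[]].
have D11 x : cube s x -> 'D_(e 1) X1 x = be1 x by move=> /dX1[_ []].
pose X x : V := (row3 (X1 x) (X2 x) (x 2 0))^T.
have [XE0 XE1 XE2] : [/\ (fun x => X x 0 0) = X1, (fun x => X x 1 0) = X2 &
    (fun x => X x 2 0) = (fun x => x 2 0)].
  by split; apply/funext => x; rewrite !mxE.
have CX : Csmooth (cube s) X.
  apply/(Csmooth_cV _ (oc s)); apply: forall_ord3; rewrite ?XE0 ?XE1 ?XE2 //.
  by move=> m; exact: Ck_coord.
have J0 x j : cube s x -> jac X x 0 j = 'D_(e j) X1 x.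
  by move=> xs; rewrite (jacE _ _ (CX 1%N) xs) XE0.
have J1 x j : cube s x -> jac X x 1 j = 'D_(e j) X2 x.
  by move=> xs; rewrite (jacE _ _ (CX 1%N) xs) XE1.
have J2 x j : cube s x -> jac X x 2 j = (2 == j)%:R.
  move=> xs; rewrite (jacE _ _ (CX 1%N) xs) XE2.
  by have [_ ->] := is_derive_coord 2 0 (is_derive_id x (e j)); rewrite basisE.
have JX x : cube s x -> jac X x *m k x = u *m jac X x.
  move=> xs; have [E0 E1 E2] := F1 _ xs.
  apply: intertwine_rows => j; [exact: k2s|exact: J2| |]; last first.
    rewrite (J1 _ 0 xs) (J1 _ 1 xs) (J2 _ j xs) (D20 _ xs) (D21 _ xs).
    have := congr1 (fun r : 'rV[R]_3 => r 0 j) (H2 _ xs).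
    rewrite mulmx3 (k2s _ _ xs) mulr0 addr0; have [-> -> _] := row3E (al x) (be x) 0.
    by move=> ->; move: j; apply: forall_ord3; rewrite mxE.
  rewrite (J0 _ 0 xs) (J0 _ 1 xs) (J1 _ j xs) (D10 _ xs) (D11 _ xs).
  move: j; apply: forall_ord3.
  - by rewrite (D20 _ xs).
  - by rewrite (D21 _ xs).
  - exact: E2.
(* At the origin the matrix is upper triangular with unit diagonal. *)
have uJ : jac X 0 \in unitmx.
  rewrite unitmxE det3 (J0 _ 0) // (J0 _ 1) // (J1 _ 0) // (J1 _ 1) //.
  rewrite (J2 _ 0) // (J2 _ 1) // (J2 _ 2) // D10 // D11 // D20 // D21 //.
  have al0 : al 0 = 0 by rewrite /al k0 !u_mxE /= add0r oppr0 mul0r.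
  have be0 : be 0 = 1 by rewrite /be N0 k0 !u_mxE /= addr0 divr1.
  have al10 : al1 0 = 1.
    by rewrite /al1 N0 be0 k0 !u_mxE /= !add0r !mulr0 subr0 mulr1 divr1.
  rewrite al0 be0 al10 /= !(mulr0, mul0r, mulr1, subr0, addr0); exact: unitr1.
have [D [g [Ds D0 dX]]] := inverse_function (oc s) CX c0 uJ.
exists D, X, g; split=> //.
- by move=> x /Ds; exact: cube_le.
- apply/colP; apply: forall_ord3; rewrite !mxE /= //.
by move=> x /Ds; exact: JX.
Qed.

Lemma intertwine_chain (H A K B L C M : 'M[R]_3) : H *m A = A *m K -> K *m B = B *m L ->
  L *m C = C *m M -> H *m (A *m B *m C) = A *m B *m C *m M.
Proof.
by move=> E1 E2 E3; rewrite !mulmxA E1 -(mulmxA A K B) E2 -!mulmxA E3.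
Qed.

(** An affine map gives [h] the value [u] at the origin, and [straighten] makes its leaves parallel
    planes. The map of [flatten] goes towards the final coordinates and therefore enters
    inverted. *)
Theorem nilpotent_normal_form U h (a : V) (F0 : 'M[R]_3) : open U -> Csmooth U h -> U a ->
  (forall x, U x -> h x *m h x *m h x = 0) ->
  (forall x v w, U x -> nij h x v w = 0) -> F0 \in unitmx -> h a *m F0 = F0 *m u ->
  exists D F g, [/\ diffeo D F g, D 0, F 0 = a, forall x, D x -> U (F x) &
    forall x, D x -> h (F x) *m jac F x = jac F x *m u].
Proof.
move=> oU Ch Ua h3 nh uF hF; have oc s := @cube_open R s.
pose F1 x := F0 *m x + a.
have F10 : F1 0 = a by rewrite /F1 mulmx0 add0r.
have C1 : {for 0, continuous F1}.
  have [_ _ _ C _] := affine_diffeo a 1 uF.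
  exact: Csmooth_continuous C (cube0 ltr01).
have [s s0 sU] : exists2 s : R, 0 < s & cube s `<=` F1 @^-1` U.
  by apply: near_cube; apply: C1; rewrite F10; apply: open_nbhs_nbhs.
have dF1 := affine_diffeo a s uF; rewrite -/F1 in dF1.
have J1 x : jac F1 x = F0 by exact: jac_affine.
have n1 := pullback_field oU Ch h3 nh s0 dF1 sU; rewrite F10 J1 in n1.
have {n1} := n1 hF; set k1 := (fun x => _) => n1.
have [t [F2 [g2 [k2 [dF2 F20 F2s n2 H2]]]]] := straighten n1.
have [D [X [gX [Dt D0 dX X0 HX]]]] := flatten n2 (fun x j xt => (H2 x xt).2 j).
have dF2D : diffeo D F2 g2 by apply: (diffeo_restrict dF2) => //; case: dX.
have d12 := diffeo_comp dF1 dF2D (fun x Dx => F2s _ (Dt _ Dx)).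
have gXD y : (X @` D) y -> D (gX y).
  by case: dX => _ _ XK _ _ [x Dx <-]; rewrite XK.
have dd := diffeo_comp d12 (diffeo_inv dX) gXD.
have gX0 : gX 0 = 0 by case: dX => _ _ XK _ _; rewrite -{1}X0 XK.
exists (X @` D), (fun y => F1 (F2 (gX y))), (fun z => X (g2 (invmx F0 *m (z - a)))).
split=> //; first by exists 0.
- by rewrite gX0 F20.
- by move=> y /gXD/Dt/F2s/sU.
move=> _ [x Dx <-]; have [oD oXD XK CX CgX] := dX; rewrite XK //.
have xt := Dt _ Dx; have xs := F2s _ xt.
have [_ _ _ CF1 _] := dF1; have [_ _ _ CF2 _] := dF2D; have [_ _ _ C12 _] := d12.
have XDx : (X @` D) (X x) by exists x.
have E1 : jac (fun y => F1 (F2 (gX y))) (X x) = F0 *m jac F2 x *m jac gX (X x).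
  have := jac_comp oD oXD (C12 1%N) (CgX 1%N) XDx; rewrite XK // => -> //.
  by rewrite (jac_comp (oc s) oD (CF1 1%N) (CF2 1%N)) ?J1.
have G1 : h (F1 (F2 x)) *m F0 = F0 *m k1 (F2 x).
  by rewrite /k1 J1; exact: conj_intertwine.
have [G2 _] := H2 _ xt; have G3 := HX _ Dx.
have uX : jac X x \in unitmx by exact: (diffeo_unit dX Dx).
have G4 : k2 x *m invmx (jac X x) = invmx (jac X x) *m u.
  by rewrite -[LHS](mulKmx uX) (mulmxA (jac X x)) G3 mulmxK.
rewrite E1 (diffeo_jac_inv dX Dx); exact: intertwine_chain G1 G2 G4.
Qed.

End Flattening.

(** * Coordinates with unit density *)

Section Unimodular.
Context {R : realType}.
Local Notation V := 'cV[R]_3.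
Local Notation e i := (Defs.basis R i).
Local Notation u := (u_mx R).
Implicit Types (A B D U : set V) (x y v w : V).

(* The component of the volume form [rho dx1 dx2 dx3] in the coordinates whose
   inverse is [F]. *)
Definition density (rho : V -> R) (F : V -> V) x : R := rho (F x) * \det (jac F x).

Lemma Csmooth_density U D rho F : open U -> open D -> Csmooth U rho -> Csmooth D F ->
  (forall x, D x -> U (F x)) -> Csmooth D (density rho F).
Proof.
move=> oU oD Cr CF DU; apply: Csmooth_M => //; first exact: (Csmooth_comp oU oD Cr CF DU).
by move=> k; exact: (Ck_det oD ((Ck_mxP _ _ oD).1 (Ck_jac oD (CF k.+1)))).
Qed.

Lemma density_mulmx rho (F : V -> V) x (J K : 'M[R]_3) : jac F x = J *m K ->
  density rho F x = rho (F x) * \det J * \det K.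
Proof. by rewrite /density => ->; rewrite det_mulmx mulrA. Qed.

Lemma commutant_u (K : 'M[R]_3) : K *m u = u *m K ->
  [/\ K 2 0 = 0, K 2 1 = 0 & \det K = K 2 2 ^+ 3].
Proof.
move=> E; have H i j : (K *m u) i j = (u *m K) i j by rewrite E.
have := H 0 0; have := H 1 0; have := H 0 1; have := H 1 1; have := H 1 2.
rewrite !mulmx3 !u_mxE /= !(mulr0, mulr1, mul0r, mul1r, addr0, add0r).
by move=> h12 h11 h01 h10 h00; rewrite det3 -h11 -h10 -h00 h01 h12; split=> //; ring.
Qed.

Lemma toeplitz_commute (K : 'M[R]_3) : K 1 0 = 0 -> K 2 0 = 0 -> K 2 1 = 0 ->
  K 1 1 = K 0 0 -> K 2 2 = K 0 0 -> K 1 2 = K 0 1 ->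
  K *m u = u *m K /\ \det K = K 0 0 ^+ 3.
Proof.
move=> k10 k20 k21 k11 k22 k12; split; last by rewrite det3 k10 k20 k21 k11 k22 k12; ring.
apply: matrix3P; apply: forall_ord3; rewrite !mulmx3 !u_mxE /=
  ?(k10, k20, k21, k11, k22, k12); split; ring.
Qed.

Lemma derive_cube_root A (w c : V -> R) x i : open A -> Ck 1 A c -> A x ->
  (forall y, A y -> c y * c y * c y = w y) -> c x != 0 -> 'D_(e i) w x = 0 ->
  'D_(e i) c x = 0.
Proof.
move=> oA Cc Ax cw c0 w0; have D := Ck_is_derive i Cc Ax.
have := is_deriveM (is_deriveM D D) D.
move=> [_]; rewrite (near_eq_derive _ (Ck_near oA Ax cw)) w0 /GRing.scale /=.
have -> : (c * c) x = c x * c x by [].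
move: ('D_(e i) c x) (c x) c0 => d a a0 /esym E.
have : (3 * (a * a)) * d = 0 by rewrite -E; ring.
by move=> /eqP; rewrite !mulf_eq0 (negbTE a0) pnatr_eq0 => /eqP.
Qed.

(** Near 0 the function keeps the sign [sg] of [w 0]; since the cube of [sg] is [sg], a third of the
    logarithm of [sg * w] yields a smooth root for either sign. *)
Lemma cube_root r (w : V -> R) : 0 < r -> Csmooth (cube r) w -> w 0 != 0 ->
  exists s (c : V -> R), [/\ 0 < s, s <= r, Csmooth (cube s) c &
    forall x, cube s x -> c x * c x * c x = w x /\ c x != 0].
Proof.
move=> r0 Cw w0; have oc s := @cube_open R s.
pose sg := Num.sg (w 0); have sg2 : sg * sg = 1.
  by have := sqr_sg (w 0); rewrite w0 expr2.
have f00 : 0 < `|w 0| by rewrite normr_gt0.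
have := Csmooth_continuous Cw (cube0 r0); rewrite /prop_for /continuous_at.
move=> /cvgrPdist_lt /(_ _ f00) /near_cube[s1 s10 H].
pose s := Num.min s1 r; have s0 : 0 < s by rewrite lt_min s10.
have sr : s <= r by rewrite ge_min lexx orbT.
have ss1 : s <= s1 by rewrite ge_min lexx.
have pos x : cube s x -> 0 < sg * w x.
  move=> /(cube_le ss1)/H /=; rewrite /sg; move: (w 0) (w x) w0 => p q p0.
  have [p1|p1|p1] := ltgtP p 0; last by rewrite p1 eqxx in p0.
    by rewrite (ltr0_sg p1) (ltr0_norm p1) ltr_norml => /andP[? ?]; lra.
  by rewrite (gtr0_sg p1) (gtr0_norm p1) ltr_norml => /andP[? ?]; lra.
exists s, (fun x => sg * expR (3^-1 * ln (sg * w x))); split=> //.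
  have Cw' k : Ck k (cube s) w by exact: Ck_sub (cube_le sr) (Cw k).
  move=> k; apply: CkZ => //; apply: Ck_exp => //; apply: CkZ => //.
  by apply: Ck_ln => //; exact: CkZ.
move=> x xs; split; last first.
  apply: mulf_neq0; last by rewrite gt_eqF ?expR_gt0.
  by apply: contraNneq (oner_neq0 R) => s00; rewrite -sg2 s00 mul0r.
have := pos _ xs; move: (w x) => p p0.
transitivity (sg * sg * sg * (expR (3^-1 * ln (sg * p)) * expR (3^-1 * ln (sg * p)) *
  expR (3^-1 * ln (sg * p)))); first by move: (expR _) => t; ring.
rewrite -!expRD sg2 mul1r.
have -> : 3^-1 * ln (sg * p) + 3^-1 * ln (sg * p) + 3^-1 * ln (sg * p) = ln (sg * p).
  by move: (ln _) => t; field.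
by rewrite lnK ?posrE // mulrA sg2 mul1r.
Qed.

(* With [c2] and [ph] the derivative and the primitive of [c] along the third
   axis, the Jacobian matrix is Toeplitz upper triangular with diagonal [c]. *)
Definition shear (c c2 ph : V -> R) x : V :=
  (row3 (c x * x 0 0 + c2 x * (x 1 0 * x 1 0) / 2) (c x * x 1 0) (ph x))^T.

Lemma shear_jac s (c : V -> R) : Csmooth (cube s) c ->
  (forall x, cube s x -> 'D_(e 0) c x = 0) -> (forall x, cube s x -> 'D_(e 1) c x = 0) ->
  let Y := shear c ('D_(e 2) c) (prim s 2 c) in
  Csmooth (cube s) Y /\ forall x, cube s x ->
    jac Y x *m u = u *m jac Y x /\ \det (jac Y x) = c x * c x * c x.
Proof.
move=> Cc c0 c1 /=; have oc := @cube_open R s; set Y := shear _ _ _.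
pose c2 := 'D_(e 2) c; pose ph := prim s 2 c; rewrite -/c2 -/ph in Y *.
have Cc2 : Csmooth (cube s) c2 by exact: Csmooth_derive.
have Cx i : Csmooth (cube s) (fun x : V => x i 0) by move=> k; exact: Ck_coord.
have [Y0 Y1 Y2] : [/\ (fun x => Y x 0 0) = (fun x => c x * x 0 0 + c2 x * (x 1 0 * x 1 0) / 2),
    (fun x => Y x 1 0) = (fun x => c x * x 1 0) & (fun x => Y x 2 0) = ph].
  by split; apply/funext => x; rewrite !mxE.
have CY : Csmooth (cube s) Y.
  apply/(Csmooth_cV _ oc); apply: forall_ord3; rewrite ?Y0 ?Y1 ?Y2.
  - move=> k; apply: CkD => //; first by apply: CkM => //; exact: Cx.
    apply: CkM => //; last exact: Ck_cst.
    by apply: CkM => //; apply: CkM => //; exact: Cx.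
  - by apply: Csmooth_M.
  - exact: prim_Csmooth.
split=> // x xs.
have dc i := Ck_is_derive i (Cc 1%N) xs; have dc2 i := Ck_is_derive i (Cc2 1%N) xs.
have dx (i j : 'I_3) : is_derive x (e j) (fun y : V => y i 0) ((i == j)%:R).
  by apply: is_derive_eq (is_derive_coord i 0 (is_derive_id x (e j))) _; rewrite basisE.
have z2 j : (forall y, cube s y -> 'D_(e j) c y = 0) -> 'D_(e j) c2 x = 0.
  move=> H; rewrite /c2 (Schwarz j 2 oc (Cc 2%N) xs).
  rewrite (near_eq_derive _ (Ck_near oc xs H)).
  by have [_ ->] := is_derive_cst (0 : R) x (e 2).
have cc w : cube s w -> {for w, continuous c} by move=> ws; exact: Csmooth_continuous Cc ws.
have phd j : j != 2 -> (forall y, cube s y -> 'D_(e j) c y = 0) -> 'D_(e j) ph x = 0.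
  move=> j2 H.
  have [_ ->] : is_derive x (e j) ph (prim s 2 (fun=> 0) x).
    apply: is_derive_prim_other => //; first by move=> w _; exact: cst_continuous.
    by move=> w ws; rewrite -(H _ ws); exact: (Ck_is_derive j (Cc 1%N) ws).
  exact: prim_zero.
have ph2 : 'D_(e 2) ph x = c x by have [_ ->] := is_derive_prim 2 cc xs.
have J0 j : jac Y x 0 j = 'D_(e j) c x * x 0 0 + c x * (0 == j)%:R +
    ('D_(e j) c2 x * (x 1 0 * x 1 0) / 2 + c2 x * x 1 0 * (1 == j)%:R).
  rewrite (jacE _ _ (CY 1%N) xs) Y0.
  have [_ ->] := is_deriveD (is_deriveM (dc j) (dx 0 j))
    (is_deriveM (is_deriveM (dc2 j) (is_deriveM (dx 1 j) (dx 1 j)))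
      (is_derive_cst (2^-1 : R) x (e j))).
  transitivity (c x * (0 == j)%:R + x 0 0 * 'D_(e j) c x + (c2 x * (x 1 0 * x 1 0) * 0 +
    2^-1 * (c2 x * (x 1 0 * (1 == j)%:R + x 1 0 * (1 == j)%:R) +
      x 1 0 * x 1 0 * 'D_(e j) c2 x))); first by [].
  move: ('D_(e j) c x) ('D_(e j) c2 x) (c x) (c2 x) => *; by field.
have J1 j : jac Y x 1 j = 'D_(e j) c x * x 1 0 + c x * (1 == j)%:R.
  rewrite (jacE _ _ (CY 1%N) xs) Y1.
  have [_ ->] := is_deriveM (dc j) (dx 1 j).
  rewrite /GRing.scale /=; move: ('D_(e j) c x) (c x) => *; ring.
have J2 j : jac Y x 2 j = 'D_(e j) ph x by rewrite (jacE _ _ (CY 1%N) xs) Y2.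
have [] := @toeplitz_commute (jac Y x).
- by rewrite J1 c0 //= mulr0 mul0r addr0.
- by rewrite J2 phd.
- by rewrite J2 phd.
- by rewrite J1 J0 c0 // c1 // z2 //= !(mulr0, mul0r, mulr1, addr0, add0r).
- by rewrite J2 ph2 J0 c0 // z2 //= !(mulr0, mul0r, mulr1, addr0, add0r).
(* Both entries are [c2 x * x 1 0]; the quadratic term of [shear] serves to make them equal. *)
- by rewrite J1 J0 c1 // z2 //= !(mulr0, mul0r, mulr1, addr0, add0r).
move=> -> ->; split=> //; rewrite J0 c0 // z2 //= !(mulr0, mul0r, mulr1, addr0, add0r).
by rewrite !exprS expr0 mulr1 mulrA.
Qed.

(** The new coordinates are the shear of the old ones translated to [a]. Their density is the old
    one divided by the Jacobian determinant of the shear, which is that same density. *)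
Theorem unimodular_exists U D (H : V -> 'M[R]_3) (rho : V -> R) (F g : V -> V) a :
  open U -> Csmooth U rho -> (forall x, U x -> rho x != 0) -> diffeo D F g ->
  (forall x, D x -> U (F x)) -> (forall x, D x -> H (F x) *m jac F x = jac F x *m u) ->
  (forall x, D x -> 'D_(e 0) (density rho F) x = 0 /\ 'D_(e 1) (density rho F) x = 0) ->
  D a -> exists D' F' g', [/\ diffeo D' F' g', D' 0, F' 0 = F a,
    forall x, D' x -> U (F' x) & forall x, D' x ->
      H (F' x) *m jac F' x = jac F' x *m u /\ density rho F' x = 1].
Proof.
move=> oU Cr r0 dF DU HF dw Da; have oc s := @cube_open R s.
have [oD _ _ CF _] := dF.
have u1 : (1%:M : 'M[R]_3) \in unitmx by exact: unitmx1.
(* A translation, because cubes are centred at 0; it is written as an affine map to reuse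
   [affine_diffeo]. *)
pose T x : V := 1%:M *m x + a; set w := density rho F in dw *.
have T0 : T 0 = a by rewrite /T mulmx0 add0r.
have C1 : {for 0, continuous T}.
  have [_ _ _ C _] := affine_diffeo a 1 u1.
  exact: Csmooth_continuous C (cube0 ltr01).
have [r rp rD] : exists2 s : R, 0 < s & cube s `<=` T @^-1` D.
  by apply: near_cube; apply: C1; rewrite T0; apply: open_nbhs_nbhs.
have dT := affine_diffeo a r u1; rewrite -/T in dT.
have [_ _ _ CT _] := dT.
have JT x : jac T x = 1%:M by exact: jac_affine.
have dFT := diffeo_comp dF dT rD; pose F1 x := F (T x).
have [_ _ _ CF1 _] := dFT.
have JF1 x : cube r x -> jac F1 x = jac F (T x).
  by move=> xr; rewrite (jac_comp oD (oc r) (CF 1%N) (CT 1%N) xr (rD _ xr)) JT mulmx1.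
have Cw : Csmooth D w by exact: Csmooth_density oU oD Cr CF DU.
pose w1 x := w (T x).
have Cw1 : Csmooth (cube r) w1 by exact: (Csmooth_comp oD (oc r) Cw CT rD).
have dw1 i x : cube r x -> 'D_(e i) w1 x = 'D_(e i) w (T x).
  move=> xr; have dTx : is_derive x (e i) T (e i).
    apply: is_derive_eq (is_derive_jac (e i) (oc r) (CT 1%N) xr) _.
    by rewrite JT mul1mx.
  have [_ E1] := is_derive_comp oD (Cw 1%N) (rD _ xr) dTx.
  have [_ E2] := is_derive_dir (e i) oD (Cw 1%N) (rD _ xr).
  exact: etrans E1 (esym E2).
have w10 : w1 0 != 0.
  rewrite /w1 T0 /w /density mulf_neq0 //; first by apply: r0; exact: DU.
  by have := diffeo_unit dF Da; rewrite unitmxE unitfE.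
have [s [c [s0 sr Cc Hc]]] := cube_root rp Cw1 w10.
have c3 x : cube s x -> c x * c x * c x = w1 x by move=> /Hc[].
have cn0 x : cube s x -> c x != 0 by move=> /Hc[].
have dc i x : cube s x -> 'D_(e i) w (T x) = 0 -> 'D_(e i) c x = 0.
  move=> xs wT; apply: (derive_cube_root (oc s) (Cc 1%N) xs c3 (cn0 _ xs)).
  by rewrite dw1 //; exact: cube_le xs.
have sD x : cube s x -> D (T x) by move=> /(cube_le sr)/rD.
have [] := @shear_jac s c Cc.
- by move=> x xs; exact: (dc 0 x xs (dw _ (sD _ xs)).1).
- by move=> x xs; exact: (dc 1 x xs (dw _ (sD _ xs)).2).
set Y := shear _ _ _ => CY HY.
have detY x : cube s x -> \det (jac Y x) = w1 x by move=> xs; rewrite (HY _ xs).2 c3.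
have uY : jac Y 0 \in unitmx.
  by rewrite unitmxE unitfE detY //; exact: cube0.
have [D1 [gY [D1s D10 dY]]] := inverse_function (oc s) CY (cube0 s0) uY.
have Y0 : Y 0 = 0.
  have ph0 : prim s 2 c 0 = 0.
    apply: prim0; [move=> v vs; exact: Csmooth_continuous Cc vs|exact: cube0|by rewrite mxE].
  apply/colP; apply: forall_ord3; rewrite !mxE /= ?ph0 //; first by rewrite !mulr0 mul0r addr0.
  by rewrite mulr0.
have [oD1 oYD YK CY1 CgY] := dY.
have D1r x : D1 x -> cube r x by move=> /D1s; exact: cube_le.
have gYD y : (Y @` D1) y -> cube r (gY y) by move=> [x Dx <-]; rewrite YK //; exact: D1r.
have dd := diffeo_comp dFT (diffeo_inv dY) gYD.
have gY0 : gY 0 = 0 by rewrite -{1}Y0 YK.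
exists (Y @` D1), (fun y => F1 (gY y)), (fun y => Y (invmx 1%:M *m (g y - a))).
split=> //; first by exists 0.
- by rewrite gY0 /F1 T0.
- by move=> y /gYD/rD/DU.
move=> _ [x Dx <-]; have xs := D1s _ Dx; have xr := D1r _ Dx.
have YDx : (Y @` D1) (Y x) by exists x.
have xD := rD _ xr.
have jY := diffeo_jac_inv dY Dx; have uYx := diffeo_unit dY Dx.
have gYr : cube r (gY (Y x)) by exact: gYD.
have E : jac (fun y => F1 (gY y)) (Y x) = jac F (T x) *m invmx (jac Y x).
  by rewrite (jac_comp (oc r) oYD (CF1 1%N) (CgY 1%N) YDx gYr) YK // JF1 // jY.
split.
  rewrite E YK // /F1 mulmxA HF // -!mulmxA; congr (_ *m _).
  by rewrite -[LHS](mulKmx uYx) (mulmxA (jac Y x)) (HY _ xs).1 mulmxK.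
rewrite (density_mulmx rho E) det_inv (detY _ xs).
have -> : F1 (gY (Y x)) = F1 x by rewrite YK.
have W : w1 x != 0.
  by rewrite -(c3 _ xs); have := cn0 _ xs; move: (c x) => t t0; rewrite !mulf_neq0.
exact: (mulfV W).
Qed.

Lemma transition_commute (H J J' K M : 'M[R]_3) : J' \in unitmx -> H *m J = J *m M ->
  H *m J' = J' *m M -> J = J' *m K -> K *m M = M *m K.
Proof.
move=> uJ HJ HJ' JK; rewrite -[LHS](mulKmx uJ) -[RHS](mulKmx uJ); congr (_ *m _).
by rewrite !mulmxA -JK -HJ JK -HJ' mulmxA.
Qed.

(** As the density for [F'] is 1, the density for [F] on the overlap is the Jacobian determinant of
    the transition map [T], the cube of [k]. The first two derivatives of the last component of [T]
    vanish on the whole overlap, hence by [Schwarz] those of [k] vanish as well. *)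
Theorem unimodular_derive U D D' (H : V -> 'M[R]_3) (rho : V -> R) (F g F' g' : V -> V) a :
  open U -> Csmooth U rho -> diffeo D F g -> diffeo D' F' g' ->
  (forall x, D x -> U (F x)) -> (forall x, D' x -> U (F' x)) ->
  (forall x, D x -> H (F x) *m jac F x = jac F x *m u) ->
  (forall x, D' x -> H (F' x) *m jac F' x = jac F' x *m u) ->
  (forall x, D' x -> density rho F' x = 1) -> D a -> (F' @` D') (F a) ->
  'D_(e 0) (density rho F) a = 0 /\ 'D_(e 1) (density rho F) a = 0.
Proof.
move=> oU Cr dF dF' DU DU' HF HF' w1 Da Fa.
have [oD _ _ CF _] := dF; have [oD' oI' K' CF' Cg'] := dF'.
(* The overlap of the two coordinate domains, seen in the coordinates of [F]. *)
pose E := [set x | D x /\ (F' @` D') (F x)].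
have oE : open E by exact: (open_preimage oD oI' (fun x => Csmooth_continuous CF)).
have ED x : E x -> D x by case.
have EF x : E x -> (F' @` D') (F x) by case.
pose T x := g' (F x).
have CT : Csmooth E T.
  exact: (Csmooth_comp_mx oI' oE Cg' (Csmooth_sub ED CF) EF).
have TD x : E x -> D' (T x) by move=> /EF[y Dy yE]; rewrite /T -yE K'.
have FT x : E x -> F' (T x) = F x by move=> /EF[y Dy yE]; rewrite /T -yE K'.
have JT x : E x -> jac F x = jac F' (T x) *m jac T x.
  move=> Ex; rewrite -(jac_comp oD' oE (CF' 1%N) (CT 1%N) Ex (TD _ Ex)).
  by apply: (jac_near oE Ex) => y Ey; rewrite FT.
have KT x : E x -> jac T x *m u = u *m jac T x.
  move=> Ex; have uJ := diffeo_unit dF' (TD _ Ex).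
  have HF2 : H (F x) *m jac F' (T x) = jac F' (T x) *m u.
    by rewrite -(FT _ Ex); exact: HF' (TD _ Ex).
  exact: transition_commute uJ (HF _ (ED _ Ex)) HF2 (JT _ Ex).
have T20 i x : (i == 0) || (i == 1) -> E x -> 'D_(e i) (fun y => T y 2 0) x = 0.
  move=> i01 Ex; rewrite -(jacE _ _ (CT 1%N) Ex); have [k0 k1 _] := commutant_u (KT _ Ex).
  by case/orP: i01 => /eqP ->.
pose k x := 'D_(e 2) (fun y => T y 2 0) x.
have wE x : E x -> density rho F x = k x * k x * k x.
  move=> Ex; have -> : density rho F x = \det (jac T x).
    rewrite (density_mulmx rho (JT _ Ex)); have := w1 _ (TD _ Ex).
    by rewrite /density (FT _ Ex) => ->; rewrite mul1r.
  have [_ _ ->] := commutant_u (KT _ Ex).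
  by rewrite (jacE _ _ (CT 1%N) Ex) -/(k x) !exprS expr0 mulr1 mulrA.
have Ea : E a by [].
have CT2 : Csmooth E (fun y => T y 2 0) by exact: (Csmooth_cV _ oE).1.
have Ck : Csmooth E k by exact: Csmooth_derive.
have dk i : (i == 0) || (i == 1) -> 'D_(e i) k a = 0.
  move=> i01; rewrite /k (Schwarz i 2 oE (CT2 2%N) Ea).
  rewrite (near_eq_derive _ (Ck_near oE Ea (T20 i ^~ i01))).
  by have [_ ->] := is_derive_cst (0 : R) a (e 2).
have dw i : (i == 0) || (i == 1) -> 'D_(e i) (density rho F) a = 0.
  move=> i01; rewrite (near_eq_derive _ (Ck_near oE Ea wE)).
  have D1 := Ck_is_derive i (Ck 1%N) Ea.
  have [_ ->] := is_deriveM (is_deriveM D1 D1) D1.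
  by rewrite dk // !scaler0 addr0 scaler0 addr0.
by split; apply: dw.
Qed.

End Unimodular.

(** * Bodies *)

Section Charts.
Context {R : realType}.
Local Notation V := 'cV[R]_3.
Local Notation e i := (Defs.basis R i).
Local Notation u := (u_mx R).
Implicit Types (B : body R).

Lemma Csmooth_ext (W : normedModType R) (A : set V) (f g : V -> W) : open A ->
  (forall x, A x -> f x = g x) -> Csmooth A f -> Csmooth A g.
Proof. by move=> oA fg Cf k; exact: Ck_ext (Cf k). Qed.

Lemma chart_range_open (B : body R) : open (gchart B @` setT).
Proof. by apply/gchart_open; exact: openT. Qed.

Lemma smooth_on_cst B (W : normedModType R) (A : set B) (c : W) : open A ->
  smooth_on A (fun=> c).
Proof.
move=> oA; have oI : open (gchart B @` A) by apply/gchart_open.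
apply: Csmooth_ext oI _ (Csmooth_cst c oI) => _ [p _ <-].
by rewrite (in_chartE (fun=> c)).
Qed.

Lemma dirder_tensor_app B (h : tensor11 B) (X : B -> tangent R) (v : V) p :
  smooth_on setT h -> smooth_on setT X ->
  dirder v (tensor_app h X) p =
  'D_v (in_chart h) (gchart B p) *m X p + h p *m dirder v X p.
Proof.
move=> Ch CX; have oU : open (gchart B @` setT) by exact: chart_range_open.
have Up : (gchart B @` setT) (gchart B p) by exists p.
have E : forall y, (gchart B @` setT) y ->
    in_chart (tensor_app h X) y = in_chart h y *m in_chart X y.
  by move=> _ [q _ <-]; rewrite !in_chartE.
rewrite /dirder (near_eq_derive _ (Ck_near oU Up E)).
have [_ ->] := is_derive_mulmx (derive_dirP v oU (Ch 1%N) Up) (derive_dirP v oU (CX 1%N) Up).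
by rewrite !in_chartE.
Qed.

(** [a], [b], [c], [d] stand for the derivatives of [Y] along [hX], of [X] along [hY], of [X] along
    [Y] and of [Y] along [X]; that they cancel is the tensoriality of the Nijenhuis tensor. *)
Lemma nijenhuis_algebra (H : 'M[R]_3) (dH : V -> 'M[R]_3) (X Y a b c d : V) :
  (dH (H *m X) *m Y + H *m a - (dH (H *m Y) *m X + H *m b)
   - H *m (a - (dH Y *m X + H *m c)) - H *m (dH X *m Y + H *m d - b)
   + H *m (H *m (d - c))) = nij_form H dH X Y.
Proof.
rewrite /nij_form !(mulmxBr, mulmxDr, mulmxN).
move: (dH (H *m X) *m Y) (H *m a) (dH (H *m Y) *m X) (H *m b) (H *m (dH Y *m X))
  (H *m (H *m c)) (H *m (dH X *m Y)) (H *m (H *m d)) => *.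
by apply/colP => i; rewrite !mxE; ring.
Qed.

Lemma nijenhuisE B (h : tensor11 B) (X Y : B -> tangent R) p :
  smooth_on setT h -> smooth_on setT X -> smooth_on setT Y ->
  nijenhuis h X Y p = 2 *: nij (in_chart h) (gchart B p) (X p) (Y p).
Proof.
move=> Ch CX CY; rewrite /nijenhuis /bracket !(dirder_tensor_app _ _ Ch) //.
rewrite /nij in_chartE; congr (_ *: _).
exact: (nijenhuis_algebra _ (fun a => 'D_a (in_chart h) (gchart B p))).
Qed.

(** By tensoriality, fields with constant components realise every pair of vectors at every
    point. *)
Lemma nijenhuis_vanishesP B (h : tensor11 B) : smooth_on setT h ->
  nijenhuis_vanishes h <->
  forall x v w, (gchart B @` setT) x -> nij (in_chart h) x v w = 0.
Proof.
move=> Ch; split=> [N _ v w [p _ <-]|N X Y CX CY p]; last first.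
  by rewrite nijenhuisE // N ?scaler0 //; exists p.
have C (c : V) : smooth_on [set: B] (fun=> c : tangent R).
  by apply: smooth_on_cst; exact: openT.
have := N _ _ (C v) (C w) p; rewrite (nijenhuisE p Ch (C v) (C w)) => /eqP.
by rewrite scaler_eq0 pnatr_eq0 => /eqP.
Qed.

(** The inverse of the coordinates, read in the global chart; it turns statements on [B] into
    statements on diffeomorphisms of open subsets of R^3. *)
Definition param B (c : local_coordinates B) : V -> V := gchart B \o prm c.

Definition coord_range B (c : local_coordinates B) : set V := crd c @` dom c.

Lemma param_crd B (c : local_coordinates B) p : dom c p ->
  param c (crd c p) = gchart B p.
Proof. by move=> dp; rewrite /param /= crdK. Qed.

Lemma param_image B (c : local_coordinates B) :
  param c @` coord_range c = gchart B @` dom c.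
Proof.
apply/seteqP; split=> [_ [_ [p dp <-] <-]|_ [p dp <-]].
  by exists p => //; rewrite param_crd.
by exists (crd c p); [exists p|rewrite param_crd].
Qed.

Lemma param_diffeo B (c : local_coordinates B) :
  diffeo (coord_range c) (param c) (in_chart (crd c)).
Proof.
split.
- exact: crd_open.
- by rewrite param_image; apply/gchart_open; exact: dom_open.
- by move=> _ [p dp <-]; rewrite param_crd // in_chartE.
- exact: prm_smooth.
- by rewrite param_image; exact: crd_smooth.
Qed.

Lemma coord_frameE B (c : local_coordinates B) p :
  coord_frame c p = jac (param c) (crd c p).
Proof. by apply/matrixP => i j; rewrite !mxE. Qed.

Lemma param_range B (c : local_coordinates B) x : coord_range c x ->
  (gchart B @` setT) (param c x).
Proof. by move=> [p dp <-]; exists p => //; rewrite param_crd. Qed.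

Lemma adapted_intertwine B (c : local_coordinates B) (h : tensor11 B) :
  adapted c (Pbar h) -> forall x, coord_range c x ->
  in_chart h (param c x) *m jac (param c) x = jac (param c) x *m u.
Proof.
move=> ad _ [p dp <-]; have /PbarE[_] := ad _ dp.
by rewrite coord_frameE param_crd // in_chartE.
Qed.

Lemma coords_of_diffeo B (p0 : B) (D : set V) F g : diffeo D F g ->
  (forall x, D x -> (gchart B @` setT) (F x)) ->
  exists c : local_coordinates B,
    (forall x q, D x -> gchart B q = F x -> dom c q) /\
    forall q, dom c q -> exists x, [/\ D x, gchart B q = F x & coord_frame c q = jac F x].
Proof.
move=> dF DU; have [oD oI gK CF Cg] := dF.
(* [p0] is only the default value outside the range of the chart. *)
pose inv y := xget p0 (gchart B @^-1` [set y]).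
have invK q : inv (gchart B q) = q.
  by apply: xget_unique => // q' /gchart_inj.
have Kinv x : D x -> gchart B (inv (F x)) = F x.
  by move=> /DU[q _ <-]; rewrite invK.
pose dm := gchart B @^-1` (F @` D); pose cr q := g (gchart B q); pose pr x := inv (F x).
have Idm : gchart B @` dm = F @` D.
  apply/seteqP; split=> [_ [q [x Dx xq] <-]|_ [x Dx <-]]; first by exists x.
  by exists (inv (F x)); rewrite /dm /= Kinv //; exists x.
have Icr : cr @` dm = D.
  apply/seteqP; split=> [_ [q [x Dx xq] <-]|x Dx]; first by rewrite /cr -xq gK.
  by exists (inv (F x)); rewrite /cr /dm /= Kinv ?gK //; exists x.
have odm : open dm by apply/gchart_open; rewrite Idm.
have ocr : open (cr @` dm) by rewrite Icr.
have crK q : dm q -> pr (cr q) = q.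
  by move=> [x Dx xq]; rewrite /pr /cr -xq gK // xq invK.
have Scr : smooth_on dm cr.
  rewrite /smooth_on Idm; apply: Csmooth_ext oI _ Cg => _ [x Dx <-].
  by rewrite -[in RHS](Kinv _ Dx) in_chartE /cr Kinv.
have Spr : Csmooth (cr @` dm) (gchart B \o pr).
  by rewrite Icr; apply: Csmooth_ext oD _ CF => x Dx; rewrite /pr /= Kinv.
exists (LocalCoordinates odm ocr crK Scr Spr); split=> [x q Dx xq|q [x Dx xq]].
  by exists x.
exists x; split; [exact: Dx|exact: esym xq|rewrite coord_frameE /= /cr -xq (gK _ Dx)].
by apply: (jac_near oD Dx) => y Dy; rewrite /param /= /pr Kinv.
Qed.

End Charts.

(** * Volume forms, their densities and their Lie derivatives *)

Section Volume.
Context {R : realType}.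
Local Notation V := 'cV[R]_3.
Local Notation e i := (Defs.basis R i).
Local Notation u := (u_mx R).
Implicit Types (B : body R).

Definition cols (a b c : V) : 'M[R]_3 :=
  \matrix_(i, j) (if j == 0 then a i 0 else if j == 1 then b i 0 else c i 0).

Lemma colsE a b c : [/\ col 0 (cols a b c) = a, col 1 (cols a b c) = b &
  col 2 (cols a b c) = c].
Proof. by split; apply/colP => i; rewrite !mxE. Qed.

Lemma cols_col (M : 'M[R]_3) : cols (col 0 M) (col 1 M) (col 2 M) = M.
Proof. by apply/matrixP => i j; rewrite !mxE; move: j; apply: forall_ord3. Qed.

(* The derivative of the determinant at [M] in the direction [N]. *)
Definition ddet (M N : 'M[R]_3) : R :=
  N 0 0 * (M 1 1 * M 2 2 - M 1 2 * M 2 1)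
  + M 0 0 * (N 1 1 * M 2 2 + M 1 1 * N 2 2
             - (N 1 2 * M 2 1 + M 1 2 * N 2 1))
  - (N 0 1 * (M 1 0 * M 2 2 - M 1 2 * M 2 0)
     + M 0 1 * (N 1 0 * M 2 2 + M 1 0 * N 2 2
                - (N 1 2 * M 2 0 + M 1 2 * N 2 0)))
  + (N 0 2 * (M 1 0 * M 2 1 - M 1 1 * M 2 0)
     + M 0 2 * (N 1 0 * M 2 1 + M 1 0 * N 2 1
                   - (N 1 1 * M 2 0 + M 1 1 * N 2 0))).

Lemma is_derive_det (W : normedModType R) (M : W -> 'M[R]_3) (N : 'M[R]_3) (x v : W) :
  is_derive x v M N -> is_derive x v (fun y => \det (M y)) (ddet (M x) N).
Proof.
move=> dM; have d i j := is_derive_coord i j dM.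
have -> : (fun y => \det (M y)) = (fun y =>
    M y 0 0 * (M y 1 1 * M y 2 2 - M y 1 2 * M y 2 1)
    - M y 0 1 * (M y 1 0 * M y 2 2 - M y 1 2 * M y 2 0)
    + M y 0 2 * (M y 1 0 * M y 2 1 - M y 1 1 * M y 2 0)).
  by apply/funext => y; exact: det3.
have m a b a' b' i j i' j' : is_derive x v (fun y => M y a b * M y a' b' - M y i j * M y i' j')
    (N a b * M x a' b' + M x a b * N a' b' - (N i j * M x i' j' + M x i j * N i' j')).
  apply: is_derive_eq (is_deriveB (is_deriveM (d a b) (d a' b')) (is_deriveM (d i j) (d i' j'))) _.
  rewrite /GRing.scale /=; ring.
apply: is_derive_eq (is_deriveD (is_deriveB (is_deriveM (d 0 0) (m 1 1 2 2 1 2 2 1))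
   (is_deriveM (d 0 1) (m 1 0 2 2 1 2 2 0)))
   (is_deriveM (d 0 2) (m 1 0 2 1 1 1 2 0))) _.
rewrite /GRing.scale /= /ddet.
move: (M x) => P; clear; ring.
Qed.

(** [A] is the Jacobian matrix of the field [X], so that [da - A *m a] is the bracket of [X] with
    the first argument. The terms in [da], [db], [dc] cancel by multilinearity, and replacing one
    column at a time by its image under [A] adds up to the trace times the determinant. *)
Lemma lie_algebra (A : 'M[R]_3) (a b c da db dc : V) (r dr : R) :
  dr * \det (cols a b c) + r * ddet (cols a b c) (cols da db dc)
  - r * \det (cols (da - A *m a) b c) - r * \det (cols a (db - A *m b) c)
  - r * \det (cols a b (dc - A *m c)) = (dr + r * \tr A) * \det (cols a b c).
Proof.
have c0 (p q s : V) i : cols p q s i 0 = p i 0 by rewrite mxE.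
have c1 (p q s : V) i : cols p q s i 1 = q i 0 by rewrite mxE.
have c2 (p q s : V) i : cols p q s i 2 = s i 0 by rewrite mxE.
have sE (p q : V) i : (p - A *m q) i 0 =
    p i 0 - (A i 0 * q 0 0 + A i 1 * q 1 0 + A i 2 * q 2 0).
  by rewrite -mulmx3 2!mxE.
rewrite !det3 /ddet /mxtrace sum3 !c0 !c1 !c2 !sE.
move: (A 0 0) (A 0 1) (A 0 2) (A 1 0) (A 1 1) (A 1 2) => a00 a01 a02 a10 a11 a12.
move: (A 2 0) (A 2 1) (A 2 2) => a20 a21 a22.
move: (a 0 0) (a 1 0) (a 2 0) (b 0 0) (b 1 0) (b 2 0) (c 0 0) (c 1 0) (c 2 0).
move: (da 0 0) (da 1 0) (da 2 0) (db 0 0) (db 1 0) (db 2 0).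
move: (dc 0 0) (dc 1 0) (dc 2 0) => *; ring.
Qed.

Lemma is_derive_cols (W : normedModType R) (a b c : W -> V) (x v : W) (da db dc : V) :
  is_derive x v a da -> is_derive x v b db -> is_derive x v c dc ->
  is_derive x v (fun y => cols (a y) (b y) (c y)) (cols da db dc).
Proof.
move=> ha hb hc; apply: is_derive_mx => i j; rewrite mxE.
have -> : (fun y => cols (a y) (b y) (c y) i j) =
    (fun y => if j == 0 then a y i 0 else if j == 1 then b y i 0 else c y i 0).
  by apply/funext => y; rewrite mxE.
move: j; apply: forall_ord3 => /=; exact: is_derive_coord.
Qed.

Section Form.
Context (B : body R) (Omega : form3 B) (Omega_vol : volume_form Omega).

Definition volume_density : V -> R :=
  in_chart (fun p => Omega p (e 0) (e 1) (e 2) : R^o).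
Local Notation rho := volume_density.

Lemma volume_densityE p a b c : Omega p a b c = rho (gchart B p) * \det (cols a b c).
Proof.
have [/(_ p) Op _ _] := Omega_vol.
have := trilinear_alternating_det 1%:M (cols a b c) Op; rewrite mul1mx.
have [-> -> ->] := colsE a b c.
rewrite ![col _ 1%:M]colE !mul1mx => ->.
by rewrite mulrC /volume_density in_chartE.
Qed.

Lemma volume_density_neq0 x : (gchart B @` setT) x -> rho x != 0.
Proof.
move=> [p _ <-]; have [_ _ /(_ p)[a [b [c]]]] := Omega_vol.
by rewrite volume_densityE mulf_eq0 negb_or => /andP[].
Qed.

Lemma volume_density_smooth : Csmooth (gchart B @` setT) rho.
Proof.
have [_ S _] := Omega_vol; apply: S; first exact: openT.
all: by apply: smooth_on_cst; exact: openT.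
Qed.

(** The divergence formula. Its first factor does not involve the arguments [Y1], [Y2], [Y3], so a
    single frame decides whether the Lie derivative vanishes at a point. *)
Lemma lie_form3E (A : set B) (X Y1 Y2 Y3 : B -> tangent R) p : open A -> A p ->
  smooth_on A X -> smooth_on A Y1 -> smooth_on A Y2 -> smooth_on A Y3 ->
  lie_form3 X Omega Y1 Y2 Y3 p =
  ('D_(X p) rho (gchart B p) + rho (gchart B p) * \tr (jac (in_chart X) (gchart B p)))
    * \det (cols (Y1 p) (Y2 p) (Y3 p)).
Proof.
move=> oA Ap CX C1 C2 C3; set x := gchart B p.
have oI : open (gchart B @` A) by apply/gchart_open.
have Ix : (gchart B @` A) x by exists p.
have Ux : (gchart B @` setT) x by exists p.
have br Y : smooth_on A Y -> bracket X Y p =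
    'D_(X p) (in_chart Y) x - jac (in_chart X) x *m Y p.
  move=> CY; rewrite /bracket /dirder -/x.
  by have [_ ->] := is_derive_jac (Y p) oI (CX 1%N) Ix.
pose M y := cols (in_chart Y1 y) (in_chart Y2 y) (in_chart Y3 y).
have dM := is_derive_cols (derive_dirP (X p) oI (C1 1%N) Ix)
  (derive_dirP (X p) oI (C2 1%N) Ix) (derive_dirP (X p) oI (C3 1%N) Ix).
have dr := is_derive_dir (X p) (@chart_range_open R B) (volume_density_smooth 1%N) Ux.
have fE : forall y, (gchart B @` A) y ->
    in_chart (fun q => Omega q (Y1 q) (Y2 q) (Y3 q) : R^o) y = rho y * \det (M y).
  by move=> _ [q Aq <-]; rewrite in_chartE volume_densityE /M !in_chartE.
have E : dirder (X p) (fun q => Omega q (Y1 q) (Y2 q) (Y3 q) : R^o) p =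
    'D_(X p) rho x * \det (M x) + rho x *
      ddet (M x) (cols ('D_(X p) (in_chart Y1) x) ('D_(X p) (in_chart Y2) x)
                       ('D_(X p) (in_chart Y3) x)).
  rewrite /dirder -/x (near_eq_derive _ (Ck_near oI Ix fE)).
  have [_ E1] := is_deriveM dr (is_derive_det dM).
  have [_ E2] := dr; rewrite E2.
  by apply: etrans E1 _; rewrite addrC mulrC.
have Mx : M x = cols (Y1 p) (Y2 p) (Y3 p) by rewrite /M !in_chartE.
rewrite /lie_form3 E (br _ C1) (br _ C2) (br _ C3) !volume_densityE -/x Mx.
exact: lie_algebra.
Qed.

Lemma coord_field_derive (c : local_coordinates B) i p : dom c p ->
  is_derive (gchart B p) (coord_field c i p) (in_chart (crd c)) (e i).
Proof.
move=> dp; have dF := param_diffeo c; have [oD oI _ CF Cg] := dF.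
have Dx : coord_range c (crd c p) by exists p.
have Ix : (param c @` coord_range c) (gchart B p) by rewrite param_image; exists p.
have E : coord_field c i p = jac (param c) (crd c p) *m e i.
  by have [_ <-] := is_derive_jac (e i) oD (CF 1%N) Dx.
rewrite E; apply: is_derive_eq (is_derive_jac _ oI (Cg 1%N) Ix) _.
by rewrite -(param_crd dp) mulmxA (diffeo_jac dF Dx) mul1mx.
Qed.

Lemma in_chart_crd (W : normedModType R) (c : local_coordinates B) (f : B -> W) (phi : V -> W) :
  (forall q, dom c q -> f q = phi (crd c q)) ->
  forall y, (param c @` coord_range c) y -> in_chart f y = phi (in_chart (crd c) y).
Proof. by move=> H; rewrite param_image => _ [q dq <-]; rewrite !in_chartE H. Qed.

Lemma dirder_coord (c : local_coordinates B) i (f phi : _ -> R) p : dom c p ->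
  Csmooth (coord_range c) phi -> (forall q, dom c q -> f q = phi (crd c q)) ->
  dirder (coord_field c i p) (f : B -> R^o) p = 'D_(e i) phi (crd c p).
Proof.
move=> dp Cphi fE; have [oD oI _ _ _] := param_diffeo c.
have Dx : coord_range c (crd c p) by exists p.
have Ix : (param c @` coord_range c) (gchart B p) by rewrite param_image; exists p.
rewrite /dirder (near_eq_derive _ (Ck_near oI Ix (in_chart_crd fE))).
have gx : in_chart (crd c) (gchart B p) = crd c p by rewrite in_chartE.
have Dx' := Dx; rewrite -gx in Dx'.
have [_ E1] := is_derive_comp oD (Cphi 1%N) Dx' (coord_field_derive i dp).
have [_ E2] := is_derive_dir (e i) oD (Cphi 1%N) Dx.
by rewrite gx in E1; exact: etrans E1 (esym E2).
Qed.

Lemma dirder_coord_mx (c : local_coordinates B) i (f : B -> V) (phi : V -> V) p : dom c p ->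
  Csmooth (coord_range c) phi -> (forall q, dom c q -> f q = phi (crd c q)) ->
  dirder (coord_field c i p) f p = 'D_(e i) phi (crd c p).
Proof.
move=> dp Cphi fE; have [oD oI _ _ _] := param_diffeo c.
have Dx : coord_range c (crd c p) by exists p.
have Ix : (param c @` coord_range c) (gchart B p) by rewrite param_image; exists p.
rewrite /dirder (near_eq_derive _ (Ck_near oI Ix (in_chart_crd fE))).
have gx : in_chart (crd c) (gchart B p) = crd c p by rewrite in_chartE.
have Dx' := Dx; rewrite -gx in Dx'.
have [_ E1] := derive_mx_comp oD (Cphi 1%N) Dx' (coord_field_derive i dp).
by rewrite gx in E1.
Qed.

Lemma coord_density (c : local_coordinates B) p : dom c p ->
  Omega p (coord_field c 0 p) (coord_field c 1 p) (coord_field c 2 p) =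
  density rho (param c) (crd c p).
Proof.
move=> dp; rewrite volume_densityE /density param_crd //; congr (_ * \det _).
by apply/matrixP => i j; rewrite !mxE; move: j; apply: forall_ord3.
Qed.

Lemma coord_field_smooth (c : local_coordinates B) i : smooth_on (dom c) (coord_field c i).
Proof.
have [oD oI gK CF Cg] := param_diffeo c.
rewrite /smooth_on -param_image.
have gD y : (param c @` coord_range c) y -> coord_range c (in_chart (crd c) y).
  by move=> [x Dx <-]; rewrite gK.
apply: Csmooth_ext oI _ (Csmooth_comp_mx oD oI (Csmooth_derive i CF) Cg gD).
by rewrite param_image => _ [p dp <-]; rewrite !in_chartE.
Qed.

Lemma Schwarz_cV A i j (f : V -> V) x : open A -> Ck 2 A f -> A x ->
  'D_(e i) ('D_(e j) f) x = 'D_(e j) ('D_(e i) f) x.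
Proof.
move=> oA Cf Ax; apply/colP => l.
have E a b : ('D_(e a) ('D_(e b) f) x) l 0 = 'D_(e a) ('D_(e b) (fun z => f z l 0)) x.
  have [_ <-] := is_derive_coord l 0 (Ck_is_derive a (Ck_derive b Cf) Ax).
  apply: near_eq_derive; apply: (Ck_near oA Ax) => y Ay.
  by have [_ ->] := is_derive_coord l 0 (Ck_is_derive b Cf Ay).
exact: etrans (E i j) (etrans (Schwarz i j oA ((Ck_cV _ _ oA).1 Cf l) Ax) (esym (E j i))).
Qed.

(** Read in the coordinates [c], each field is a partial derivative of [param c], so the bracket is
    the difference of two mixed second derivatives. *)
Lemma coord_bracket (c : local_coordinates B) i j p : dom c p ->
  bracket (coord_field c i) (coord_field c j) p = 0.
Proof.
move=> dp; have [oD _ _ CF _] := param_diffeo c.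
have Dx : coord_range c (crd c p) by exists p.
have C k : Csmooth (coord_range c) ('D_(e k) (param c)) by exact: Csmooth_derive.
have H k l : dirder (coord_field c k p) (coord_field c l) p =
    'D_(e k) ('D_(e l) (param c)) (crd c p) by exact: dirder_coord_mx dp (C l) _.
apply/eqP; rewrite /bracket subr_eq0; apply/eqP.
exact: etrans (H i j) (etrans (Schwarz_cV i j oD (CF 2%N) Dx) (esym (H j i))).
Qed.

Lemma density_smooth (c : local_coordinates B) :
  Csmooth (coord_range c) (density rho (param c)).
Proof.
have [oD _ _ CF _] := param_diffeo c.
exact: (Csmooth_density (@chart_range_open R B) oD volume_density_smooth CF (@param_range R B c)).
Qed.

Lemma sub3_zero (a b c d : R) : b = 0 -> c = 0 -> d = 0 -> a - b - c - d = a.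
Proof. by move=> -> -> ->; rewrite !subr0. Qed.

Lemma lie_coord_frame (c : local_coordinates B) i p : dom c p ->
  lie_form3 (coord_field c i) Omega (coord_field c 0) (coord_field c 1)
    (coord_field c 2) p = 'D_(e i) (density rho (param c)) (crd c p).
Proof.
move=> dp; have Z k := coord_bracket i k dp.
have w0 a b : [/\ Omega p 0 a b = 0, Omega p a 0 b = 0 & Omega p a b 0 = 0].
  have [/(_ p)[l1 l2 l3 _] _ _] := Omega_vol; split.
  - by have := l1 (-1) 0 0 a b; rewrite scaler0 addr0 mulN1r addNr.
  - by have := l2 (-1) a 0 0 b; rewrite scaler0 addr0 mulN1r addNr.
  - by have := l3 (-1) a b 0 0; rewrite scaler0 addr0 mulN1r addNr.
pose X k := coord_field c k.
have T1 : Omega p (bracket (X i) (X 0) p) (X 1 p) (X 2 p) = 0.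
  by rewrite (Z 0); have [] := w0 (X 1 p) (X 2 p).
have T2 : Omega p (X 0 p) (bracket (X i) (X 1) p) (X 2 p) = 0.
  by rewrite (Z 1); have [] := w0 (X 0 p) (X 2 p).
have T3 : Omega p (X 0 p) (X 1 p) (bracket (X i) (X 2) p) = 0.
  by rewrite (Z 2); have [] := w0 (X 0 p) (X 1 p).
apply: etrans (sub3_zero _ T1 T2 T3) _.
exact: dirder_coord dp (density_smooth c) (@coord_density c).
Qed.

(** On the coordinate frame the Lie derivative is a derivative of the density. The frame has nonzero
    determinant, so when this derivative vanishes the common factor in [lie_form3E] does too, and
    with it the Lie derivative on all arguments. *)
Lemma lie_coord_vanishes (c : local_coordinates B) i :
  lie_form3_vanishes_on (dom c) (coord_field c i) Omega <->
  forall x, coord_range c x -> 'D_(e i) (density rho (param c)) x = 0.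
Proof.
have od := dom_open c; have CF := coord_field_smooth c.
split=> [L _ [p dp <-]|H Y1 Y2 Y3 C1 C2 C3 p dp].
  by rewrite -(lie_coord_frame i dp); exact: L.
have Dx : coord_range c (crd c p) by exists p.
have := etrans (esym (lie_form3E od dp (CF i) (CF 0) (CF 1) (CF 2)))
  (etrans (lie_coord_frame i dp) (H _ Dx)).
have -> : cols (coord_field c 0 p) (coord_field c 1 p) (coord_field c 2 p) =
    jac (param c) (crd c p).
  by rewrite -coord_frameE; apply/matrixP => a b; rewrite !mxE; move: b; apply: forall_ord3.
move=> /eqP; rewrite mulf_eq0 => /orP[/eqP K|/eqP K].
  by apply: etrans (lie_form3E od dp (CF i) C1 C2 C3) _; rewrite K mul0r.
have := diffeo_unit (param_diffeo c) Dx; rewrite unitmxE K unitr0.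
by [].
Qed.

End Form.
End Volume.

(** * The four implications on a body *)

Section Integrability.
Context {R : realType} (B : body R) (h : tensor11 B).
Local Notation V := 'cV[R]_3.
Local Notation u := (u_mx R).
Local Notation U := (gchart B @` setT).

Lemma deformable_frame : deformable0 h u -> forall p,
  exists2 F : 'M[R]_3, F \in unitmx & h p *m F = F *m u.
Proof.
move=> hd p; have [F uF hF] := hd p; exists F => //.
by rewrite -hF mulmxA mulKVmx.
Qed.

Lemma deformable_cube : deformable0 h u -> forall x, U x ->
  in_chart h x *m in_chart h x *m in_chart h x = 0.
Proof.
move=> hd _ [p _ <-]; rewrite in_chartE; have [F uF hF] := deformable_frame hd p.
rewrite -[LHS](mulmxK uF).
have -> : h p *m h p *m h p *m F = F *m (u *m u *m u).
  by rewrite -[LHS]mulmxA hF mulmxA -(mulmxA (h p) (h p) F) hF !mulmxA hF.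
by rewrite u_cube mulmx0 mul0mx.
Qed.

Lemma integrable_nij : smooth_on setT h -> integrable_structure (Pbar h) ->
  forall x v w, U x -> nij (in_chart h) x v w = 0.
Proof.
move=> Ch hi _ v w [p _ <-]; have [c [dp ad]] := hi p.
have dF := param_diffeo c; have [oD _ _ CF _] := dF.
have Dx : coord_range c (crd c p) by exists p.
have uJ := diffeo_unit dF Dx; rewrite -(param_crd dp).
rewrite -[v](mulKVmx uJ) -[w](mulKVmx uJ).
have Cu : Ck 1 (coord_range c) (fun=> u) by exact: Ck_cst.
rewrite (nij_transport _ _ oD (@chart_range_open R B) (CF 2%N) (Ch 1%N) Cu
  (@param_range R B c) (adapted_intertwine ad) Dx).
rewrite /nij /nij_form.
have D0 a : 'D_a (fun=> u) (crd c p) = 0 :> 'M[R]_3.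
  by have [_ ->] := is_derive_cst u (crd c p) a.
by rewrite !D0 !mul0mx !mulmx0 !subr0 addr0 mulmx0.
Qed.

Lemma nij_integrable : smooth_on setT h -> deformable0 h u ->
  (forall x v w, U x -> nij (in_chart h) x v w = 0) -> integrable_structure (Pbar h).
Proof.
move=> Ch hd nh p; have [F0 uF0 hF0] := deformable_frame hd p.
have Up : U (gchart B p) by exists p.
have {}hF0 : in_chart h (gchart B p) *m F0 = F0 *m u by rewrite in_chartE.
have [D [F [g [dF D0 F00 DU HF]]]] := nilpotent_normal_form (@chart_range_open R B) Ch Up
  (deformable_cube hd) nh uF0 hF0.
have [c [c1 c2]] := coords_of_diffeo p dF DU.
exists c; split; first by apply: (c1 0).
move=> q /c2[x [Dx qx ->]]; apply/PbarE; split; first exact: (diffeo_unit dF Dx).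
by rewrite -(in_chartE h q) qx HF.
Qed.

Lemma unimodular_lie (Omega : form3 B) : volume_form Omega ->
  integrable_structure (Pvol h Omega) -> forall c : local_coordinates B,
  adapted c (Pbar h) -> lie_form3_vanishes_on (dom c) (coord_field c 0) Omega /\
    lie_form3_vanishes_on (dom c) (coord_field c 1) Omega.
Proof.
move=> vO hv c ad.
suff H x : coord_range c x ->
    'D_(Defs.basis R 0) (density (volume_density Omega) (param c)) x = 0 /\
    'D_(Defs.basis R 1) (density (volume_density Omega) (param c)) x = 0.
  by split; apply/(lie_coord_vanishes vO) => x /H[].
move=> [p dp <-]; have [c' [dp' ad']] := hv p.
have adb : adapted c' (Pbar h) by move=> q /ad'[].
have w1 y : coord_range c' y -> density (volume_density Omega) (param c') y = 1.
  move=> [q dq <-]; rewrite -(coord_density vO dq); have [_] := ad' _ dq.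
  have E j : col j (coord_frame c' q) = coord_field c' j q.
    by apply/colP => i; rewrite !mxE.
  by rewrite /= !E.
apply: (unimodular_derive (@chart_range_open R B) (volume_density_smooth vO)
  (param_diffeo c) (param_diffeo c') (@param_range R B c) (@param_range R B c')
  (adapted_intertwine ad) (adapted_intertwine adb) w1).
  by exists p.
by rewrite param_image param_crd //; exists p.
Qed.

Lemma lie_unimodular (Omega : form3 B) : volume_form Omega ->
  integrable_structure (Pbar h) ->
  (forall c : local_coordinates B, adapted c (Pbar h) ->
    lie_form3_vanishes_on (dom c) (coord_field c 0) Omega /\
    lie_form3_vanishes_on (dom c) (coord_field c 1) Omega) ->
  integrable_structure (Pvol h Omega).
Proof.
move=> vO hi hl p; have [c [dp ad]] := hi p; have [l0 l1] := hl c ad.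
have Dx : coord_range c (crd c p) by exists p.
have [D [F [g [dF D0 F0 DU HF]]]] := unimodular_exists (@chart_range_open R B)
  (volume_density_smooth vO) (volume_density_neq0 vO) (param_diffeo c)
  (@param_range R B c) (adapted_intertwine ad)
  (fun x cx => conj (((lie_coord_vanishes vO _ _).1 l0) x cx)
                    (((lie_coord_vanishes vO _ _).1 l1) x cx)) Dx.
have [c' [c1 c2]] := coords_of_diffeo p dF DU.
exists c'; split; first by apply: (c1 0); rewrite // F0 param_crd.
move=> q dq; have [x [Dx' qx Jx]] := c2 _ dq; have [HFx wx] := HF _ Dx'.
split.
  apply/PbarE; rewrite Jx; split; first exact: (diffeo_unit dF Dx').
  by rewrite -(in_chartE h q) qx.
by rewrite /= (volume_densityE vO) cols_col Jx qx.
Qed.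

End Integrability.

Theorem proposition6p42 (R : realType) (B : body R) (h : tensor11 B)
    (Omega : form3 B)
    (h_smooth : smooth_on setT h)
    (h_deformable : deformable0 h (u_mx R))
    (Omega_vol : volume_form Omega) :
  (integrable_structure (Pbar h) <-> nijenhuis_vanishes h) /\
  (integrable_structure (Pbar h) ->
    (integrable_structure (Pvol h Omega) <->
     forall c : local_coordinates B, adapted c (Pbar h) ->
       lie_form3_vanishes_on (dom c) (coord_field c 0%R) Omega /\
       lie_form3_vanishes_on (dom c) (coord_field c 1%R) Omega)).
Proof.
split=> [|hi]; split.
- by move=> hi; apply/(nijenhuis_vanishesP h_smooth); exact: integrable_nij.
- by move=> /(nijenhuis_vanishesP h_smooth); exact: nij_integrable.
- exact: unimodular_lie.
- exact: lie_unimodular.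
Qed.
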